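(* Let $d\ge 1$ be an integer, let $T>0$, let $H_1,H_2\in(0,1)$, and let $\mathbf{k}=(k_1,\dots,k_d)$ be a multi-index of nonnegative integers with $|\mathbf{k}|=\sum_{i=1}^d k_i$. Assume that $X^{H_1}=\{X^{H_1}_t:\, t\ge 0\}$ and $\widetilde{X}^{H_2}=\{\widetilde{X}^{H_2}_t:\, t\ge 0\}$ are two independent $d$-dimensional centered Gaussian processes in the class $G^d_{1,2}$ with parameters $H_1$ and $H_2$, respectively. For any $x\in\mathbb{R}^d$ with $x\neq 0$, if $\frac{H_1H_2}{H_1+H_2}(2|\mathbf{k}|+d)\ge 1$, then there exist positive constants $c_1$ and $c_2$ such that $$\liminf_{\varepsilon\downarrow 0}\frac{\mathbb{E}\big[|L^{(\mathbf{k})}_{\varepsilon}(T,x)|^2\big]}{h^{d,|\mathbf{k}|}_{H_1,H_2}(\varepsilon)}\ \ge\ c_1e^{-c_2|x|^2},$$ where $$h^{d,|\mathbf{k}|}_{H_1,H_2}(\varepsilon)=\begin{cases}\varepsilon^{\frac{H_1+H_2}{2H_1H_2}-\frac{d}{2}-|\mathbf{k}|} & \text{if } \frac{H_1H_2}{H_1+H_2}(2|\mathbf{k}|+d)>1,\\[4pt] \ln\big(1+\varepsilon^{-\frac12}\big) & \text{if } \frac{H_1H_2}{H_1+H_2}(2|\mathbf{k}|+d)=1.\end{cases}$$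
   Context: Class $G^d_1$. For $H\in(0,1)$, a $d$-dimensional centered Gaussian process $X^H=\{X^H_t: t\ge 0\}$ belongs to $G^d_1$ with parameter $H$ if its components $X^{H,\ell}$ ($1\le \ell\le d$) are independent and identically distributed and satisfy (P1) for any $T>0$ there exist two positive constants $\kappa_{T,1,H}\le\kappa_{T,2,H}$, depending only on $T$ and $H$, such that for any $0\le s<t<T$, $$\kappa_{T,1,H}(t-s)^{2H}\le \mathbb{E}\big[(X^{H,\ell}_t-X^{H,\ell}_s)^2\big]\le \kappa_{T,2,H}(t-s)^{2H}.$$ Class $G^d_{1,2}$. It consists of the processes in $G^d_1$ that also satisfy, on the time horizon $T$ under consideration, (P2) there exists a nonnegative decreasing function $\beta:(1,\infty)\to\mathbb{R}$ with $\lim_{\gamma\to\infty}\beta(\gamma)=0$ such that, for every $\gamma>1$ and any $0<s<t<T$ with $\frac{t-s}{s}\le\frac1\gamma$, $$\Big|\mathbb{E}\big[(X^{H,\ell}_t-X^{H,\ell}_s)X^{H,\ell}_s\big]\Big|\le \beta(\gamma)\Big[\mathbb{E}\big(X^{H,\ell}_t-X^{H,\ell}_s\big)^2\Big]^{\frac12}\Big[\mathbb{E}\big(X^{H,\ell}_s\big)^2\Big]^{\frac12}.$$ Approximate derivatives of local time. For $\varepsilon>0$ let $p_\varepsilon(x)=\frac{1}{(2\pi\varepsilon)^{d/2}}e^{-\frac{|x|^2}{2\varepsilon}}$, $x\in\mathbb{R}^d$, where $|x|$ is the Euclidean norm, and $$p^{(\mathbf{k})}_\varepsilon(x)=\frac{\partial^{|\mathbf{k}|}}{\partial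 x_1^{k_1}\cdots\partial x_d^{k_d}}p_\varepsilon(x).$$ For $T>0$ and $x\in\mathbb{R}^d$ define $$L^{(\mathbf{k})}_\varepsilon(T,x)=\int_0^T\int_0^T p^{(\mathbf{k})}_\varepsilon\big(X^{H_1}_t-\widetilde{X}^{H_2}_s+x\big)\,ds\,dt.$$ (By (P1) the processes admit versions with continuous paths; the integral is understood for such versions.) *)

(* Defs.v *)
From HB Require Import structures.
From mathcomp Require Import all_boot all_order all_algebra.
From mathcomp Require Import all_classical all_reals all_analysis.

Set Implicit Arguments.
Unset Strict Implicit.
Unset Printing Implicit Defensive.

Import Order.TTheory GRing.Theory Num.Theory.
Import numFieldNormedType.Exports.

Local Open Scope classical_set_scope.
Local Open Scope ring_scope.

(* A d-dimensional process {X_t : t >= 0} is a map X : R -> 'I_d -> {RV P >-> R},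
   X t l being the l-th component at time t. All notions below only look at
   times t >= 0, so the values of X at negative times are irrelevant. *)

(* s = 0 is the degenerate law at m; normal_prob m 0 is a different, dummy law *)
Definition gaussian_law {R : realType} (m s : R) (B : set R) : \bar R :=
  if s == 0 then \d_m B else normal_prob m s B.

Definition gaussian_rv {R : realType} {dO : measure_display}
    {Omega : measurableType dO} (P : probability Omega R) (Y : Omega -> R) : Prop :=
  exists m s : R, 0 <= s /\
    forall B : set R, measurable B -> P (Y @^-1` B) = gaussian_law m s B.

Definition gaussian_process {R : realType} {dO : measure_display}
    {Omega : measurableType dO} (P : probability Omega R) (d : nat)
    (X : R -> 'I_d -> {RV P >-> R}) : Prop :=
  forall (n : nat) (a t : 'I_n -> R) (l : 'I_n -> 'I_d),
    (forall i, 0 <= t i) ->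
    gaussian_rv P (fun w => \sum_(i < n) a i * X (t i) (l i) w).

Definition centered_process {R : realType} {dO : measure_display}
    {Omega : measurableType dO} (P : probability Omega R) (d : nat)
    (X : R -> 'I_d -> {RV P >-> R}) : Prop :=
  forall (t : R) (l : 'I_d), 0 <= t -> ('E_P[X t l] = 0)%E.

Definition continuous_paths {R : realType} {dO : measure_display}
    {Omega : measurableType dO} (P : probability Omega R) (d : nat)
    (X : R -> 'I_d -> {RV P >-> R}) : Prop :=
  forall (w : Omega) (l : 'I_d),
    {within `[0, +oo[%classic, continuous (fun t : R => X t l w)}.

(* the sigma-algebra generated by the variables X t l, t >= 0, l \in A *)
Definition sigma_process {R : realType} {dO : measure_display}
    {Omega : measurableType dO} (P : probability Omega R) (d : nat)
    (X : R -> 'I_d -> {RV P >-> R}) (A : set 'I_d) : set (set Omega) :=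
  <<s [set E | exists (t : R) (l : 'I_d) (B : set R),
         [/\ 0 <= t, A l, measurable B & E = X t l @^-1` B]] >>.

Definition independent_processes {R : realType} {dO : measure_display}
    {Omega : measurableType dO} (P : probability Omega R) (d : nat)
    (X Y : R -> 'I_d -> {RV P >-> R}) : Prop :=
  forall E F : set Omega, sigma_process X setT E -> sigma_process Y setT F ->
    P (E `&` F) = (P E * P F)%E.

(* Mutual independence; subfamilies are covered by taking E l = setT. *)
Definition independent_components {R : realType} {dO : measure_display}
    {Omega : measurableType dO} (P : probability Omega R) (d : nat)
    (X : R -> 'I_d -> {RV P >-> R}) : Prop :=
  forall E : 'I_d -> set Omega, (forall l, sigma_process X [set l] (E l)) ->
    P (\bigcap_l E l) = (\prod_(l < d) P (E l))%E.

Definition identically_distributed_components {R : realType}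
    {dO : measure_display} {Omega : measurableType dO} (P : probability Omega R)
    (d : nat) (X : R -> 'I_d -> {RV P >-> R}) : Prop :=
  forall (l l' : 'I_d) (n : nat) (t : 'I_n -> R) (B : set (n.-tuple R)),
    (forall i, 0 <= t i) -> measurable B ->
    P ((fun w => [tuple X (t i) l w | i < n]) @^-1` B) =
    P ((fun w => [tuple X (t i) l' w | i < n]) @^-1` B).

Definition property_P1 {R : realType} {dO : measure_display}
    {Omega : measurableType dO} (P : probability Omega R) (d : nat) (H : R)
    (X : R -> 'I_d -> {RV P >-> R}) : Prop :=
  forall T : R, 0 < T ->
    exists kappa1 kappa2 : R, [/\ 0 < kappa1, kappa1 <= kappa2 &
      forall (l : 'I_d) (s t : R), 0 <= s -> s < t -> t < T ->
        ((kappa1 * (t - s) `^ (2 * H))%:E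
           <= 'E_P[(fun w => (X t l w - X s l w) ^+ 2)%R])%E /\
        ('E_P[(fun w => (X t l w - X s l w) ^+ 2)%R]
           <= (kappa2 * (t - s) `^ (2 * H))%:E)%E].

(* "decreasing" is taken in the weak sense, which is the more general hypothesis *)
Definition property_P2 {R : realType} {dO : measure_display}
    {Omega : measurableType dO} (P : probability Omega R) (d : nat) (T : R)
    (X : R -> 'I_d -> {RV P >-> R}) : Prop :=
  exists beta : R -> R,
    [/\ forall g, 1 < g -> 0 <= beta g,
        forall g1 g2, 1 < g1 -> g1 <= g2 -> beta g2 <= beta g1,
        beta g @[g --> +oo] --> (0 : R) &
        forall (l : 'I_d) (g s t : R), 1 < g -> 0 < s -> s < t -> t < T ->
          (t - s) / s <= 1 / g ->
          (`|'E_P[(fun w => (X t l w - X s l w) * X s l w)%R]|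
             <= (beta g)%:E
                * 'E_P[(fun w => (X t l w - X s l w) ^+ 2)%R] `^ 2^-1
                * 'E_P[(fun w => X s l w ^+ 2)%R] `^ 2^-1)%E].

Record class_G1 {R : realType} {dO : measure_display}
    {Omega : measurableType dO} (P : probability Omega R) (d : nat) (H : R)
    (X : R -> 'I_d -> {RV P >-> R}) : Prop := {
  G1_gaussian : gaussian_process X;
  G1_centered : centered_process X;
  G1_independent : independent_components X;
  G1_identical : identically_distributed_components X;
  G1_P1 : property_P1 H X }.

Record class_G12 {R : realType} {dO : measure_display}
    {Omega : measurableType dO} (P : probability Omega R) (d : nat) (H T : R)
    (X : R -> 'I_d -> {RV P >-> R}) : Prop := {
  G12_G1 : class_G1 H X;
  G12_P2 : property_P2 T X }.

(* the library norm `|x| of a row vector is the sup norm *)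
Definition enorm {R : realType} {d : nat} (x : 'rV[R]_d) : R :=
  Num.sqrt (\sum_(i < d) x 0 i ^+ 2).

Definition heat_kernel {R : realType} {d : nat} (eps : R) (x : 'rV[R]_d) : R :=
  1 / (2 * pi * eps) `^ (d%:R / 2) * expR (- (enorm x ^+ 2 / (2 * eps))).

Definition partial {R : realType} {d : nat} (i : 'I_d) (f : 'rV[R]_d -> R) :
    'rV[R]_d -> R :=
  fun x => 'D_(delta_mx 0 i) f x.

Definition multi_partial {R : realType} {d : nat} (k : 'I_d -> nat)
    (f : 'rV[R]_d -> R) : 'rV[R]_d -> R :=
  foldr (fun i g => iter (k i) (partial i) g) f (enum 'I_d).

Definition order_of {d : nat} (k : 'I_d -> nat) : nat := (\sum_(i < d) k i)%N.

Definition local_time {R : realType} {dO : measure_display}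
    {Omega : measurableType dO} (P : probability Omega R) (d : nat)
    (X Y : R -> 'I_d -> {RV P >-> R}) (k : 'I_d -> nat) (eps T : R)
    (x : 'rV[R]_d) (w : Omega) : R :=
  \int[lebesgue_measure]_(t in `[0, T])
    \int[lebesgue_measure]_(s in `[0, T])
      multi_partial k (heat_kernel eps)
        (\row_(l < d) X t l w - \row_(l < d) Y s l w + x).

Definition h_rate {R : realType} (d m : nat) (H1 H2 eps : R) : R :=
  if 1 < H1 * H2 / (H1 + H2) * (2 * m%:R + d%:R)
  then eps `^ ((H1 + H2) / (2 * H1 * H2) - d%:R / 2 - m%:R)
  else ln (1 + eps `^ (- (1 / 2))).

(* Main.v *)
(* The second moment E|L_eps|^2 is the integral over ]0,T[^4 of the covariance
   kernel K(t,s,t',s') = E[p^(k)(Z) p^(k)(Z')], where Z = X_t - Y_s + x and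
   Z' = X_t' - Y_s' + x.  Differentiating the joint Gaussian density, K is a product
   of Gaussian factors times Wick polynomials in the entries of the inverse
   covariance matrix.  With r^2 = E(Z - Z')^2 + 2 eps one gets |K| <= C r^(-d-2|k|)
   everywhere, because the Gaussian factor exp(-|x|^2/2v), with v the conditional
   variance, kills all negative powers of v when x <> 0.  Near the diagonal and away
   from time 0, (P2) makes Z and Z - Z' almost uncorrelated; then the leading term of
   the Wick polynomial is positive, so that K is almost nonnegative there, and
   K >= c r^(-d-2|k|) on a box where Var X_t is bounded below.  The remaining
   (t,s) have small measure, so E|L_eps|^2 is at least a constant times the
   integral J(eps) of (|u|^(2 H1) + |w|^(2 H2) + eps)^(-|k|-d/2) near 0, minus a
   constant.  Finally J(eps) dominates h(eps), which tends to infinity.  Since x is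
   fixed, a positive lower bound for the liminf suffices. *)
Require Import Defs.
From HB Require Import structures.
From mathcomp Require Import all_boot all_order all_algebra.
From mathcomp Require Import all_classical all_reals all_analysis.
From mathcomp Require Import measurable_realfun.
From mathcomp Require Import ring lra zify.

Set Implicit Arguments.
Unset Strict Implicit.
Unset Printing Implicit Defensive.

Import Order.TTheory GRing.Theory Num.Theory.
Import numFieldNormedType.Exports.

Local Open Scope classical_set_scope.
Local Open Scope ring_scope.

(** Only the laws of linear combinations are given, and the covariance matrix of (Z, Z') may be
    singular, so there need not be a density of the pair to differentiate. The heat kernel is
    therefore written as a cosine transform: [heat1 eps 0 z] is a constant times the mean of cos (xi
    z), with xi normal of variance 1 / eps. Fubini leaves the characteristic function of (Z, Z') and
    two Gaussian integrals, which only see the covariance matrix plus eps times the identity.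
    Derivatives come afterwards, by differentiating in the shifts of the two factors. For fixed eps
    every integrand is bounded and every measure finite, so integrability and Fubini become closure
    properties of one class of functions; uniformity in eps is a matter for the estimates alone. The
    sign is a matter of Wick pairings. Without the linear arguments [al] and [be], a self-pairing
    contributes -A or -B and a cross pairing C. Both factors carry the same order k l, so
    self-pairings occur equally often on either side and the signs cancel, for odd k l too. The
    distance from this case is measured by one parameter t. *)

(** * Bounded measurable functions and finite measures *)

Definition bounded_measurable {R : realType} {d} {S : measurableType d}
  (f : S -> R) := measurable_fun setT f /\ exists M, forall x, `|f x| <= M.

Section bounded_measurable.
Context {R : realType} {d} {S : measurableType d}.
Implicit Types (f g : S -> R) (mu : {finite_measure set S -> \bar R}).
Notation bmf := bounded_measurable.

Lemma bmf_integrable mu f : bmf f -> mu.-integrable setT (EFin \o f).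
Proof.
move=> [mf [M fM]]; apply: measurable_bounded_integrable => //.
  by rewrite -ge0_fin_numE// fin_num_measure.
exists M; split; first exact: num_real.
by move=> y My x _ /=; exact: le_trans (fM x) (ltW My).
Qed.

Lemma bmf_cst (c : R) : bmf (fun _ : S => c).
Proof. by split; [exact: measurable_cst | exists `|c|]. Qed.

Lemma bmfD f g : bmf f -> bmf g -> bmf (fun x => f x + g x).
Proof.
move=> [mf [M fM]] [mg [N gN]]; split; first exact: measurable_funD.
exists (M + N) => x; exact: le_trans (ler_normD _ _) (lerD (fM x) (gN x)).
Qed.

Lemma bmfN f : bmf f -> bmf (fun x => - f x).
Proof.
move=> [mf [M fM]]; split; first exact: measurable_funN.
by exists M => x; rewrite normrN.
Qed.

Lemma bmfB f g : bmf f -> bmf g -> bmf (fun x => f x - g x).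
Proof. by move=> bf bg; apply: bmfD => //; exact: bmfN. Qed.

Lemma bmfM f g : bmf f -> bmf g -> bmf (fun x => f x * g x).
Proof.
move=> [mf [M fM]] [mg [N gN]]; split; first exact: measurable_funM.
by exists (M * N) => x; rewrite normrM; apply: ler_pM.
Qed.

Lemma bmfZ c f : bmf f -> bmf (fun x => c * f x).
Proof. by move=> bf; apply: bmfM => //; exact: bmf_cst. Qed.

Lemma bmf_prod (I : Type) (s : seq I) (F : I -> S -> R) :
  (forall i, bmf (F i)) -> bmf (fun x => \prod_(i <- s) F i x).
Proof.
move=> bF; elim: s => [|i s IH].
  by under eq_fun do rewrite big_nil; exact: bmf_cst.
by under eq_fun do rewrite big_cons; apply: bmfM.
Qed.

Lemma bmf_indic (A : set S) : measurable A -> bmf (\1_A : S -> R).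
Proof.
move=> mA; split; first exact: measurable_indic.
by exists 1 => x; rewrite indicE ger0_norm ?ler_nat//; case: (_ \in _).
Qed.

Lemma bmf_RintegralD mu f g : bmf f -> bmf g ->
  \int[mu]_x (f x + g x) = \int[mu]_x f x + \int[mu]_x g x.
Proof. by move=> bf bg; apply: RintegralD => //; exact: bmf_integrable. Qed.

Lemma bmf_RintegralB mu f g : bmf f -> bmf g ->
  \int[mu]_x (f x - g x) = \int[mu]_x f x - \int[mu]_x g x.
Proof. by move=> bf bg; apply: RintegralB => //; exact: bmf_integrable. Qed.

Lemma bmf_RintegralZl mu c f : bmf f ->
  \int[mu]_x (c * f x) = c * \int[mu]_x f x.
Proof. by move=> bf; apply: RintegralZl => //; exact: bmf_integrable. Qed.

Lemma bmf_RintegralZr mu c f : bmf f ->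
  \int[mu]_x (f x * c) = (\int[mu]_x f x) * c.
Proof. by move=> bf; apply: RintegralZr => //; exact: bmf_integrable. Qed.

Lemma bmf_le_Rintegral mu f g : bmf f -> bmf g -> (forall x, f x <= g x) ->
  \int[mu]_x f x <= \int[mu]_x g x.
Proof.
by move=> bf bg fg; apply: le_Rintegral => //; exact: bmf_integrable.
Qed.

Lemma bmf_RintegralE mu f : bmf f ->
  ((\int[mu]_x f x)%:E = \int[mu]_x (f x)%:E)%E.
Proof.
by move=> bf; rewrite /Rintegral fineK//; apply: integrable_fin_num => //;
  exact: bmf_integrable.
Qed.

Lemma Rintegral_cstT mu c : \int[mu]_(_ in setT) c = c * fine (mu setT).
Proof. by rewrite Rintegral_cst. Qed.

Lemma bmf_le_norm_Rintegral mu f (M : R) : bmf f -> (forall x, `|f x| <= M) ->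
  `|\int[mu]_x f x| <= M * fine (mu setT).
Proof.
move=> bf fM; apply: le_trans (le_normr_Rintegral _ (bmf_integrable mu bf)) _ => //.
rewrite -Rintegral_cstT; apply: bmf_le_Rintegral => //; last exact: bmf_cst.
case: bf => mf _; split; first exact: measurableT_comp.
by exists M => x; rewrite normr_id.
Qed.

End bounded_measurable.

Lemma bmf_comp {R : realType} {d1 d2} {S1 : measurableType d1}
    {S2 : measurableType d2} (f : S1 -> R) (phi : S2 -> S1) :
  measurable_fun setT phi -> bounded_measurable f ->
  bounded_measurable (fun x => f (phi x)).
Proof.
move=> mphi [mf [M fM]]; split; first exact: (measurableT_comp mf mphi).
by exists M.
Qed.

Section bounded_measurable_product.
Context {R : realType} {d1 d2} {S1 : measurableType d1} {S2 : measurableType d2}.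
Variables (m1 : {finite_measure set S1 -> \bar R}).
Variables (m2 : {finite_measure set S2 -> \bar R}).
Implicit Types (f : S1 * S2 -> R).
Notation bmf := bounded_measurable.

Lemma bmf_integrable_prod f : bmf f ->
  (m1 \x m2)%E.-integrable setT (EFin \o f).
Proof.
move=> [mf [M fM]]; apply/integrable12ltyP.
  exact/measurable_EFinP.
have m1T : (m1 setT < +oo)%E by rewrite -ge0_fin_numE// fin_num_measure.
have m2T : (m2 setT < +oo)%E by rewrite -ge0_fin_numE// fin_num_measure.
have mn : measurable_fun setT (fun z => `|(f z)%:E|%E).
  by apply/measurableT_comp => //; exact/measurable_EFinP.
have M0 (x : S1 * S2) : 0 <= M by apply: le_trans (fM x).
apply: (@le_lt_trans _ _ (\int[m1]_x (`|M|%:E * m2 setT))%E).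
  apply: ge0_le_integral => //.
  - by move=> x _; apply: integral_ge0.
  - exact: (measurable_fun_fubini_tonelli_F (m2 := m2) _ mn (fun=> abse_ge0 _)).
  - move=> x _; rewrite -integral_cst//; apply: ge0_le_integral => //.
      exact: (measurableT_comp mn (pair1_measurable x)).
    by move=> y _; rewrite abse_EFin lee_fin; apply: le_trans (fM _) (ler_norm _).
by rewrite integral_cst// ltey_eq !fin_numM// fin_num_measure.
Qed.

Lemma bmf_Rintegral f : bmf f -> bmf (fun x => \int[m2]_y f (x, y)).
Proof.
move=> bf; have [mf [M fM]] := bf; split; last first.
  exists (M * fine (m2 setT)) => x; apply: bmf_le_norm_Rintegral => //.
  by apply: (bmf_comp _ bf); exact: pair1_measurable.
(* Measurability of a partial integral is known for nonnegative functions; adding the bound [M]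
   reduces to that case. *)
pose g z := f z + M.
have bg : bmf g by apply: bmfD => //; exact: bmf_cst.
have g0 z : (0 <= (g z)%:E)%E.
  by rewrite lee_fin /g -lerBlDr sub0r; have := fM z; rewrite ler_norml => /andP[].
have mF : measurable_fun setT (fun x => \int[m2]_y (g (x, y))%:E)%E.
  apply: (measurable_fun_fubini_tonelli_F (m2 := m2) (EFin \o g) _ g0).
  by apply/measurable_EFinP; case: bg.
have -> : (fun x => \int[m2]_y f (x, y)) =
    (fun x => fine (\int[m2]_y (g (x, y))%:E)%E - M * fine (m2 setT)).
  apply/funext => x; rewrite -/(Rintegral _ _ _) /g bmf_RintegralD.
  - by rewrite Rintegral_cstT addrK.
  - by apply: (bmf_comp _ bf); exact: pair1_measurable.
  - exact: bmf_cst.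
apply: measurable_funB; last exact: measurable_cst.
exact: (measurableT_comp (fine_measurable measurableT) mF).
Qed.

End bounded_measurable_product.

Lemma bmf_Fubini {R : realType} {d1 d2} {S1 : measurableType d1}
  {S2 : measurableType d2} (m1 : {finite_measure set S1 -> \bar R})
  (m2 : {finite_measure set S2 -> \bar R}) (f : S1 * S2 -> R) :
  bounded_measurable f ->
  \int[m1]_x \int[m2]_y f (x, y) = \int[m2]_y \int[m1]_x f (x, y).
Proof.
move=> bf; have H := Fubini (bmf_integrable_prod m1 m2 bf).
have E1 : (\int[m1]_x (\int[m2]_y f (x, y))%:E =
    \int[m1]_x \int[m2]_y (f (x, y))%:E)%E.
  apply: eq_integral => x _; rewrite bmf_RintegralE//.
  by apply: (bmf_comp _ bf); exact: pair1_measurable.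
have E2 : (\int[m2]_y (\int[m1]_x f (x, y))%:E =
    \int[m2]_y \int[m1]_x (f (x, y))%:E)%E.
  apply: eq_integral => y _; rewrite bmf_RintegralE//.
  by apply: (bmf_comp _ bf); exact: pair2_measurable.
by rewrite [LHS](congr1 fine E1) [RHS](congr1 fine E2); congr fine.
Qed.

(** * Calculus on the real line and the normal density *)

Section real_derivatives.
Context {R : realType}.
Implicit Types (f g : R -> R) (x a b c : R).

Lemma drv_cst c x : is_derive x 1 (fun _ : R => c : R) (0 : R).
Proof. exact: is_derive_cst. Qed.

Lemma drv_id x : is_derive x 1 (fun y : R => y) (1 : R).
Proof. exact: is_derive_id. Qed.

Lemma drvD f g x a b : is_derive x 1 f a -> is_derive x 1 g b ->
  is_derive x 1 (fun y => f y + g y) (a + b).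
Proof. by move=> ? ?; exact: is_deriveD. Qed.

Lemma drvN f x a : is_derive x 1 f a -> is_derive x 1 (fun y => - f y) (- a).
Proof. by move=> ?; exact: is_deriveN. Qed.

Lemma drvM f g x a b : is_derive x 1 f a -> is_derive x 1 g b ->
  is_derive x 1 (fun y => f y * g y) (a * g x + f x * b).
Proof.
move=> df dg; have H := @is_deriveM R _ f g x 1 a b df dg.
by apply: (@is_derive_eq _ _ _ _ _ _ _ _ H); rewrite addrC /GRing.scale/= [g x * a]mulrC.
Qed.

Lemma drvZ f x a c : is_derive x 1 f a -> is_derive x 1 (fun y => c * f y) (c * a).
Proof.
move=> df; have H := drvM (drv_cst c x) df.
by apply: (@is_derive_eq _ _ _ _ _ _ _ _ H); rewrite mul0r add0r.
Qed.

Lemma drv_expR f x a : is_derive x 1 f a ->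
  is_derive x 1 (fun y => expR (f y)) (expR (f x) * a).
Proof. by move=> df; exact: (is_derive1_comp (is_derive_expR _) df). Qed.

Lemma drv_cos f x a : is_derive x 1 f a ->
  is_derive x 1 (fun y => cos (f y)) (- sin (f x) * a).
Proof. by move=> df; exact: (is_derive1_comp (is_derive_cos _) df). Qed.

Lemma drv_sin f x a : is_derive x 1 f a ->
  is_derive x 1 (fun y => sin (f y)) (cos (f x) * a).
Proof. by move=> df; exact: (is_derive1_comp (is_derive_sin _) df). Qed.

Lemma drv_eq f x a b : is_derive x 1 f a -> a = b -> is_derive x 1 f b.
Proof. by move=> + <-. Qed.

Lemma drv_derivable f x a : is_derive x 1 f a -> derivable f x 1.
Proof. by case. Qed.

Lemma drv_val f x a : is_derive x 1 f a -> f^`()%classic x = a.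
Proof. by move=> df; rewrite derive1E; exact: derive_val. Qed.

Lemma drv_continuous f (f' : R -> R) :
  (forall x, is_derive x 1 f (f' x)) -> continuous f.
Proof.
move=> df x; apply: differentiable_continuous; apply/derivable1_diffP.
exact: drv_derivable (df x).
Qed.

End real_derivatives.

Section gaussian_density.
Context {R : realType}.
Variables (m s : R).
Hypothesis s0 : 0 < s.
Notation mu := (@lebesgue_measure R).
Notation phi := (normal_pdf m s).

Let sN0 : s != 0. Proof. exact: lt0r_neq0. Qed.

Lemma drv_normal_pdf (x : R) :
  is_derive x 1 (phi : R -> R) (- ((x - m) / s ^+ 2) * phi x : R).
Proof.
have -> : phi = fun y => normal_peak s *
    expR (- ((s ^+ 2 *+ 2)^-1) * ((y - m) * (y - m))).
  apply/funext => y; rewrite normal_pdfE// /normal_fun.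
  by congr (_ * expR _); rewrite -expr2 mulNr mulNr mulrC.
have d1 : is_derive x 1 (fun y : R => y - m) (1 - 0).
  by apply: (drvD (drv_id x)); apply: drvN; exact: drv_cst.
have := drvZ (normal_peak s) (drv_expR (drvZ (- ((s ^+ 2 *+ 2)^-1)) (drvM d1 d1))).
move/drv_eq; apply; rewrite -[s ^+ 2 *+ 2]mulr_natl; field; exact: sN0.
Qed.

Lemma continuous_normal_density : continuous phi.
Proof. exact: continuous_normal_pdf. Qed.

(** Half of the exponent pays for the quadratic weight: with u = x - m, 1 + u^2 is at most (1 + 4
    s^2) exp (u^2 / (4 s^2)), and what is left of the exponential has the shape of the normal
    density of standard deviation s sqrt 2. That density is the integrable majorant for all the
    moments below. *)
Lemma normal_pdf_moment_bound : exists2 C : R, 0 <= C &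
  forall x, (1 + (x - m) ^+ 2) * phi x <= C * normal_pdf m (s * Num.sqrt 2) x.
Proof.
have s2 : s * Num.sqrt 2 != 0 by rewrite mulf_neq0// sqrtr_eq0 -ltNge.
have sq2 : (s * Num.sqrt 2) ^+ 2 = 2 * s ^+ 2.
  by rewrite exprMn sqr_sqrtr// mulrC.
pose a := normal_peak s; pose b := normal_peak (s * Num.sqrt 2).
have b0 : 0 < b by rewrite normal_peak_gt0.
exists (a * (1 + 4 * s ^+ 2) / b).
  by rewrite divr_ge0 ?(ltW b0)// mulr_ge0 ?normal_peak_ge0//; nra.
move=> x; rewrite !normal_pdfE//= -/a -/b.
have -> y : a * (1 + 4 * s ^+ 2) / b * (b * y) = a * ((1 + 4 * s ^+ 2) * y).
  by field; exact: lt0r_neq0.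
rewrite mulrCA ler_wpM2l ?normal_peak_ge0// /normal_fun sq2; set u := x - m.
have -> : - u ^+ 2 / (s ^+ 2 *+ 2) =
    - (u ^+ 2 / (4 * s ^+ 2)) + - u ^+ 2 / (2 * s ^+ 2 *+ 2).
  by rewrite -[s ^+ 2 *+ 2]mulr_natl -[2 * s ^+ 2 *+ 2]mulr_natl; field.
rewrite expRD mulrA ler_wpM2r ?expR_ge0//.
have E : expR (u ^+ 2 / (4 * s ^+ 2)) * expR (- (u ^+ 2 / (4 * s ^+ 2))) = 1.
  by rewrite -expRD subrr expR0.
have p0 := expR_gt0 (- (u ^+ 2 / (4 * s ^+ 2))).
have := expR_ge1Dx (u ^+ 2 / (4 * s ^+ 2)).
set e := expR (_ / _) in E *; set e' := expR (- _) in E p0 *.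
move=> le; suff : 1 + u ^+ 2 <= (1 + 4 * s ^+ 2) * e.
  move/(ler_wpM2r (ltW p0)); rewrite -mulrA E mulr1; exact.
have s20 : 0 < s ^+ 2 by rewrite exprn_gt0.
apply: (@le_trans _ _ ((1 + 4 * s ^+ 2) * (1 + u ^+ 2 / (4 * s ^+ 2)))).
  have -> : (1 + 4 * s ^+ 2) * (1 + u ^+ 2 / (4 * s ^+ 2)) =
     1 + u ^+ 2 + (4 * s ^+ 2 + u ^+ 2 / (4 * s ^+ 2)) by field.
  rewrite lerDl addr_ge0//; first by rewrite mulr_ge0// ltW.
  by rewrite divr_ge0 ?sqr_ge0// mulr_ge0// ltW.
by rewrite ler_wpM2l// addr_ge0// mulr_ge0// ltW.
Qed.

Lemma normal_pdf_integrable_moment (g : R -> R) (K : R) :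
  measurable_fun setT g -> (forall x, `|g x| <= K * (1 + (x - m) ^+ 2)) ->
  mu.-integrable setT (EFin \o (fun x => g x * phi x)).
Proof.
move=> mg gK; have [C C0 HC] := normal_pdf_moment_bound.
have K0 : 0 <= K.
  have := le_trans (normr_ge0 _) (gK m); rewrite subrr expr0n /= addr0 mulr1.
  exact.
have I := integrable_normal_pdf m (s * Num.sqrt 2).
have I2 := integrableZl measurableT (K * C) I.
apply: (le_integrable measurableT _ _ I2).
  apply/measurable_EFinP; apply: measurable_funM => //.
  exact: measurable_normal_pdf.
move=> x _; rewrite /= lee_fin normrM [`|phi x|]ger0_norm ?normal_pdf_ge0//.
apply: (le_trans _ (ler_norm _)).
apply: (le_trans (ler_wpM2r (normal_pdf_ge0 _ _ _) (gK x))).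
by rewrite -!mulrA ler_wpM2l.
Qed.

End gaussian_density.

(** The fundamental theorem of calculus on [-n, n] gives H n - H (-n), which tends to 0 by the last
    hypothesis; dominated convergence passes to the whole line. *)
Lemma Rintegral_derive_eq0 {R : realType} (H h : R -> R) (C : R) :
  (forall x : R, is_derive x 1 (H : R -> R) (h x : R)) -> continuous h ->
  (@lebesgue_measure R).-integrable setT (EFin \o h) ->
  (forall n : nat, `|H n%:R - H (- n%:R)| <= C * n.+1%:R^-1) ->
  \int[lebesgue_measure]_x h x = 0.
Proof.
move=> dH ch ih HC.
pose f_ (n : nat) (x : R) := ((h \_ `[- n%:R, n%:R]) x)%:E.
have cf : continuous H by exact: drv_continuous dH.
have L := @dominated_cvg _ _ R lebesgue_measure setT measurableT f_
   (EFin \o h) (fun x => `|(h x)%:E|%E).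
have mh : measurable_fun setT h by exact: continuous_measurable_fun.
have {}L : (\int[lebesgue_measure]_x f_ n x @[n --> \oo] -->
    \int[lebesgue_measure]_x (h x)%:E)%E.
  apply: L.
  - move=> n; apply/measurable_EFinP; apply/(measurable_restrictT _ _).1 => //.
    exact: measurable_funTS.
  - move=> x _; apply: cvg_near_cst; near=> n.
    rewrite /f_ patchE ifT// inE /= in_itv/= -ler_norml.
    near: n; exact: nbhs_infty_ger.
  - by [].
  - exact: integrable_abse.
  - move=> n x _; rewrite /f_ patchE; case: ifPn => _ //.
    by rewrite abse0.
(* The index is shifted because the fundamental theorem is applied on a nondegenerate interval,
   which [-0, 0] is not. *)
have E n : (\int[lebesgue_measure]_x f_ n.+1 x)%E = (H n.+1%:R - H (- n.+1%:R))%:E.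
  transitivity (\int[lebesgue_measure]_(x in `[(- n.+1%:R)%R, (n.+1%:R)%R]) (h x)%:E)%E.
    rewrite [RHS]integral_mkcond; apply: eq_integral => x _.
    by rewrite /f_ !patchE; case: ifP.
  rewrite (@continuous_FTC2 _ h H).
  - by rewrite EFinB.
  - by rewrite -subr_gt0 opprK -natrD ltr0n.
  - exact: continuous_subspaceT.
  - split.
    + by move=> x _; exact: drv_derivable (dH x).
    + by apply: cvg_at_right_filter; exact: cf.
    + by apply: cvg_at_left_filter; exact: cf.
  - by move=> x _; exact: drv_val.
pose D (n : nat) : R := H n%:R - H (- n%:R).
have L0 : D n @[n --> \oo] --> (0 : R).
  apply/cvgr0Pnorm_lt => e e0.
  have Hc : (C * harmonic n) @[n --> \oo] --> (0 : R).
    by rewrite -[X in _ --> X](mulr0 C); apply: cvgM; [exact: cvg_cst|exact: cvg_harmonic].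
  move/cvgr0Pnorm_lt : Hc => /(_ _ e0); apply: filterS => n.
  by apply: le_lt_trans; apply: le_trans (HC _) (ler_norm _).
have L1 : (\int[lebesgue_measure]_x f_ n.+1 x @[n --> \oo] --> (0 : \bar R))%E.
  under eq_fun do rewrite E.
  apply: cvg_EFin; first exact: nearW.
  by move: L0; rewrite -(cvg_shiftS D).
have L2 : (\int[lebesgue_measure]_x f_ n.+1 x @[n --> \oo] -->
    \int[lebesgue_measure]_x (h x)%:E)%E.
  by move: L; rewrite -(cvg_shiftS (fun n => \int[lebesgue_measure]_x f_ n x)%E).
rewrite /Rintegral.
by rewrite (cvg_unique _ L2 L1).
Unshelve. all: by end_near. Qed.

(** * Change of variables along a map, with a density *)

Section integral_transfer.
Context {R : realType} {d1 d2} {T : measurableType d1} {S : measurableType d2}.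
Variables (nu : {measure set T -> \bar R}) (mu : {measure set S -> \bar R}).
Variables (phi : S -> T) (h : S -> R).
Hypothesis mphi : measurable_fun setT phi.
Hypothesis mh : measurable_fun setT h.
Hypothesis h0 : forall x, 0 <= h x.
Hypothesis nuE : forall A, measurable A ->
  (nu A = \int[mu]_x (\1_A (phi x) * h x)%:E)%E.
Local Open Scope ereal_scope.

Import HBNNSimple.

Let transfer_nnsfun (f : {nnsfun T >-> R}) :
  \int[nu]_x (f x)%:E = \int[mu]_x (f (phi x) * h x)%:E.
Proof.
under [LHS]eq_integral do rewrite fimfunE -fsumEFin//.
rewrite [LHS]ge0_integral_fsum//; last 2 first.
  - by move=> r; exact/measurable_EFinP/measurableT_comp.
  - by move=> n x _; rewrite EFinM nnfun_muleindic_ge0.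
under [RHS]eq_integral.
  move=> x xD; rewrite EFinM muleC fimfunE -fsumEFin// ge0_mule_fsumr; last first.
    by move=> r; rewrite EFinM nnfun_muleindic_ge0.
  over.
rewrite [RHS]ge0_integral_fsum//; last 2 first.
  - move=> r; apply/measurable_EFinP; apply: measurable_funM => //.
    apply: measurable_funM => //; apply: (measurableT_comp _ mphi).
    exact: measurable_indic.
  - move=> n x _; rewrite mule_ge0//; first by rewrite lee_fin.
    by rewrite EFinM nnfun_muleindic_ge0.
apply: eq_fsbigr => r _.
rewrite integralZl_indic_nnsfun//= integral_indic// setIT nuE//.
have [r0|r0] := leP 0%R r; last first.
  have r1 : f @^-1` [set r] = set0 by apply: preimage_nnfun0.
  rewrite r1; under eq_integral do rewrite indic0 mul0r.
  under [RHS]eq_integral do rewrite indic0 mulr0 mule0.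
  by rewrite integral0 mule0.
rewrite -ge0_integralZl//.
- by apply: eq_integral => x _; rewrite -!EFinM; congr EFin; ring.
- apply/measurable_EFinP; apply: measurable_funM => //.
  by apply: (measurableT_comp _ mphi); exact: measurable_indic.
- by move=> x _; rewrite lee_fin mulr_ge0.
Qed.

(** Approximation by simple functions. The form of the hypothesis on [nu] covers at once image
    measures (h = 1), measures with a density (phi the identity), translations of Lebesgue measure
    and the passage to a smaller sigma-algebra. *)
Lemma ge0_integral_transfer (f : T -> \bar R) :
  measurable_fun setT f -> (forall x, 0 <= f x) ->
  \int[nu]_x f x = \int[mu]_x (f (phi x) * (h x)%:E).
Proof.
move=> mf f0; pose f_ := nnsfun_approx measurableT mf.
transitivity (lim (\int[nu]_x (f_ n x)%:E @[n --> \oo])).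
  rewrite -monotone_convergence//=.
  - apply: eq_integral => ? /[!inE] xD; apply/esym/cvg_lim => //=.
    exact: cvg_nnsfun_approx.
  - by move=> n; exact/measurable_EFinP/measurable_funTS.
  - by move=> n ? _; rewrite lee_fin.
  - by move=> ? _ ? ? mn; rewrite lee_fin; exact/lefP/nd_nnsfun_approx.
rewrite [RHS](_ : _ = lim
    (\int[mu]_x (f_ n (phi x) * h x)%:E @[n --> \oo])); last first.
  rewrite -monotone_convergence//=.
  - apply: eq_integral => x _; apply/esym/cvg_lim => //.
    under eq_fun do rewrite EFinM.
    apply: cvgeMr => //; exact: cvg_nnsfun_approx.
  - move=> n; apply/measurable_EFinP; apply: measurable_funM => //.
    exact: (measurableT_comp _ mphi).
  - by move=> n ? _; rewrite lee_fin mulr_ge0.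
  - move=> x _ a b ab; rewrite lee_fin ler_wpM2r//.
    exact/lefP/nd_nnsfun_approx.
by apply: congr_lim; apply/funext => n /=; exact: transfer_nnsfun.
Qed.

(** Multiplication by the nonnegative [h] commutes with positive and negative parts, so the two
    halves transfer separately. *)
Lemma integral_transfer (f : T -> R) : measurable_fun setT f ->
  \int[nu]_x (f x)%:E = \int[mu]_x (f (phi x) * h x)%:E.
Proof.
move=> mf; have mf' : measurable_fun setT (EFin \o f) by exact/measurable_EFinP.
rewrite integralE [RHS]integralE.
rewrite !ge0_integral_transfer; [|exact: measurable_funeneg|by []|
  exact: measurable_funepos|by []].
congr (_ - _); apply: eq_integral => x _.
  rewrite !funeposE; have [f0|f0] := leP 0%R (f (phi x)).
    by rewrite !max_l// ?lee_fin ?mulr_ge0.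
  rewrite !max_r ?mul0e// lee_fin; last exact: ltW.
  by rewrite mulr_le0_ge0// ltW.
rewrite !funenegE; have [f0|f0] := leP 0%R (f (phi x)).
  by rewrite !max_r ?mul0e// oppe_le0 lee_fin ?mulr_ge0.
rewrite !max_l ?oppe_ge0 ?lee_fin ?(ltW f0)// ?muleN ?mulNe//.
by rewrite mulr_le0_ge0// ltW.
Qed.

Lemma Rintegral_transfer (f : T -> R) : measurable_fun setT f ->
  (\int[nu]_x f x)%R = (\int[mu]_x (f (phi x) * h x))%R.
Proof. by move=> mf; rewrite /Rintegral integral_transfer. Qed.

End integral_transfer.

Lemma integral_normal_prob {R : realType} (m s : R) (f : R -> R) :
  measurable_fun setT f ->
  (\int[normal_prob m s]_x (f x)%:E =
   \int[lebesgue_measure]_x (f x * normal_pdf m s x)%:E)%E.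
Proof.
move=> mf; have H := @integral_transfer R _ _ _ _ (normal_prob m s) lebesgue_measure
  idfun (normal_pdf m s) (@measurable_id _ _ setT) (measurable_normal_pdf m s)
  (normal_pdf_ge0 m s).
apply: H => // A mA.
transitivity (\int[lebesgue_measure]_(x in A) (normal_pdf m s x)%:E)%E => //.
rewrite [LHS]integral_mkcond; apply: eq_integral => x _.
by rewrite patchE indicE; case: (_ \in _); rewrite ?mul1r ?mul0r.
Qed.

(** * Moments and characteristic function of a Gaussian variable *)

Section gaussian_moments.
Context {R : realType}.
Variables (m s : R).
Hypothesis s0 : 0 < s.
Notation mu := (@lebesgue_measure R).
Notation phi := (normal_pdf m s).

Let sN0 : s != 0. Proof. exact: lt0r_neq0. Qed.

(** Stein's identity: the integrand is the derivative of [g * phi]. Suitable choices of [g] yield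
    all the Gaussian integrals of this section. *)
Lemma Rintegral_derive_normal_pdf_eq0 (g g' : R -> R) (K : R) :
  (forall x : R, is_derive x (1 : R) (g : R -> R) (g' x : R)) -> continuous g' ->
  (forall x, `|g x| <= K * (1 + (x - m) ^+ 2)) ->
  (forall x, `|g' x - g x * ((x - m) / s ^+ 2)| <= K * (1 + (x - m) ^+ 2)) ->
  \int[mu]_x ((g' x - g x * ((x - m) / s ^+ 2)) * phi x) = 0.
Proof.
move=> dg cg' gK hK.
have dH (x : R) : is_derive x 1 (fun y => g y * phi y : R)
    ((g' x - g x * ((x - m) / s ^+ 2)) * phi x).
  have := drvM (dg x) (drv_normal_pdf m s0 x) => /drv_eq; apply; ring.
have cg : continuous g := drv_continuous dg.
have cphi : continuous phi := @continuous_normal_density R m s s0.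
have ch : continuous (fun x : R => (g' x - g x * ((x - m) / s ^+ 2)) : R).
  move=> x; apply: (@cvgB _ R^o); first exact: cg'.
  apply: cvgM; first exact: cg.
  apply: cvgM; last exact: cvg_cst.
  by apply: (@cvgB _ R^o); [exact: cvg_id|exact: cvg_cst].
have K0 : 0 <= K.
  by have := le_trans (normr_ge0 _) (gK m); rewrite subrr expr0n /= addr0 mulr1.
have [C1 C10 HC1] := normal_pdf_moment_bound m s0.
have s2 : 0 < s * Num.sqrt 2 by rewrite mulr_gt0.
have [C2 C20 HC2] := normal_pdf_moment_bound m s2.
pose p := normal_peak (s * Num.sqrt 2 * Num.sqrt 2).
have p0 : 0 <= p by exact: normal_peak_ge0.
(* [normal_pdf_moment_bound] is used twice: one quadratic weight pays for the growth of [g], the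
   second one is kept on the left as decay in x. *)
have Hb x : `|g x * phi x| * (1 + (x - m) ^+ 2) <= K * (C1 * (C2 * p)).
  have w0 : 0 <= 1 + (x - m) ^+ 2 by rewrite addr_ge0// sqr_ge0.
  rewrite normrM [`|phi x|]ger0_norm ?normal_pdf_ge0//.
  apply: (@le_trans _ _ (K * ((1 + (x - m) ^+ 2) * phi x) * (1 + (x - m) ^+ 2))).
    by rewrite ler_wpM2r// mulrA ler_wpM2r ?normal_pdf_ge0.
  rewrite -mulrA ler_wpM2l//.
  apply: (le_trans (ler_wpM2r w0 (HC1 x))).
  rewrite -mulrA ler_wpM2l// mulrC; apply: (le_trans (HC2 x)).
  rewrite ler_wpM2l// normal_pdf_ub//.
  by rewrite !mulf_neq0// sqrtr_eq0 -ltNge.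
(* At |b| = n the weight 1 + (b - m)^2 dominates n + 1 up to this factor, which turns [Hb] into the
   boundary bound of [Rintegral_derive_eq0]. *)
pose D := 2 * (1 + `|m|).
have pe (n : nat) (b : R) : `|b| = n%:R -> n.+1%:R <= D * (1 + (b - m) ^+ 2).
  move=> bn; rewrite -natr1 -bn /D.
  have h1 := ler_normD (b - m) m; rewrite subrK in h1.
  have <- : `|b - m| ^+ 2 = (b - m) ^+ 2 by rewrite real_normK// num_real.
  move: h1 (normr_ge0 m) (normr_ge0 (b - m)).
  move: `|b| `|m| `|b - m| => B M q h1 M0 q0.
  have h2 : 0 <= (1 + M) * (2 * (1 + q ^+ 2) - (1 + q)).
    by apply: mulr_ge0; [exact: addr_ge0|have := sqr_ge0 (q - 1 / 2); nra].
  have h3 : 0 <= M * q by rewrite mulr_ge0.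
  by lra.
have wb (n : nat) (b : R) : `|b| = n%:R ->
    `|g b * phi b| <= K * (C1 * (C2 * p)) * D * n.+1%:R^-1.
  move=> bn; rewrite ler_pdivlMr ?ltr0n//.
  apply: (le_trans (ler_wpM2l (normr_ge0 _) (pe _ _ bn))).
  rewrite mulrCA [leRHS]mulrC; apply: ler_wpM2l; last exact: Hb.
  by rewrite /D mulr_ge0// addr_ge0.
apply: (@Rintegral_derive_eq0 _ (fun y => g y * phi y)
  (fun x => (g' x - g x * ((x - m) / s ^+ 2)) * phi x)
  (2 * (K * (C1 * (C2 * p)) * D)) dH).
- by move=> x; apply: cvgM; [exact: ch|exact: cphi].
- apply: (normal_pdf_integrable_moment s0 _ hK).
  exact: continuous_measurable_fun.
- move=> n; apply: (le_trans (ler_normB _ _)).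
  rewrite -mulrA [leRHS]mulr_natl mulr2n; apply: lerD; apply: wb.
    by rewrite ger0_norm.
  by rewrite normrN ger0_norm.
Qed.

Let u1 (x : R) : `|x - m| <= 1 * (1 + (x - m) ^+ 2).
Proof.
have : `|x - m| ^+ 2 = (x - m) ^+ 2 by rewrite real_normK// num_real.
have := normr_ge0 (x - m); nra.
Qed.

Let cst1 (K : R) (x : R) : 0 <= K -> K <= K * (1 + (x - m) ^+ 2).
Proof. by move=> K0; rewrite ler_peMr// lerDl sqr_ge0. Qed.

Let drv_u (x : R) : is_derive x 1 (fun y : R => y - m) (1 : R).
Proof.
by apply: drv_eq (drvD (drv_id x) (drv_cst _ x)) _; rewrite addr0.
Qed.

Let mu_ : measurable_fun setT (fun x : R => x - m).
Proof. exact: measurable_funB. Qed.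

Lemma Rintegral_normal_pdf : \int[mu]_x phi x = 1.
Proof. by rewrite /Rintegral integral_normal_pdf. Qed.

(** Stein's identity with g = - s^2; the variance below takes g = - s^2 (x - m). *)
Lemma Rintegral_normal_pdf_mean : \int[mu]_x ((x - m) * phi x) = 0.
Proof.
have K0 : 0 <= s ^+ 2 + 1 by rewrite addr_ge0// sqr_ge0.
have H := @Rintegral_derive_normal_pdf_eq0 (fun=> - s ^+ 2) (fun=> 0) (s ^+ 2 + 1).
rewrite -[RHS]H.
- apply: eq_Rintegral => x _; congr (_ * _); by field.
- by move=> x; exact: cvg_cst.
- move=> x; rewrite normrN ger0_norm ?sqr_ge0//.
  by apply: le_trans (cst1 _ K0); rewrite lerDl.
- move=> x; have -> : 0 - - s ^+ 2 * ((x - m) / s ^+ 2) = x - m by field.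
  apply: (le_trans (u1 x)); rewrite ler_wpM2r ?lerDr ?sqr_ge0//.
  by rewrite addr_ge0// sqr_ge0.
Qed.

Lemma Rintegral_normal_pdf_variance :
  \int[mu]_x ((x - m) ^+ 2 * phi x) = s ^+ 2.
Proof.
have K0 : 0 <= s ^+ 2 + 1 by rewrite addr_ge0// sqr_ge0.
have sq0 := sqr_ge0 s.
have H := @Rintegral_derive_normal_pdf_eq0 (fun x => - s ^+ 2 * (x - m))
  (fun=> - s ^+ 2 * 1) (s ^+ 2 + 1) (fun x => drvZ (- s ^+ 2) (drv_u x)).
have Ev x : - s ^+ 2 * 1 - - s ^+ 2 * (x - m) * ((x - m) / s ^+ 2) =
  (x - m) ^+ 2 - s ^+ 2 by field.
have E : \int[mu]_x (((x - m) ^+ 2 - s ^+ 2) * phi x) = 0.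
  rewrite -[RHS]H.
  - by apply: eq_Rintegral => x _; rewrite Ev.
  - by move=> x; exact: cvg_cst.
  - move=> x; rewrite normrM normrN [X in X * _]ger0_norm//.
    apply: (le_trans (ler_wpM2l sq0 (u1 x))); rewrite mul1r.
    by rewrite ler_wpM2r ?lerDl// addr_ge0// sqr_ge0.
  - move=> x; rewrite Ev; apply: (le_trans (ler_normB _ _)).
    by rewrite !ger0_norm ?sqr_ge0//; have := sqr_ge0 (x - m); nra.
have I1 : mu.-integrable setT (EFin \o (fun x => (x - m) ^+ 2 * phi x)).
  apply: (@normal_pdf_integrable_moment _ _ _ s0 _ 1).
    by apply: measurable_funX.
  by move=> x; rewrite mul1r ger0_norm ?sqr_ge0// lerDr.
have I2 : mu.-integrable setT (EFin \o (fun x => s ^+ 2 * phi x)).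
  apply: (@normal_pdf_integrable_moment _ _ _ s0 _ (s ^+ 2)).
    exact: measurable_cst.
  by move=> x; rewrite ger0_norm//; exact: cst1.
have := RintegralB measurableT I1 I2.
under eq_Rintegral do rewrite -mulrBl.
rewrite E => /esym/eqP; rewrite subr_eq0 => /eqP ->.
rewrite RintegralZl//; last exact: integrable_normal_pdf.
by rewrite Rintegral_normal_pdf mulr1.
Qed.

(** As a function of z the integral F satisfies F' = - s^2 z F: differentiate under the integral
    sign and use Stein's identity with g = - s^2 sin (th + (x - m) z). Hence F exp (s^2 z^2 / 2) is
    constant. The phase [th] lets a real cosine carry the whole characteristic function, sines
    included. *)
Lemma Rintegral_normal_pdf_cos (th y : R) :
  \int[mu]_x (cos (th + (x - m) * y) * phi x) = cos th * expR (- (s * y) ^+ 2 / 2).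
Proof.
pose f (z x : R) := cos (th + (x - m) * z) * phi x.
pose F z := \int[mu]_x f z x.
have sq0 := sqr_ge0 s.
have mlin (z : R) : measurable_fun setT (fun x : R => th + (x - m) * z : R).
  by apply: measurable_funD => //; apply: measurable_funM.
have dlin (z x : R) : is_derive x 1 (fun x : R => th + (x - m) * z : R) (z : R).
  apply: drv_eq (drvD (drv_cst th x) (drvM (drv_u x) (drv_cst z x))) _.
  by rewrite add0r mul1r mulr0 addr0.
have dlin' (z x : R) : is_derive z 1 (fun z : R => th + (x - m) * z : R) (x - m : R).
  apply: drv_eq (drvD (drv_cst th z) (drvZ (x - m) (drv_id z))) _.
  by rewrite add0r mulr1.
have df (z x : R) : is_derive z 1 (f ^~ x : R -> R)
    (- sin (th + (x - m) * z) * (x - m) * phi x : R).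
  apply: drv_eq (drvM (drv_cos (dlin' z x)) (drv_cst (phi x) z)) _.
  by rewrite mulr0 addr0.
have intf (z : R) : mu.-integrable setT (EFin \o f z).
  apply: (@normal_pdf_integrable_moment _ _ _ s0 _ 1).
    by apply: measurableT_comp => //; exact: (continuous_measurable_fun (@continuous_cos R)).
  move=> x; apply: le_trans (cst1 _ _) => //.
  by rewrite ler_norml cos_geN1 cos_le1.
pose G (x : R) := `|x - m| * phi x.
have intG : mu.-integrable setT (EFin \o G).
  apply: (@normal_pdf_integrable_moment _ _ _ s0 _ 1).
    exact: measurableT_comp.
  by move=> x; rewrite normr_id.
have G0 x : 0 <= G x by rewrite mulr_ge0// normal_pdf_ge0.
have d1E (z x : R) : partial1of2 f z x = - sin (th + (x - m) * z) * (x - m) * phi x.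
  by rewrite /partial1of2; exact: drv_val.
have Gub (z x : R) : `|partial1of2 f z x| <= G x.
  rewrite d1E !normrM [`|phi x|]ger0_norm ?normal_pdf_ge0// normrN.
  rewrite ler_wpM2r ?normal_pdf_ge0// ler_piMl//.
  by rewrite ler_norml sin_geN1 sin_le1.
have Iz (z : R) : `](z - 1), (z + 1)[%classic z.
  by rewrite /= in_itv/= ltrBlDr ltrDl ltr01.
have dF (z : R) : is_derive z 1 (F : R -> R) (- (s ^+ 2 * z) * F z : R).
  have dz := @derivable_under_integral _ _ _ mu f setT measurableT z _ _ (Iz z)
    (fun x _ => intf x) (fun a b _ _ => drv_derivable (df a b)) G G0 intG
    (fun a b _ _ => Gub a b).
  have vz := @differentiation_under_integral _ _ _ mu f setT measurableT z _ _ (Iz z)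
    (fun x _ => intf x) (fun a b _ _ => drv_derivable (df a b)) G G0 intG
    (fun a b _ _ => Gub a b).
  have := derivableP dz; rewrite -derive1E vz => /drv_eq; apply.
  under eq_Rintegral do rewrite d1E.
  have H := @Rintegral_derive_normal_pdf_eq0 (fun x => - s ^+ 2 * sin (th + (x - m) * z))
    (fun x => - s ^+ 2 * (cos (th + (x - m) * z) * z)) (s ^+ 2 * (1 + `|z|) + 1)
    (fun x => drvZ (- s ^+ 2) (drv_sin (dlin z x))).
  have Ev x : (- s ^+ 2 * (cos (th + (x - m) * z) * z) -
     - s ^+ 2 * sin (th + (x - m) * z) * ((x - m) / s ^+ 2)) * phi x =
     (- (s ^+ 2 * z)) * f z x - (- sin (th + (x - m) * z) * (x - m) * phi x).
    by rewrite /f; field.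
  have E : \int[mu]_x ((- (s ^+ 2 * z)) * f z x -
      (- sin (th + (x - m) * z) * (x - m) * phi x)) = 0.
    rewrite -[RHS]H.
    - by apply: eq_Rintegral => x _; rewrite Ev.
    - move=> x; apply: cvgM; first exact: cvg_cst.
      apply: cvgM; last exact: cvg_cst.
      apply: (@continuous_comp _ _ _ (fun x => th + (x - m) * z) cos).
        exact: (drv_continuous (dlin z)).
      exact: continuous_cos.
    - move=> x; rewrite normrM normrN [`|s ^+ 2|]ger0_norm//.
      have zs : 0 <= s ^+ 2 * `|z| by rewrite mulr_ge0.
      apply: (@le_trans _ _ (s ^+ 2 * (1 + `|z|) + 1)); last first.
        by apply: cst1; rewrite mulrDr mulr1 !addr_ge0.
      apply: (@le_trans _ _ (s ^+ 2)); last by rewrite mulrDr mulr1; lra.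
      by rewrite ler_piMr// ler_norml sin_geN1 sin_le1.
    - move=> x; have -> : - s ^+ 2 * (cos (th + (x - m) * z) * z) -
          - s ^+ 2 * sin (th + (x - m) * z) * ((x - m) / s ^+ 2) =
          - (s ^+ 2 * (z * cos (th + (x - m) * z))) + sin (th + (x - m) * z) * (x - m).
        by field.
      apply: (le_trans (ler_normD _ _)); rewrite normrN [X in X + _ <= _]normrM.
      rewrite [X in X * _ + _ <= _]ger0_norm// !normrM.
      have : `|sin (th + (x - m) * z)| <= 1 by rewrite ler_norml sin_geN1 sin_le1.
      have : `|cos (th + (x - m) * z)| <= 1 by rewrite ler_norml cos_geN1 cos_le1.
      have := normr_ge0 z; have := u1 x; have := normr_ge0 (x - m).
      have := sqr_ge0 (x - m); have := normr_ge0 (cos (th + (x - m) * z)).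
      have := normr_ge0 (sin (th + (x - m) * z)).
      move: (`|sin _|) (`|cos _|) (`|z|) => S C Z S0 C0 q0 u0 uu Z0 C1 S1.
      have h1 : S * `|x - m| <= 1 + (x - m) ^+ 2 by nra.
      have h2 : Z * C <= Z by nra.
      have h3 : s ^+ 2 * (Z * C) <= s ^+ 2 * Z by rewrite ler_wpM2l.
      have h4 : 0 <= s ^+ 2 * Z by rewrite mulr_ge0.
      have h5 : 0 <= s ^+ 2 * (1 + Z) * (x - m) ^+ 2.
        by apply: mulr_ge0; [apply: mulr_ge0 => //; exact: addr_ge0|exact: sqr_ge0].
      nra.
  move: E; rewrite RintegralB//.
  - by rewrite RintegralZl// => /eqP; rewrite subr_eq0 => /eqP.
  - exact: (integrableZl measurableT _ (intf z)).
  - apply: (@normal_pdf_integrable_moment _ _ _ s0 _ 1).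
      apply: measurable_funM => //; apply: measurableT_comp => //.
      by apply: measurableT_comp => //; exact: (continuous_measurable_fun (@continuous_sin R)).
    move=> x; apply: le_trans (u1 x); rewrite normrM normrN ler_piMl//.
    by rewrite ler_norml sin_geN1 sin_le1.
pose g z := F z * expR (s ^+ 2 / 2 * (z * z)).
have dg (z : R) : is_derive z 1 (g : R -> R) (0 : R).
  apply: drv_eq (drvM (dF z) (drv_expR (drvZ (s ^+ 2 / 2) (drvM (drv_id z) (drv_id z))))) _.
  by rewrite -/(F z); field.
have := @is_derive_0_is_cst _ g y 0 dg.
rewrite /g !mulr0 expR0 mulr1.
have -> : F 0 = cos th.
  rewrite /F /f; under eq_Rintegral do rewrite mulr0 addr0.
  rewrite RintegralZl//; last exact: integrable_normal_pdf.
  by rewrite Rintegral_normal_pdf mulr1.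
move=> <-; rewrite -[RHS]mulrA -expRD.
have -> : s ^+ 2 / 2 * (y * y) + - (s * y) ^+ 2 / 2 = 0 by field.
by rewrite expR0 mulr1.
Qed.

End gaussian_moments.

Section gaussian_rv_facts.
Context {R : realType} {dO : measure_display} {Omega : measurableType dO}.
Variable P : probability Omega R.

Lemma integral_gaussian_law (Y : Omega -> R) (m s : R) (f : R -> R) :
  measurable_fun setT Y ->
  (forall B, measurable B -> P (Y @^-1` B) = gaussian_law m s B) ->
  measurable_fun setT f ->
  (\int[P]_w (f (Y w))%:E = if (s == 0)%R then (f m)%:E else
     \int[lebesgue_measure]_x (f x * normal_pdf m s x)%:E)%E.
Proof.
move=> mY law mf.
have PE (B : set R) : measurable B ->
    P (Y @^-1` B) = (\int[P]_w (\1_B (Y w) * 1)%:E)%E.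
  move=> mB; have mYB : measurable (Y @^-1` B).
    by rewrite -[X in measurable X]setTI; exact: mY.
  rewrite -[Y @^-1` B in LHS]setIT -integral_indic//.
  by apply: eq_integral => w _; rewrite mulr1.
have one0 : forall w : Omega, 0 <= (1 : R) by [].
have [s0|s0] := eqVneq s 0.
  have H := @integral_transfer R _ _ _ _ (dirac m) P Y (fun=> 1) mY
    (measurable_cst _) one0.
  transitivity (\int[dirac m]_x (f x)%:E)%E; last first.
    rewrite integral_dirac//; last exact/measurable_EFinP.
    by rewrite diracT mul1e.
  rewrite H//; first by apply: eq_integral => w _; rewrite mulr1.
  by move=> A mA; rewrite -PE// law// /gaussian_law s0 eqxx.
have H := @integral_transfer R _ _ _ _ (normal_prob m s) P Y (fun=> 1) mY
  (measurable_cst _) one0.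
rewrite -integral_normal_prob// H//; first by apply: eq_integral => w _; rewrite mulr1.
by move=> A mA; rewrite -PE// law// /gaussian_law (negbTE s0).
Qed.

Lemma gaussian_rv_moments (Y : Omega -> R) : measurable_fun setT Y ->
  gaussian_rv P Y -> exists m s : R, [/\
    P.-integrable setT (EFin \o (fun w => Y w ^+ 2)),
    \int[P]_w Y w = m, \int[P]_w (Y w ^+ 2) = m ^+ 2 + s ^+ 2 &
    forall th : R,
      \int[P]_w cos (th + Y w) = cos (th + m) * expR (- (s ^+ 2 / 2))].
Proof.
move=> mY [m [s [s0 law]]]; exists m, s.
have mid : measurable_fun setT (fun x : R => x) by exact: measurable_id.
have msq : measurable_fun setT (fun x : R => x ^+ 2) by exact: measurable_funX.
have mcos (th : R) : measurable_fun setT (fun x : R => cos (th + x)).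
  apply: measurableT_comp; last exact: measurable_funD.
  exact: (continuous_measurable_fun (@continuous_cos R)).
have I f mf := @integral_gaussian_law Y m s f mY law mf.
have I2 : (\int[P]_w (Y w ^+ 2)%:E = (m ^+ 2 + s ^+ 2)%:E)%E /\
    \int[P]_w Y w = m /\ (forall th : R,
      \int[P]_w cos (th + Y w) = cos (th + m) * expR (- (s ^+ 2 / 2))).
  have [sE|sN0] := eqVneq s 0.
    rewrite (I _ msq) /Rintegral (I _ mid) sE eqxx expr0n/= addr0; split => //.
    split => // th; rewrite (I _ (mcos th)) sE eqxx /=.
    by rewrite mul0r oppr0 expR0 mulr1.
  have sp : 0 < s by rewrite lt_neqAle eq_sym sN0.
  have i0 : lebesgue_measure.-integrable setT (EFin \o normal_pdf m s).
    exact: integrable_normal_pdf.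
  have i1 : lebesgue_measure.-integrable setT
      (EFin \o (fun x : R => (x - m) * normal_pdf m s x)).
    apply: (@normal_pdf_integrable_moment _ _ _ sp _ 1).
      exact: measurable_funB.
    move=> x; have : `|x - m| ^+ 2 = (x - m) ^+ 2 by rewrite real_normK// num_real.
    have := normr_ge0 (x - m); nra.
  have i2 : lebesgue_measure.-integrable setT
      (EFin \o (fun x : R => (x - m) ^+ 2 * normal_pdf m s x)).
    apply: (@normal_pdf_integrable_moment _ _ _ sp _ 1).
      by apply: measurable_funX; exact: measurable_funB.
    by move=> x; rewrite mul1r ger0_norm ?sqr_ge0// lerDr.
  have k1 := @integrableZl _ _ _ _ setT measurableT m _ i0.
  have k2 := @integrableZl _ _ _ _ setT measurableT (2 * m) _ i1.
  have k3 := @integrableZl _ _ _ _ setT measurableT (m ^+ 2) _ i0.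
  have E1 : \int[lebesgue_measure]_x (x * normal_pdf m s x) = m.
    transitivity (\int[lebesgue_measure]_x
      ((x - m) * normal_pdf m s x + m * normal_pdf m s x)).
      by apply: eq_Rintegral => x _; ring.
    rewrite RintegralD// RintegralZl//.
    by rewrite Rintegral_normal_pdf_mean// Rintegral_normal_pdf mulr1 add0r.
  have j2 : lebesgue_measure.-integrable setT (EFin \o (fun x =>
      (x - m) ^+ 2 * normal_pdf m s x + 2 * m * ((x - m) * normal_pdf m s x))).
    exact: (integrableD measurableT i2 k2).
  have J2 : lebesgue_measure.-integrable setT (EFin \o (fun x : R =>
      x ^+ 2 * normal_pdf m s x)).
    apply: eq_integrable (integrableD measurableT j2 k3) => // x _ /=.
    by rewrite -!EFinM -!EFinD; congr EFin; ring.
  have E2 : \int[lebesgue_measure]_x (x ^+ 2 * normal_pdf m s x) = m ^+ 2 + s ^+ 2.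
    transitivity (\int[lebesgue_measure]_x
      (((x - m) ^+ 2 * normal_pdf m s x + 2 * m * ((x - m) * normal_pdf m s x))
       + m ^+ 2 * normal_pdf m s x)).
      by apply: eq_Rintegral => x _; ring.
    rewrite RintegralD// RintegralD// !RintegralZl//.
    rewrite Rintegral_normal_pdf_mean// Rintegral_normal_pdf_variance//.
    by rewrite Rintegral_normal_pdf; ring.
  rewrite /Rintegral (I _ mid) (I _ msq) (negbTE sN0); split.
    by rewrite -E2 /Rintegral fineK//; exact: integrable_fin_num J2.
  split; first exact: E1.
  move=> th; rewrite (I _ (mcos th)) (negbTE sN0).
  have -> : - (s ^+ 2 / 2) = - (s * 1) ^+ 2 / 2 by rewrite mulr1 mulNr.
  rewrite -(Rintegral_normal_pdf_cos m sp (th + m) 1).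
  rewrite /Rintegral; congr fine; apply: eq_integral => x _.
  by rewrite mulr1 -addrA [m + _]addrCA subrr addr0.
have [I2a [I2b I2c]] := I2; split => //; last by rewrite /Rintegral I2a.
apply/integrableP; split.
  by apply/measurable_EFinP; exact: measurable_funX.
under eq_integral do rewrite /= ger0_norm ?sqr_ge0//.
by rewrite I2a ltry.
Qed.

Lemma gaussian_rv_cos (Y : Omega -> R) : measurable_fun setT Y ->
  gaussian_rv P Y -> \int[P]_w Y w = 0 -> forall th : R,
  \int[P]_w cos (th + Y w) = cos th * expR (- (\int[P]_w (Y w ^+ 2) / 2)).
Proof.
move=> mY gY Y0 th; have [m [s [_ mE sE cE]]] := gaussian_rv_moments mY gY.
by rewrite cE sE -mE Y0 addr0 expr0n/= add0r.
Qed.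

End gaussian_rv_facts.

(** * Wick polynomials: derivatives, bounds and signs *)

Section wick.
Context {R : realType}.
Implicit Types (al be A B C : R).

(* [wick al be A B C j i] is the polynomial H such that differentiating
   exp (- (A a^2 - 2 C a b + B b^2) / 2) j times in a and i times in b
   multiplies it by H, where al = A a - C b and be = B b - C a *)
Fixpoint wick_col be B (i : nat) {struct i} : R :=
  match i with
  | 0 => 1
  | i1.+1 => - be * wick_col be B i1 -
      (match i1 with 0 => 0 | i2.+1 => i1%:R * B * wick_col be B i2 end)
  end.

Fixpoint wick al be A B C (j : nat) {struct j} : nat -> R := fun i =>
  match j with
  | 0 => wick_col be B i
  | j1.+1 => - al * wick al be A B C j1 i
      - (match j1 with 0 => 0 | j2.+1 => j1%:R * A * wick al be A B C j2 i end)
      + (match i with 0 => 0 | i1.+1 => i%:R * C * wick al be A B C j1 i1 end)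
  end.

(** At index 0 the predecessor is a default value, harmless because its coefficient is 0. This gives
    a recursion without case distinction; [wickS] uses the same device. *)
Lemma wick_colS be B i : wick_col be B i.+1 =
  - be * wick_col be B i - i%:R * B * wick_col be B i.-1.
Proof. by case: i => [|i] //=; rewrite !mul0r. Qed.

Lemma wickS al be A B C j i : wick al be A B C j.+1 i =
  - al * wick al be A B C j i - j%:R * A * wick al be A B C j.-1 i
  + i%:R * C * wick al be A B C j i.-1.
Proof. by case: j => [|j]; case: i => [|i] //=; rewrite !mul0r. Qed.

End wick.

Section wick_derivative.
Context {R : realType}.

(** As for Hermite polynomials, a derivative lowers an index, here one term for each of [al] and
    [be]. This is what makes the product rule in [drv_wick_gauss] reproduce the recursion
    [wickS]. *)
Lemma drv_wick (al be : R -> R) (p q A B C x : R) :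
  is_derive x 1 al p -> is_derive x 1 be q ->
  forall j i, is_derive x 1 (fun y => wick (al y) (be y) A B C j i)
    (- (j%:R * p * wick (al x) (be x) A B C j.-1 i)
     - i%:R * q * wick (al x) (be x) A B C j i.-1).
Proof.
move=> dal dbe.
have dcol i : is_derive x 1 (fun y => wick_col (be y) B i)
    (- (i%:R * q * wick_col (be x) B i.-1)).
  elim/ltn_ind : i => -[_|i IH].
    apply: drv_eq (drv_cst 1 x) _.
    by rewrite !mul0r oppr0.
  have -> : (fun y => wick_col (be y) B i.+1) = (fun y => - be y * wick_col (be y) B i
      + - (i%:R * B) * wick_col (be y) B i.-1).
    by apply/funext => y; rewrite wick_colS; ring.
  have D := drvD (drvM (drvN dbe) (IH i (ltnSn _)))
    (drvZ (- (i%:R * B)) (IH i.-1 (leq_ltn_trans (leq_pred _) (ltnSn _)))).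
  apply: drv_eq D _; case: i {IH} => [|i]; first by ring.
  by rewrite -[i.+1.-1]/i -[i.+2.-1]/i.+1 !(wick_colS (be x) B i); ring.
elim/ltn_ind => -[_ i|j IH i].
  by apply: drv_eq (dcol i) _; rewrite /= !mul0r oppr0 sub0r.
have -> : (fun y => wick (al y) (be y) A B C j.+1 i) =
   (fun y => (- al y * wick (al y) (be y) A B C j i
      + - (j%:R * A) * wick (al y) (be y) A B C j.-1 i)
      + i%:R * C * wick (al y) (be y) A B C j i.-1).
  by apply/funext => y; rewrite wickS; ring.
have lj : (j.-1 < j.+1)%N by rewrite ltnS leq_pred.
have D := drvD (drvD (drvM (drvN dal) (IH j (ltnSn _) i))
  (drvZ (- (j%:R * A)) (IH j.-1 lj i)))
  (drvZ (i%:R * C) (IH j (ltnSn _) i.-1)).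
apply: drv_eq D _; rewrite [in RHS]wickS /=.
move: (wick (al x) (be x) A B C) (@wickS _ (al x) (be x) A B C) => W WS.
case: j {IH lj} => [|j]; last rewrite -[j.+1.-1]/j.
  by case: i => [|i]; rewrite ?(WS 0%N) -?[i.+1.-1]/i -?[0.-1]/0%N; ring.
by case: i => [|i]; rewrite !(WS j) -?[i.+1.-1]/i; ring.
Qed.

Lemma drv_wick_gauss (A B C a b : R) j i :
  is_derive a 1 (fun a => wick (A * a - C * b) (B * b - C * a) A B C j i *
     expR (- ((A * (a * a) - 2 * C * (a * b) + B * (b * b)) / 2)))
   (wick (A * a - C * b) (B * b - C * a) A B C j.+1 i *
     expR (- ((A * (a * a) - 2 * C * (a * b) + B * (b * b)) / 2))).
Proof.
have dal : is_derive a 1 (fun a : R => A * a - C * b) A.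
  by apply: drv_eq (drvD (drvZ A (drv_id a)) (drv_cst _ a)) _; rewrite mulr1 addr0.
have dbe : is_derive a 1 (fun a : R => B * b - C * a) (- C).
  apply: drv_eq (drvD (drv_cst _ a) (drvN (drvZ C (drv_id a)))) _.
  by rewrite mulr1 add0r.
have dQ : is_derive a 1 (fun a : R =>
    - ((A * (a * a) - 2 * C * (a * b) + B * (b * b)) / 2)) (- (A * a - C * b)).
  have D := drvN (drvM (drvD (drvD (drvZ A (drvM (drv_id a) (drv_id a)))
    (drvN (drvZ (2 * C) (drvM (drv_id a) (drv_cst b a))))) (drv_cst (B * (b * b)) a))
    (drv_cst (2^-1) a)).
  by apply: drv_eq D _; field.
apply: drv_eq (drvM (drv_wick A B C dal dbe j i) (drv_expR dQ)) _.
by rewrite (wickS _ _ _ _ _ j); ring.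
Qed.

(** The derivatives in [b] are taken first, while [j = 0], where the recursion in [i] is that of
    [wick_col]. *)
Lemma drv_wick_gauss0 (A B C a b : R) i :
  is_derive b 1 (fun b => wick (A * a - C * b) (B * b - C * a) A B C 0 i *
     expR (- ((A * (a * a) - 2 * C * (a * b) + B * (b * b)) / 2)))
   (wick (A * a - C * b) (B * b - C * a) A B C 0 i.+1 *
     expR (- ((A * (a * a) - 2 * C * (a * b) + B * (b * b)) / 2))).
Proof.
have dal : is_derive b 1 (fun b : R => A * a - C * b) (- C).
  apply: drv_eq (drvD (drv_cst _ b) (drvN (drvZ C (drv_id b)))) _.
  by rewrite mulr1 add0r.
have dbe : is_derive b 1 (fun b : R => B * b - C * a) B.
  by apply: drv_eq (drvD (drvZ B (drv_id b)) (drv_cst _ b)) _; rewrite mulr1 addr0.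
have dQ : is_derive b 1 (fun b : R =>
    - ((A * (a * a) - 2 * C * (a * b) + B * (b * b)) / 2)) (- (B * b - C * a)).
  have D := drvN (drvM (drvD (drvD (drv_cst (A * (a * a)) b)
    (drvN (drvZ (2 * C) (drvM (drv_cst a b) (drv_id b)))))
    (drvZ B (drvM (drv_id b) (drv_id b)))) (drv_cst (2^-1) b)).
  by apply: drv_eq D _; field.
apply: drv_eq (drvM (drv_wick A B C dal dbe 0 i) (drv_expR dQ)) _.
by rewrite /= -/(wick_col (B * b - C * a) B i.+1) wick_colS; ring.
Qed.

End wick_derivative.

Section wick_bounds.
Context {R : realType}.
Implicit Types (al be A B C s t : R).

(** With these arguments every term of the recursion is nonnegative, so the value bounds the sum of
    the absolute values of the coefficients. *)
Definition wick_majorant (j i : nat) : R := wick (-1) (-1) (-1) (-1) 1 j i.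

Lemma wick_majorant0S i : wick_majorant 0 i.+1 =
  wick_majorant 0 i + i%:R * wick_majorant 0 i.-1.
Proof.
rewrite /wick_majorant -[LHS]/(wick_col (-1) (-1) i.+1) wick_colS.
by rewrite -[wick _ _ _ _ _ 0 i]/(wick_col (-1) (-1) i)
  -[wick _ _ _ _ _ 0 i.-1]/(wick_col (-1) (-1) i.-1); ring.
Qed.

Lemma wick_majorantS j i : wick_majorant j.+1 i = wick_majorant j i +
  j%:R * wick_majorant j.-1 i + i%:R * wick_majorant j i.-1.
Proof. by rewrite /wick_majorant wickS; ring. Qed.

Lemma wick_majorant_ge0 j i : 0 <= wick_majorant j i.
Proof.
elim/ltn_ind : j i => -[_ i|j IH i].
  elim/ltn_ind : i => -[_ //|i IH].
  rewrite wick_majorant0S addr_ge0 ?mulr_ge0//; first exact: IH.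
  by apply: (IH i.-1); rewrite ltnS leq_pred.
rewrite wick_majorantS !addr_ge0 ?mulr_ge0//.
- exact: IH.
- by apply: IH; rewrite ltnS leq_pred.
- exact: IH.
Qed.

(** The polynomial is homogeneous of degree j + i when [al], [be] have weight 1 and [A], [B], [C]
    have weight 2; [s] is a common scale for all five. *)
Lemma wick_bound al be A B C s : 0 <= s -> `|al| <= s -> `|be| <= s ->
  `|A| <= s ^+ 2 -> `|B| <= s ^+ 2 -> `|C| <= s ^+ 2 -> forall j i,
  `|wick al be A B C j i| <= wick_majorant j i * s ^+ (j + i).
Proof.
move=> s0 als bes As Bs Cs.
have col i : `|wick_col be B i| <= wick_majorant 0 i * s ^+ i.
  elim/ltn_ind : i => -[_|i IH]; first by rewrite /= normr1 mulr1.
  rewrite wick_colS wick_majorant0S mulrDl.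
  apply: (le_trans (ler_normB _ _)); apply: lerD.
    by rewrite normrM normrN exprS mulrCA ler_pM// IH.
  case: i IH => [|i IH] /=; first by rewrite !mul0r normr0.
  rewrite !normrM normr_nat -!mulrA ler_wpM2l// -[i.+2]addn2 addnC exprD mulrCA.
  by rewrite ler_pM// IH// ltnW.
elim/ltn_ind => -[_ i|j IH i]; first by rewrite add0n; exact: col.
rewrite wickS wick_majorantS !mulrDl.
apply: (le_trans (ler_normD _ _)); apply: lerD.
  apply: (le_trans (ler_normB _ _)); apply: lerD.
    by rewrite normrM normrN addSn exprS mulrCA ler_pM// IH.
  case: j IH => [|j IH] /=; first by rewrite !mul0r normr0.
  rewrite !normrM normr_nat -!mulrA ler_wpM2l// -[j.+2]addn2 addnAC addnC exprD mulrCA.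
  by rewrite ler_pM// IH// ltnW.
case: i => [|i] /=; first by rewrite !mul0r normr0.
rewrite !normrM normr_nat -!mulrA ler_wpM2l//.
have -> : (j.+1 + i.+1 = 2 + (j + i))%N by rewrite addSn addnS.
by rewrite exprD mulrCA ler_pM// IH.
Qed.

(** Near the diagonal the linear arguments are at most t times their scale and C is at least - t
    s^2. Dropping [al], [be] and replacing [C] by its positive part then costs an error of relative
    order t, with [M] depending on j and i only. The value compared with has a sign known from
    [wick0_sign]. *)
Lemma wick_perturb j i : exists2 M : R, 0 <= M &
  forall al be A B C s t, 0 <= s -> 0 <= t -> t <= 1 -> `|al| <= t * s -> `|be| <= t * s ->
  `|A| <= s ^+ 2 -> `|B| <= s ^+ 2 -> `|C| <= s ^+ 2 -> - (t * s ^+ 2) <= C ->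
  `|wick al be A B C j i - wick 0 0 A B (Num.max C 0) j i| <= t * M * s ^+ (j + i).
Proof.
have tsle (s t : R) : 0 <= s -> t <= 1 -> t * s <= s by move=> s0 t1; rewrite ler_piMl.
elim/ltn_ind : j i => -[_ i|j IH i].
  elim/ltn_ind : i => -[_|i IH].
    exists 0 => // *; rewrite /= subrr normr0 mulr0 mul0r//.
  have [M1 M10 H1] := IH i.-1 (leq_ltn_trans (leq_pred _) (ltnSn _)).
  exists (wick_majorant 0 i + i%:R * M1).
    by rewrite addr_ge0 ?wick_majorant_ge0 ?mulr_ge0.
  move=> al be A B C s t s0 t0 t1 als bes As Bs Cs Ct.
  have {}H1 := H1 al be A B C s t s0 t0 t1 als bes As Bs Cs Ct.
  have Hb := wick_bound s0 (le_trans als (tsle _ _ s0 t1))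
    (le_trans bes (tsle _ _ s0 t1)) As Bs Cs 0 i.
  move: H1 Hb; rewrite /= !add0n => H1 Hb.
  rewrite -/(wick_col be B i.+1) -/(wick_col 0 B i.+1) !wick_colS oppr0 mul0r sub0r.
  have -> : - be * wick_col be B i - i%:R * B * wick_col be B i.-1 -
      - (i%:R * B * wick_col 0 B i.-1) =
      - be * wick_col be B i - i%:R * B * (wick_col be B i.-1 - wick_col 0 B i.-1).
    by ring.
  rewrite [t * (_ + _)]mulrDr [leRHS]mulrDl; apply: (le_trans (ler_normB _ _)); apply: lerD.
    rewrite normrM normrN exprS.
    have -> : t * wick_majorant 0 i * (s * s ^+ i) =
      (t * s) * (wick_majorant 0 i * s ^+ i) by ring.
    by rewrite ler_pM.
  case: i H1 {IH Hb} => [|i] /= H1; first by rewrite !mul0r normr0 mulr0 mul0r.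
  rewrite !normrM normr_nat.
  have -> : t * (i.+1%:R * M1) * s ^+ i.+2 = i.+1%:R * s ^+ 2 * (t * M1 * s ^+ i).
    by rewrite -[i.+2]addn2 exprD; ring.
  by rewrite ler_pM// ?mulr_ge0// ler_wpM2l.
have [M1 M10 H1] := IH j.-1 (leq_ltn_trans (leq_pred _) (ltnSn _)) i.
have [M2 M20 H2] := IH j (ltnSn _) i.-1.
exists (wick_majorant j i + j%:R * M1 + i%:R * (wick_majorant j i.-1 + M2)).
  by rewrite !addr_ge0 ?wick_majorant_ge0 ?mulr_ge0 ?addr_ge0 ?wick_majorant_ge0.
move=> al be A B C s t s0 t0 t1 als bes As Bs Cs Ct.
have {}H1 := H1 al be A B C s t s0 t0 t1 als bes As Bs Cs Ct.
have {}H2 := H2 al be A B C s t s0 t0 t1 als bes As Bs Cs Ct.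
have Hb := wick_bound s0 (le_trans als (tsle _ _ s0 t1))
    (le_trans bes (tsle _ _ s0 t1)) As Bs Cs.
set D := Num.max C 0.
have Ds : `|D| <= s ^+ 2 by rewrite /D; case: (leP C 0) => // _; rewrite normr0 sqr_ge0.
have CD : `|C - D| <= t * s ^+ 2.
  rewrite /D; case: (leP C 0) => C0; last by rewrite subrr normr0 mulr_ge0// sqr_ge0.
  by rewrite subr0 ler0_norm// lerNl.
rewrite !wickS oppr0 mul0r sub0r.
set W := wick al be A B C; set V := wick 0 0 A B D.
have -> : - al * W j i - j%:R * A * W j.-1 i + i%:R * C * W j i.-1 -
   (- (j%:R * A * V j.-1 i) + i%:R * D * V j i.-1) =
   - al * W j i - j%:R * A * (W j.-1 i - V j.-1 i) +
   i%:R * ((C - D) * W j i.-1 + D * (W j i.-1 - V j i.-1)) by ring.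
rewrite [t * (_ + _)]mulrDr [t * (_ + _)]mulrDr [leRHS]mulrDl [X in _ <= X + _]mulrDl.
rewrite [i%:R * (_ + M2)]mulrDr [t * (_ + i%:R * _)]mulrDr [X in _ <= _ + X]mulrDl.
apply: (le_trans (ler_normD _ _)); apply: lerD.
  apply: (le_trans (ler_normB _ _)); apply: lerD.
    rewrite normrM normrN addSn exprS.
    have -> : t * wick_majorant j i * (s * s ^+ (j + i)) =
      (t * s) * (wick_majorant j i * s ^+ (j + i)) by ring.
    by rewrite ler_pM.
  case: j H1 {IH H2 Hb} => [|j] /= H1; first by rewrite !mul0r normr0 mulr0 mul0r.
  rewrite !normrM normr_nat.
  have -> : t * (j.+1%:R * M1) * s ^+ (j.+2 + i) = j.+1%:R * s ^+ 2 * (t * M1 * s ^+ (j + i)).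
    by rewrite -[j.+2]addn2 addnAC exprD; ring.
  by rewrite ler_pM// ?mulr_ge0// ler_wpM2l.
case: i H2 {H1} => [|i] /= H2; first by rewrite !(mul0r, normr0, mulr0, addr0).
have -> : (j.+1 + i.+1 = 2 + (j + i))%N by rewrite addSn addnS.
have -> : t * (i.+1%:R * wick_majorant j i) * s ^+ (2 + (j + i)) +
   t * (i.+1%:R * M2) * s ^+ (2 + (j + i)) =
   i.+1%:R * ((t * s ^+ 2) * (wick_majorant j i * s ^+ (j + i)) +
     s ^+ 2 * (t * M2 * s ^+ (j + i))) by rewrite exprD; ring.
rewrite normrM normr_nat ler_wpM2l//.
by apply: (le_trans (ler_normD _ _)); apply: lerD; rewrite normrM ler_pM.
Qed.

(** The value is a sum over pairings of j points with i points. With c cross pairs there are (j + i)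
    / 2 - c self-pairs, each contributing a factor -1, and c has the parity of i: every term has the
    sign (-1)^((j - i) / 2). Writing j + 3 i instead of j - i changes the exponent by the even
    number 2 i and avoids truncated subtraction. *)
Lemma wick0_sign A B C : 0 <= A -> 0 <= B -> 0 <= C -> forall j i,
  ~~ odd (j + i) -> 0 <= (-1) ^+ ((j + 3 * i)./2) * wick 0 0 A B C j i.
Proof.
move=> A0 B0 C0; elim/ltn_ind => -[_ i|j IH i].
  rewrite !add0n; elim/ltn_ind : i => -[_ _|[//|i] IH oi]; first by rewrite /= mulr1.
  have -> : (3 * i.+2)./2 = ((3 * i)./2).+3 by lia.
  rewrite -[wick 0 0 A B C 0 i.+2]/(wick_col 0 B i.+2) wick_colS oppr0 mul0r sub0r.
  rewrite -[i.+1.-1]/i -[wick_col 0 B i]/(wick 0 0 A B C 0 i).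
  have h : 0 <= (-1) ^+ (3 * i)./2 * wick 0 0 A B C 0 i.
    by apply: IH; [exact: ltnW|move: oi; rewrite /= negbK].
  have -> : (-1) ^+ ((3 * i)./2).+3 * - (i.+1%:R * B * wick 0 0 A B C 0 i) =
     (i.+1%:R * B) * ((-1) ^+ (3 * i)./2 * wick 0 0 A B C 0 i).
    by rewrite !exprS; ring.
  by apply: mulr_ge0 => //; exact: mulr_ge0.
move=> oi; rewrite wickS oppr0 mul0r sub0r mulrDr; apply: addr_ge0.
  case: j IH oi => [|j] IH oi; first by rewrite !mul0r oppr0 mulr0.
  rewrite -[j.+1.-1]/j.
  have -> : (j.+2 + 3 * i)./2 = ((j + 3 * i)./2).+1 by lia.
  have h : 0 <= (-1) ^+ (j + 3 * i)./2 * wick 0 0 A B C j i.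
    by apply: IH; [exact: ltnW | move: oi; rewrite !addSn /= negbK].
  have -> : (-1) ^+ ((j + 3 * i)./2).+1 * - (j.+1%:R * A * wick 0 0 A B C j i) =
     (j.+1%:R * A) * ((-1) ^+ (j + 3 * i)./2 * wick 0 0 A B C j i).
    by rewrite !exprS; ring.
  by apply: mulr_ge0 => //; exact: mulr_ge0.
case: i oi => [|i] oi; first by rewrite !mul0r mulr0.
rewrite -[i.+1.-1]/i.
have -> : (j.+1 + 3 * i.+1)./2 = ((j + 3 * i)./2).+2 by lia.
have h : 0 <= (-1) ^+ (j + 3 * i)./2 * wick 0 0 A B C j i.
  by apply: IH => //; move: oi; rewrite addSn addnS /= negbK.
have -> : (-1) ^+ ((j + 3 * i)./2).+2 * (i.+1%:R * C * wick 0 0 A B C j i) =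
   (i.+1%:R * C) * ((-1) ^+ (j + 3 * i)./2 * wick 0 0 A B C j i).
  by rewrite !exprS; ring.
by apply: mulr_ge0 => //; exact: mulr_ge0.
Qed.

Lemma wick0_ge A B C : 0 <= A -> 0 <= B -> 0 <= C -> forall k,
  (k`!)%:R * C ^+ k <= wick 0 0 A B C k k.
Proof.
move=> A0 B0 C0; elim => [|k IH]; first by rewrite /= mulr1.
rewrite wickS oppr0 mul0r sub0r factS natrM exprS /=.
have -> : k.+1%:R * k`!%:R * (C * C ^+ k) = k.+1%:R * C * (k`!%:R * C ^+ k) by ring.
rewrite -[leLHS]add0r; apply: lerD; last by rewrite ler_wpM2l// mulr_ge0.
case: k {IH} => [|k] /=; first by rewrite !mul0r oppr0.
rewrite -mulrN mulr_ge0// ?mulr_ge0//.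
have := @wick0_sign A B C A0 B0 C0 k k.+2.
have -> : (k + 3 * k.+2)./2 = (2 * k + 3)%N by lia.
rewrite addnS addnS /= negbK addnn odd_double => /(_ isT).
have -> : (-1) ^+ (2 * k + 3) = -1 :> R.
  by rewrite exprD exprM sqrrN !expr1n mul1r !exprS expr0; ring.
by rewrite mulN1r.
Qed.

End wick_bounds.

(** * Derivatives of the heat kernel *)

Section heat_kernel_derivatives.
Context {R : realType}.
Variable eps : R.
Hypothesis eps0 : 0 < eps.

(** The n-th derivative of the one-dimensional heat kernel. Its Hermite factor is written as a Wick
    column, so that the derivative formula for [wick] applies. *)
Definition heat1 (n : nat) (z : R) : R := wick_col (z / eps) (eps^-1) n *
  ((Num.sqrt (2 * pi * eps))^-1 * expR (- (z ^+ 2 / (2 * eps)))).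

Let epsN0 : eps != 0. Proof. exact: lt0r_neq0. Qed.

Lemma heat10 z : heat1 0 z =
  (Num.sqrt (2 * pi * eps))^-1 * expR (- (z ^+ 2 / (2 * eps))).
Proof. exact: mul1r. Qed.

Lemma drv_heat1 n (z : R) : is_derive z 1 (heat1 n : R -> R) (heat1 n.+1 z : R).
Proof.
have E m : heat1 m = fun z => (Num.sqrt (2 * pi * eps))^-1 *
   (wick (0 * 0 - 0 * z) (eps^-1 * z - 0 * 0) 0 eps^-1 0 0 m *
     expR (- ((0 * (0 * 0) - 2 * 0 * (0 * z) + eps^-1 * (z * z)) / 2))).
  apply/funext => y; rewrite /heat1 mulrCA; congr (_ * (_ * expR _)).
    by rewrite -[RHS]/(wick_col (eps^-1 * y - 0 * 0) eps^-1 m) mul0r subr0 mulrC.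
  by field.
rewrite !E; apply: drvZ; exact: drv_wick_gauss0.
Qed.

Lemma continuous_heat1 n : continuous (heat1 n).
Proof. exact: drv_continuous (drv_heat1 n). Qed.

Lemma exprn_expRN_bound (n : nat) (s : R) : 0 <= s -> s ^+ n * expR (- s) <= n`!%:R.
Proof.
move=> s0; rewrite expRN ler_pdivrMr ?expR_gt0//; case: n => [|n].
  by rewrite fact0 mul1r -[leLHS]expR0 ler_expR.
rewrite mulrC -ler_pdivrMr ?ltr0n ?fact_gt0//.
by apply: le_trans (expR_ge1Dxn n s0); rewrite lerDr.
Qed.

Lemma heat1_bounded n : exists M, forall z, `|heat1 n z| <= M.
Proof.
exists (wick_majorant 0 n * n`!%:R *
  ((Num.sqrt (2 * pi * eps))^-1 * expR ((2 * eps)^-1 + eps^-1 + 1))).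
(* A scale for [wick_bound]: it dominates |z| / eps, and its square dominates 1 / eps. It is linear
   in |z|, so the Gaussian factor beats exp s after completing a square. *)
move=> z; pose s := `|z| / eps + eps^-1 + 1.
have e10 : 0 <= eps^-1 by rewrite invr_ge0 ltW.
have z0 : 0 <= `|z| / eps by rewrite mulr_ge0.
have s0 : 0 <= s by rewrite !addr_ge0.
have hb := @wick_bound R 0 (z / eps) 0 eps^-1 0 s s0.
have {}hb : `|wick_col (z / eps) eps^-1 n| <= wick_majorant 0 n * s ^+ n.
  have := hb _ _ _ _ _ 0 n; rewrite add0n; apply.
  - by rewrite normr0.
  - by rewrite normrM [`|eps^-1|]ger0_norm// /s -addrA lerDl addr_ge0.
  - by rewrite normr0 sqr_ge0.
  - by rewrite ger0_norm// /s; nra.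
  - by rewrite normr0 sqr_ge0.
have c0 : 0 <= (Num.sqrt (2 * pi * eps))^-1 by rewrite invr_ge0 sqrtr_ge0.
rewrite /heat1 normrM [X in _ * X]ger0_norm ?mulr_ge0 ?expR_ge0//.
rewrite [_^-1 * expR _]mulrC mulrA [X in _ <= _ * X]mulrC mulrA ler_wpM2r//.
have -> : wick_majorant 0 n * n`!%:R * expR ((2 * eps)^-1 + eps^-1 + 1) =
  wick_majorant 0 n * (n`!%:R * expR ((2 * eps)^-1 + eps^-1 + 1)) by ring.
apply: (@le_trans _ _ (wick_majorant 0 n * (s ^+ n * expR (- (z ^+ 2 / (2 * eps)))))).
  by rewrite mulrA ler_wpM2r ?expR_ge0.
rewrite ler_wpM2l ?wick_majorant_ge0//.
apply: (@le_trans _ _ (s ^+ n * (expR (- s) * expR ((2 * eps)^-1 + eps^-1 + 1)))).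
  rewrite ler_wpM2l ?exprn_ge0// -expRD ler_expR /s.
  have -> : z ^+ 2 = `|z| ^+ 2 by rewrite real_normK// num_real.
  have -> : - (`|z| / eps + eps^-1 + 1) + ((2 * eps)^-1 + eps^-1 + 1) =
     - (`|z| ^+ 2 / (2 * eps)) + (`|z| - 1) ^+ 2 / (2 * eps) by field.
  by rewrite lerDl divr_ge0 ?sqr_ge0// mulr_ge0// ltW.
by rewrite mulrA ler_wpM2r ?expR_ge0// exprn_expRN_bound.
Qed.

Lemma bmf_heat1 n : bounded_measurable (heat1 n).
Proof.
split; last exact: heat1_bounded.
by apply: continuous_measurable_fun; exact: continuous_heat1.
Qed.

Lemma partial_prod_heat1 d (i : 'I_d) (ka : 'I_d -> nat) :
  partial i (fun z : 'rV[R]_d => \prod_(l < d) heat1 (ka l) (z 0 l)) =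
  (fun z => \prod_(l < d) heat1 (ka l + (l == i)) (z 0 l)).
Proof.
apply/funext => z; rewrite /partial.
pose c := \prod_(l < d | l != i) heat1 (ka l) (z 0 l).
transitivity ('D_1 (fun y : R => c * heat1 (ka i) y) (z 0 i)).
  rewrite /derive; apply: (congr1 (fun g : R -> R => lim (g h @[h --> (0 : R)^']))).
  apply/funext => h /=.
  congr (_ *: (_ - _)); last by rewrite (bigD1 i)//= mulrC.
  rewrite (bigD1 i)//= !mxE !eqxx /= [LHS]mulrC; congr (_ * heat1 _ _).
  by apply: eq_bigr => l li; rewrite !mxE eqxx (negbTE li) mulr0 add0r.
have D := drvZ c (drv_heat1 (ka i) (z 0 i)).
have -> := @derive_val _ _ _ _ _ _ _ D.
rewrite (bigD1 i)//= eqxx addn1 mulrC; congr (_ * _).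
by apply: eq_bigr => l li; rewrite (negbTE li) addn0.
Qed.

Lemma iter_partial_prod_heat1 d (i : 'I_d) n (ka : 'I_d -> nat) :
  iter n (partial i) (fun z : 'rV[R]_d => \prod_(l < d) heat1 (ka l) (z 0 l)) =
  (fun z => \prod_(l < d) heat1 (ka l + n * (l == i)) (z 0 l)).
Proof.
elim: n => [|n IH] /=; first by under [in RHS]eq_fun do under eq_bigr do rewrite addn0.
rewrite IH partial_prod_heat1; apply/funext => z; apply: eq_bigr => l _.
by rewrite -addnA mulSn [((l == i) + _)%N]addnC.
Qed.

Lemma heat_kernelE d (z : 'rV[R]_d) :
  heat_kernel eps z = \prod_(l < d) heat1 0 (z 0 l).
Proof.
have p0 : 0 <= 2 * pi * eps by rewrite !mulr_ge0 ?pi_ge0// ltW.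
rewrite /heat_kernel /enorm sqr_sqrtr; last by apply: sumr_ge0 => l _; rewrite sqr_ge0.
rewrite (eq_bigr _ (fun l _ => heat10 (z 0 l))).
rewrite big_split /= prodr_const card_ord -expR_sum; congr (_ * expR _).
  rewrite mul1r exprVn; congr (_^-1).
  by rewrite [d%:R / 2]mulrC powRrM powR_mulrn ?powR_ge0// powR12_sqrt.
by rewrite mulr_suml -sumrN.
Qed.

(** [enum 'I_d] lists each coordinate once, so the fold differentiates the l-th factor of the
    product exactly k l times. *)
Lemma multi_partial_heat_kernel d (k : 'I_d -> nat) (z : 'rV[R]_d) :
  multi_partial k (heat_kernel eps) z = \prod_(l < d) heat1 (k l) (z 0 l).
Proof.
rewrite /multi_partial.
have -> : heat_kernel eps = (fun z : 'rV[R]_d => \prod_(l < d) heat1 0 (z 0 l)).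
  by apply/funext => y; exact: heat_kernelE.
have gen : forall s : seq 'I_d, uniq s ->
  foldr (fun i g => iter (k i) (partial i) g)
     (fun z : 'rV[R]_d => \prod_(l < d) heat1 0 (z 0 l)) s =
  (fun z => \prod_(l < d) heat1 (k l * (l \in s)) (z 0 l)).
  elim => [_|i s IH /= /andP[iNs us]].
    by apply/funext => y; apply: eq_bigr => l _; rewrite muln0.
  rewrite IH// iter_partial_prod_heat1; apply/funext => y; apply: eq_bigr => l _.
  rewrite inE; have [->|li] := eqVneq l i; first by rewrite (negbTE iNs) muln0 add0n.
  by rewrite muln0 addn0.
rewrite gen ?enum_uniq//; apply: eq_bigr => l _.
by rewrite mem_enum muln1.
Qed.

End heat_kernel_derivatives.

(** * The covariance of two heat kernels of a Gaussian pair *)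

Section gaussian_reweighting.
Context {R : realType}.

Lemma normal_peak_sqrtV (e : R) : 0 < e ->
  normal_peak (Num.sqrt e)^-1 = Num.sqrt (e / (2 * pi)).
Proof.
move=> e0; rewrite /normal_peak; move: (pi_gt0 R); generalize (@pi R) => p p0.
rewrite exprVn sqr_sqrtr ?ltW// -sqrtrV; last first.
  by rewrite mulrn_wge0// mulr_ge0 ?invr_ge0 ?ltW.
by congr Num.sqrt; rewrite -[e^-1 * p *+ 2]mulr_natl; field; rewrite !lt0r_neq0.
Qed.

Lemma normal_pdf_sqrtV (e m x : R) : 0 < e ->
  normal_pdf m (Num.sqrt e)^-1 x =
  Num.sqrt (e / (2 * pi)) * expR (- (e * (x - m) ^+ 2 / 2)).
Proof.
move=> e0; have s0 : (Num.sqrt e)^-1 != 0 by rewrite invr_neq0// sqrtr_eq0 -ltNge.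
rewrite normal_pdfE// normal_peak_sqrtV// /normal_fun exprVn sqr_sqrtr ?ltW//.
by congr (_ * expR _); rewrite -[e^-1 *+ 2]mulr_natl; field; rewrite lt0r_neq0.
Qed.

(** Completing the square: the weight turns the normal law of variance 1 / e into a multiple of the
    one with mean - g / (e + c) and variance 1 / (e + c). Here [c] may be negative as long as e + c
    > 0. *)
Lemma Rintegral_normal_cos_reweight (e c g th b : R) : 0 < e -> 0 < e + c ->
  \int[normal_prob 0 (Num.sqrt e)^-1]_x
    (cos (th + x * b) * expR (- (c * x ^+ 2 / 2 + g * x))) =
  Num.sqrt (e / (e + c)) * expR (g ^+ 2 / (2 * (e + c))) *
  (cos (th - g / (e + c) * b) * expR (- (b ^+ 2 / (2 * (e + c))))).
Proof.
move=> e0 ec0; have p0 := pi_gt0 R; have ecN0 := lt0r_neq0 ec0.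
pose m := - g / (e + c); pose s := (Num.sqrt (e + c))^-1.
have s0 : 0 < s by rewrite invr_gt0 sqrtr_gt0.
have mcos : measurable_fun setT (fun x : R => cos (th + x * b)).
  apply: measurableT_comp; first exact: (continuous_measurable_fun (@continuous_cos R)).
  by apply: measurable_funD => //; exact: measurable_funM.
have mf : measurable_fun setT
    (fun x : R => cos (th + x * b) * expR (- (c * x ^+ 2 / 2 + g * x))).
  apply: measurable_funM => //; apply: measurableT_comp => //.
  apply: measurable_funN; apply: measurable_funD; last exact: measurable_funM.
  by apply: measurable_funM => //; apply: measurable_funM => //; exact: measurable_funX.
rewrite /Rintegral integral_normal_prob// -/(Rintegral _ _ _).
pose K := Num.sqrt (e / (e + c)) * expR (g ^+ 2 / (2 * (e + c))).
transitivity (\int[lebesgue_measure]_x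
    (K * (cos ((th + m * b) + (x - m) * b) * normal_pdf m s x))).
  congr fine; apply: eq_integral => x _; congr EFin.
  rewrite !normal_pdf_sqrtV// /K.
  have -> : th + m * b + (x - m) * b = th + x * b by ring.
  have -> : Num.sqrt (e / (2 * pi)) =
      Num.sqrt (e / (e + c)) * Num.sqrt ((e + c) / (2 * pi)).
    move: (pi_gt0 R); generalize (@pi R) => p pp0.
    rewrite -sqrtrM; last by rewrite divr_ge0 ?ltW.
    by congr Num.sqrt; field; rewrite ecN0 lt0r_neq0.
  have E : expR (- (c * x ^+ 2 / 2 + g * x)) * expR (- (e * (x - 0) ^+ 2 / 2)) =
      expR (g ^+ 2 / (2 * (e + c))) * expR (- ((e + c) * (x - m) ^+ 2 / 2)).
    by rewrite -!expRD; congr expR; rewrite /m; field.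
  transitivity (cos (th + x * b) *
    (Num.sqrt (e / (e + c)) * Num.sqrt ((e + c) / (2 * pi))) *
    (expR (- (c * x ^+ 2 / 2 + g * x)) * expR (- (e * (x - 0) ^+ 2 / 2)))); first by ring.
  by rewrite E; ring.
rewrite RintegralZl//; last first.
  apply: (@normal_pdf_integrable_moment _ _ _ s0 _ 1).
    apply: measurableT_comp; first exact: (continuous_measurable_fun (@continuous_cos R)).
    apply: measurable_funD => //; apply: measurable_funM => //.
    exact: measurable_funB.
  move=> x; rewrite mul1r; apply: (@le_trans _ _ 1); last by rewrite lerDl sqr_ge0.
  by rewrite ler_norml cos_geN1 cos_le1.
rewrite Rintegral_normal_pdf_cos//; congr (_ * (cos _ * expR _)).
  by rewrite /m !mulNr.
rewrite exprMn /s exprVn sqr_sqrtr ?ltW//; field.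
exact: ecN0.
Qed.

End gaussian_reweighting.

Section gaussian_pair.
Context {R : realType} {dO : measure_display} {Omega : measurableType dO}.
Variable P : probability Omega R.
Variables (Z Z' : Omega -> R) (v w c : R) (eps : R).
Hypothesis mZ : measurable_fun setT Z.
Hypothesis mZ' : measurable_fun setT Z'.
Hypothesis charZ : forall th xi eta : R,
  \int[P]_om cos (th + (xi * Z om + eta * Z' om)) =
  cos th * expR (- ((xi ^+ 2 * v + 2 * xi * eta * c + eta ^+ 2 * w) / 2)).
Hypothesis eps0 : 0 < eps.
Let A0 := v + eps.
Let B0 := w + eps.
Let D := A0 * B0 - c ^+ 2.
Hypothesis B00 : 0 < B0.
Hypothesis D0 : 0 < D.

Let nu : probability _ R := normal_prob 0 (Num.sqrt eps)^-1.
Notation bmf := bounded_measurable.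

Let bmf_cos {d} {S : measurableType d} (f : S -> R) :
  measurable_fun setT f -> bmf (fun x => cos (f x)).
Proof.
move=> mf; split; last by exists 1 => x; rewrite ler_norml cos_geN1 cos_le1.
by apply: measurableT_comp mf; exact: (continuous_measurable_fun (@continuous_cos R)).
Qed.

Let nu_cos (th y : R) : \int[nu]_x cos (th + x * y) =
  cos th * expR (- (y ^+ 2 / (2 * eps))).
Proof.
have := @Rintegral_normal_cos_reweight R eps 0 0 th y eps0.
rewrite addr0 => /(_ eps0).
under eq_Rintegral do rewrite !mul0r addr0 oppr0 expR0 mulr1.
by move=> ->; rewrite divff ?lt0r_neq0// sqrtr1 expr0n /= !mul0r subr0 expR0 !mul1r.
Qed.

(** Both heat kernels become cosine means over frequencies xi and eta of law [nu]. After Fubini the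
    expectation is the characteristic function [charZ]. Integrating out eta produces B0, integrating
    out xi its Schur complement D / B0; no density of (Z, Z') is involved. *)
Lemma Rintegral_heat1_pair0 (a b : R) :
  \int[P]_om (heat1 eps 0 (Z om + a) * heat1 eps 0 (Z' om + b)) =
  (2 * pi * Num.sqrt D)^-1 * expR (- ((B0 / D * (a * a) - 2 * (c / D) * (a * b)
     + A0 / D * (b * b)) / 2)).
Proof.
have p0 := pi_gt0 R.
pose f (q : Omega * (R * R)) : R :=
  cos (q.2.1 * (Z q.1 + a) + q.2.2 * (Z' q.1 + b)).
pose k := (Num.sqrt (2 * pi * eps))^-1.
(* [nu_cos] twice: the inner integral has phase xi (Z + a), the outer one phase 0. *)
have E1 om : heat1 eps 0 (Z om + a) * heat1 eps 0 (Z' om + b) =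
    k ^+ 2 * \int[nu]_xi \int[nu]_eta cos (xi * (Z om + a) + eta * (Z' om + b)).
  under eq_Rintegral do rewrite nu_cos.
  rewrite RintegralZr//; last first.
    apply: bmf_integrable; apply: bmf_cos; exact: measurable_funM.
  under eq_Rintegral do rewrite -[X in cos X]add0r.
  by rewrite nu_cos cos0 mul1r !heat10 /k; ring.
have mlin (h : Omega * R -> R) (y : R) : measurable_fun setT h ->
    measurable_fun setT (fun q : Omega * R => h q + q.2 * (y : R)).
  by move=> mh; apply: measurable_funD => //; exact: measurable_funM.
have mZ1 : measurable_fun setT (fun q : Omega * (R * R) => Z q.1 + a).
  by apply: measurable_funD => //; exact: measurableT_comp.
have mZ2 : measurable_fun setT (fun q : Omega * (R * R) => Z' q.1 + b).
  by apply: measurable_funD => //; exact: measurableT_comp.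
have bf : bmf f.
  apply: bmf_cos; apply: measurable_funD; apply: measurable_funM => //.
    exact: measurableT_comp.
  exact: measurableT_comp.
have bg : bmf (fun q : (Omega * R) * R => f (q.1.1, (q.1.2, q.2))).
  apply: (bmf_comp _ bf); apply: measurable_fun_pair.
    exact: measurableT_comp.
  by apply: measurable_fun_pair => //; exact: measurableT_comp.
have bh : bmf (fun q : Omega * R => \int[nu]_eta f (q.1, (q.2, eta))).
  exact: (bmf_Rintegral nu bg).
have bf_xi (xi : R) : bmf (fun q : Omega * R => f (q.1, (xi, q.2))).
  apply: (bmf_comp _ bf); apply: measurable_fun_pair => //.
  by apply: measurable_fun_pair => //; exact: measurable_cst.
under eq_Rintegral do rewrite E1.
rewrite bmf_RintegralZl; last exact: (bmf_Rintegral nu bh).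
have -> : \int[P]_om \int[nu]_xi \int[nu]_eta cos (xi * (Z om + a) + eta * (Z' om + b)) =
    \int[nu]_xi \int[nu]_eta \int[P]_om cos (xi * (Z om + a) + eta * (Z' om + b)).
  rewrite (bmf_Fubini P nu bh); apply: eq_Rintegral => xi _.
  by rewrite (bmf_Fubini P nu (bf_xi xi)).
have E2 (xi eta : R) : \int[P]_om cos (xi * (Z om + a) + eta * (Z' om + b)) =
    expR (- (xi ^+ 2 * v / 2)) *
    (cos (xi * a + eta * b) * expR (- (w * eta ^+ 2 / 2 + (xi * c) * eta))).
  transitivity (\int[P]_om cos ((xi * a + eta * b) + (xi * Z om + eta * Z' om))).
    by apply: eq_Rintegral => om _; congr cos; ring.
  by rewrite charZ mulrCA -expRD; congr (_ * expR _); field.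
have we : 0 < eps + w by rewrite addrC.
(* Integrability is not read off the Gaussian expression: up to a positive constant this function of
   eta is the expectation of a cosine, hence bounded. *)
have I3 (xi : R) : nu.-integrable setT (EFin \o (fun eta =>
    cos (xi * a + eta * b) * expR (- (w * eta ^+ 2 / 2 + (xi * c) * eta)))).
  have : bmf (fun eta : R => expR (xi ^+ 2 * v / 2) *
      \int[P]_om cos (xi * (Z om + a) + eta * (Z' om + b))).
    apply: bmfZ.
    have := @bmf_Rintegral R _ _ _ _ P (fun q : R * Omega =>
       f (q.2, (xi, q.1))); apply.
    exact: (bmf_comp (@measurable_swap _ _ R Omega) (bf_xi xi)).
  under eq_fun do rewrite E2 mulrA -expRD subrr expR0 mul1r.
  by move=> h; refine (@bmf_integrable R _ _ nu _ h).
have E3 (xi : R) : \int[nu]_eta \int[P]_om cos (xi * (Z om + a) + eta * (Z' om + b)) =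
    Num.sqrt (eps / B0) * expR (- (b ^+ 2 / (2 * B0))) *
    (cos (0 + xi * (a - c * b / B0)) * expR (- ((v - c ^+ 2 / B0) * xi ^+ 2 / 2 + 0 * xi))).
  under eq_Rintegral do rewrite E2.
  rewrite RintegralZl//.
  rewrite Rintegral_normal_cos_reweight// [eps + w]addrC -/B0.
  have -> : xi * a - xi * c / B0 * b = 0 + xi * (a - c * b / B0) by ring.
  have -> : expR (- ((v - c ^+ 2 / B0) * xi ^+ 2 / 2 + 0 * xi)) =
     expR (- (xi ^+ 2 * v / 2)) * expR ((xi * c) ^+ 2 / (2 * B0)).
    by rewrite -expRD; congr expR; field; exact: lt0r_neq0.
  by ring.
have DB : eps + (v - c ^+ 2 / B0) = D / B0.
  by rewrite /D /A0; field; exact: lt0r_neq0.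
have DB0 : 0 < eps + (v - c ^+ 2 / B0) by rewrite DB divr_gt0.
have KN0 : Num.sqrt (eps / B0) * expR (- (b ^+ 2 / (2 * B0))) != 0.
  by rewrite lt0r_neq0// mulr_gt0 ?expR_gt0// sqrtr_gt0 divr_gt0.
under eq_Rintegral do rewrite E3.
rewrite RintegralZl//; last first.
  have : bmf (fun xi : R => (Num.sqrt (eps / B0) * expR (- (b ^+ 2 / (2 * B0))))^-1 *
      \int[nu]_eta \int[P]_om cos (xi * (Z om + a) + eta * (Z' om + b))).
    apply: bmfZ.
    have b1 : bmf (fun q : R * R => \int[P]_om f (om, (q.1, q.2))).
      have := @bmf_Rintegral R _ _ _ _ P (fun q : (R * R) * Omega => f (q.2, (q.1.1, q.1.2))).
      apply; apply: (bmf_comp _ bf); apply: measurable_fun_pair => //.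
      by apply: measurable_fun_pair; exact: measurableT_comp.
    exact: (bmf_Rintegral nu b1).
  under eq_fun do rewrite E3 mulrA (mulVf KN0) mul1r.
  by move=> h; refine (@bmf_integrable R _ _ nu _ h).
rewrite Rintegral_normal_cos_reweight// DB.
rewrite expr0n /= !mul0r expR0 mulr1 subr0 cos0 mul1r.
have k2 : k ^+ 2 = (2 * pi * eps)^-1.
  by rewrite /k exprVn sqr_sqrtr// ltW// !mulr_gt0.
rewrite k2.
have -> : (2 * pi * eps)^-1 *
  (Num.sqrt (eps / B0) * expR (- (b ^+ 2 / (2 * B0))) *
   (Num.sqrt (eps / (D / B0)) * expR (- ((a - c * b / B0) ^+ 2 / (2 * (D / B0)))))) =
  (2 * pi * eps)^-1 * (Num.sqrt (eps / B0) * Num.sqrt (eps / (D / B0))) *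
  (expR (- (b ^+ 2 / (2 * B0))) * expR (- ((a - c * b / B0) ^+ 2 / (2 * (D / B0))))).
  by ring.
have BN := lt0r_neq0 B00; have DN := lt0r_neq0 D0.
congr (_ * _).
  rewrite -sqrtrM ?divr_ge0 ?ltW//.
  have -> : eps / B0 * (eps / (D / B0)) = eps ^+ 2 / D by field; rewrite BN DN.
  rewrite sqrtrM ?sqr_ge0// sqrtr_sqr ger0_norm ?ltW// sqrtrV ?ltW//.
  move: (pi_gt0 R); generalize (@pi R) => p pp0.
  by field; rewrite !lt0r_neq0 ?sqrtr_gt0.
rewrite -expRD; congr expR; rewrite /D; field.
by rewrite BN -/D DN.
Qed.

Let F j i (a b : R) : R :=
  \int[P]_om (heat1 eps j (Z om + a) * heat1 eps i (Z' om + b)).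

Let bmf_pair j i a b :
  bmf (fun om => heat1 eps j (Z om + a) * heat1 eps i (Z' om + b)).
Proof.
apply: bmfM; apply: (bmf_comp _ (bmf_heat1 eps0 _)); exact: measurable_funD.
Qed.

Let drv_heat1_shift n (z x : R) :
  is_derive x 1 (fun y : R => heat1 eps n (z + y)) (heat1 eps n.+1 (z + x)).
Proof.
have D1 : is_derive x 1 (fun y : R => z + y : R) (1 : R).
  by apply: drv_eq (drvD (drv_cst z x) (drv_id x)) _; rewrite add0r.
have := @is_derive1_comp _ (heat1 eps n) (fun y : R => z + y) x _ _
  (drv_heat1 eps0 n (z + x)) D1.
by rewrite mulr1.
Qed.

Let F_deriv1 j i (a b : R) :
  is_derive a 1 (fun a : R => F j i a b : R) (F j.+1 i a b : R).
Proof.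
have [M1 HM1] := heat1_bounded eps0 j.+1; have [M2 HM2] := heat1_bounded eps0 i.
have Ia : `](a - 1), (a + 1)[%classic a by rewrite /= in_itv/= ltrBlDr ltrDl ltr01.
pose f (y : R) om := heat1 eps j (Z om + y) * heat1 eps i (Z' om + b).
have df (y : R) om : is_derive y 1 (f ^~ om : R -> R)
    (heat1 eps j.+1 (Z om + y) * heat1 eps i (Z' om + b)).
  apply: drv_eq (drvM (drv_heat1_shift j (Z om) y) (drv_cst _ y)) _.
  by rewrite mulr0 addr0.
have d1E y om : partial1of2 f y om = heat1 eps j.+1 (Z om + y) * heat1 eps i (Z' om + b).
  exact: drv_val.
have M0 : 0 <= M1 * M2.
  by rewrite mulr_ge0//; [exact: le_trans (HM1 0)|exact: le_trans (HM2 0)].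
have Gub y om : `](a - 1), (a + 1)[%classic y -> setT om ->
    `|partial1of2 f y om| <= M1 * M2.
  by move=> _ _; rewrite d1E normrM ler_pM.
have H1 := @derivable_under_integral _ _ _ P f setT measurableT a _ _ Ia
  (fun y _ => bmf_integrable P (bmf_pair j i y b))
  (fun y om _ _ => drv_derivable (df y om)) (fun=> M1 * M2) (fun=> M0)
  (bmf_integrable P (bmf_cst _)) Gub.
have H2 := @differentiation_under_integral _ _ _ P f setT measurableT a _ _ Ia
  (fun y _ => bmf_integrable P (bmf_pair j i y b))
  (fun y om _ _ => drv_derivable (df y om)) (fun=> M1 * M2) (fun=> M0)
  (bmf_integrable P (bmf_cst _)) Gub.
have := derivableP H1; rewrite -derive1E H2 => /drv_eq; apply.
by apply: eq_Rintegral => om _; exact: d1E.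
Qed.

Let F_deriv2 j i (a b : R) :
  is_derive b 1 (fun b : R => F j i a b : R) (F j i.+1 a b : R).
Proof.
have [M1 HM1] := heat1_bounded eps0 j; have [M2 HM2] := heat1_bounded eps0 i.+1.
have Ib : `](b - 1), (b + 1)[%classic b by rewrite /= in_itv/= ltrBlDr ltrDl ltr01.
pose f (y : R) om := heat1 eps j (Z om + a) * heat1 eps i (Z' om + y).
have df (y : R) om : is_derive y 1 (f ^~ om : R -> R)
    (heat1 eps j (Z om + a) * heat1 eps i.+1 (Z' om + y)).
  exact: (drvZ _ (drv_heat1_shift i (Z' om) y)).
have d1E y om : partial1of2 f y om = heat1 eps j (Z om + a) * heat1 eps i.+1 (Z' om + y).
  exact: drv_val.
have M0 : 0 <= M1 * M2.
  by rewrite mulr_ge0//; [exact: le_trans (HM1 0)|exact: le_trans (HM2 0)].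
have Gub y om : `](b - 1), (b + 1)[%classic y -> setT om ->
    `|partial1of2 f y om| <= M1 * M2.
  by move=> _ _; rewrite d1E normrM ler_pM.
have H1 := @derivable_under_integral _ _ _ P f setT measurableT b _ _ Ib
  (fun y _ => bmf_integrable P (bmf_pair j i a y))
  (fun y om _ _ => drv_derivable (df y om)) (fun=> M1 * M2) (fun=> M0)
  (bmf_integrable P (bmf_cst _)) Gub.
have H2 := @differentiation_under_integral _ _ _ P f setT measurableT b _ _ Ib
  (fun y _ => bmf_integrable P (bmf_pair j i a y))
  (fun y om _ _ => drv_derivable (df y om)) (fun=> M1 * M2) (fun=> M0)
  (bmf_integrable P (bmf_cst _)) Gub.
have := derivableP H1; rewrite -derive1E H2 => /drv_eq; apply.
by apply: eq_Rintegral => om _; exact: d1E.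
Qed.

(** Differentiating in [a] raises [j] on both sides, by [drv_heat1] under the integral and by
    [drv_wick_gauss] on the right; likewise [b] raises [i]. This is why the two shifts are kept
    apart, although both are x l in the end. *)
Lemma Rintegral_heat1_pair j i (a b : R) :
  \int[P]_om (heat1 eps j (Z om + a) * heat1 eps i (Z' om + b)) =
  (2 * pi * Num.sqrt D)^-1 *
  (wick (B0 / D * a - c / D * b) (A0 / D * b - c / D * a)
     (B0 / D) (A0 / D) (c / D) j i *
   expR (- ((B0 / D * (a * a) - 2 * (c / D) * (a * b) + A0 / D * (b * b)) / 2))).
Proof.
rewrite -/(F j i a b).
elim: j i a b => [|j IHj] i a b.
  elim: i a b => [|i IHi] a b.
    by rewrite /F Rintegral_heat1_pair0 /= mul1r.
  rewrite -(drv_val (F_deriv2 0 i a b)).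
  have -> := funext (IHi a).
  exact: (drv_val (drvZ _ (drv_wick_gauss0 (B0 / D) (A0 / D) (c / D) a b i))).
rewrite -(drv_val (F_deriv1 j i a b)).
have -> := funext (fun y => IHj i y b).
exact: (drv_val (drvZ _ (drv_wick_gauss (B0 / D) (A0 / D) (c / D) a b j i))).
Qed.

End gaussian_pair.

(** * Upper and lower bounds for the pair density *)

(** The factors are replaced one at a time. [C] depends on [N] and [M] only, so the error stays
    linear in [t]. *)
Lemma prod_perturb {R : realType} (I : Type) (N M : I -> R) (s : seq I) :
  (forall l, 0 <= N l) -> (forall l, 0 <= M l) ->
  exists2 C : R, 0 <= C & forall (S W V : I -> R) (t : R), 0 <= t ->
  (forall l, 0 <= S l) -> (forall l, `|W l| <= N l * S l) ->
  (forall l, `|V l| <= N l * S l) -> (forall l, `|W l - V l| <= t * M l * S l) ->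
  `|\prod_(l <- s) W l - \prod_(l <- s) V l| <= t * C * \prod_(l <- s) S l.
Proof.
move=> N0 M0; elim: s => [|i s [C C0 IH]].
  by exists 0 => // *; rewrite !big_nil subrr normr0 mulr0 mul0r.
exists (M i * \prod_(l <- s) N l + N i * C).
  by rewrite addr_ge0 ?mulr_ge0 ?prodr_ge0.
move=> S W V t t0 S0 HW HV HD; rewrite !big_cons.
set PW := \prod_(l <- s) W l; set PV := \prod_(l <- s) V l.
set PS := \prod_(l <- s) S l; set PN := \prod_(l <- s) N l.
have -> : W i * PW - V i * PV = (W i - V i) * PW + V i * (PW - PV) by ring.
have HPW : `|PW| <= PN * PS.
  by rewrite /PW normr_prod /PN /PS -big_split /=; apply: ler_prod => l _; rewrite normr_ge0 HW.
have -> : t * (M i * PN + N i * C) * (S i * PS) =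
  (t * M i * S i) * (PN * PS) + (N i * S i) * (t * C * PS) by ring.
apply: (le_trans (ler_normD _ _)); apply: lerD; rewrite normrM ler_pM//.
exact: IH.
Qed.

Section pair_density_bounds.
Context {R : realType} {d : nat}.
Variables (x : 'I_d -> R) (k : 'I_d -> nat) (M : R).
Hypothesis x0 : 0 < \sum_(l < d) x l ^+ 2.
Hypothesis M1 : 1 <= M.

Let D (A0 B0 c : R) : R := A0 * B0 - c ^+ 2.

(** The mean of a product of two k-th derivatives of the heat kernel, as a function of the
    regularised variances [A0], [B0] and the covariance [c]: its factors are those of
    [Rintegral_heat1_pair] with both shifts equal to x l. *)
Definition pair_density (A0 B0 c : R) : R := \prod_(l < d)
  ((2 * pi * Num.sqrt (D A0 B0 c))^-1 *
  (wick (B0 / D A0 B0 c * x l - c / D A0 B0 c * x l)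
     (A0 / D A0 B0 c * x l - c / D A0 B0 c * x l)
     (B0 / D A0 B0 c) (A0 / D A0 B0 c) (c / D A0 B0 c) (k l) (k l) *
   expR (- ((B0 / D A0 B0 c * (x l * x l) - 2 * (c / D A0 B0 c) * (x l * x l) +
     A0 / D A0 B0 c * (x l * x l)) / 2)))).

Let X := \sum_(l < d) x l ^+ 2.
Let m := order_of k.
(** Chosen so that s = L / (v r) is a scale for all Wick arguments: M |x l| <= L serves the linear
    ones, and 2 M <= L, together with v <= M and r <= 2 M, the quadratic ones. *)
Let L := 2 * M * (1 + \sum_(l < d) `|x l|).

Let M0 : 0 < M. Proof. exact: lt_le_trans M1. Qed.

Let xL l : M * `|x l| <= L /\ `|x l| <= L.
Proof.
have h : `|x l| <= \sum_(l < d) `|x l|.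
  by rewrite (bigD1 l)//= lerDl sumr_ge0.
have h0 : 0 <= \sum_(l < d) `|x l| by exact: sumr_ge0.
move: h h0 (normr_ge0 (x l)); rewrite /L; move: (\sum_(_ < _) _) `|x l| => S y h h0 y0.
have h1 : 0 <= S - y by rewrite subr_ge0.
have h2 : 0 <= M - 1 by rewrite subr_ge0.
have := mulr_ge0 (ltW M0) h1; have := mulr_ge0 (ltW M0) h0.
have := mulr_ge0 h2 y0; have := M0; have := M1; split; lra.
Qed.

Let L2M : 2 * M <= L.
Proof.
have h0 : 0 <= \sum_(l < d) `|x l| by exact: sumr_ge0.
by rewrite /L ler_peMr// ?lerDl// mulr_ge0 ?ltW.
Qed.

(* everything is expressed through r = sqrt (A0 + B0 - 2 c) and the conditional
   variance v = D / r^2 *)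
Let setup (A0 B0 c : R) : 0 < A0 -> A0 <= M -> 0 < B0 -> B0 <= M -> 0 < D A0 B0 c ->
  let r := Num.sqrt (A0 + B0 - 2 * c) in
  exists v : R, [/\ 0 < r /\ r <= 2 * M, 0 < v /\ v <= M, D A0 B0 c = v * r ^+ 2,
    v = A0 - ((A0 - c) / r) ^+ 2 & 
    [/\ `|A0 - c| <= M * r, `|B0 - c| <= M * r & `|c| <= M]].
Proof.
move=> A00 A0M B00 B0M D0 r.
have cM : `|c| <= M.
  rewrite -(@ler_pXn2r _ 2) ?nnegrE//; last exact: ltW.
  rewrite real_normK ?num_real//; move: D0; rewrite /D; nra.
have r20 : 0 < A0 + B0 - 2 * c.
  (* If c were at least the mean of A0 and B0, its square would be at least A0 B0, against the
     positive determinant. *)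
  rewrite ltNge; apply/negP => h; move: D0; rewrite /D ltNge => /negP; apply.
  have h1 : 0 <= c - (A0 + B0) / 2 by lra.
  have h2 : 0 <= c + (A0 + B0) / 2 by lra.
  have := mulr_ge0 h1 h2; have := sqr_ge0 (A0 - B0); nra.
have rE : r ^+ 2 = A0 + B0 - 2 * c by rewrite /r sqr_sqrtr// ltW.
have r0 : 0 < r by rewrite sqrtr_gt0.
have rN0 := lt0r_neq0 r0.
have M20 : 0 <= M by exact: ltW.
have MM : M <= M ^+ 2 by rewrite expr2 ler_peMl.
(* These two forms of the determinant exhibit v as A0 minus the part explained by Z - Z'. Positivity
   then bounds A0 - c and B0 - c by M r. *)
have dA : D A0 B0 c = A0 * r ^+ 2 - (A0 - c) ^+ 2 by rewrite rE /D; ring.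
have dB : D A0 B0 c = B0 * r ^+ 2 - (B0 - c) ^+ 2 by rewrite rE /D; ring.
have r2p : 0 < r ^+ 2 by rewrite exprn_gt0.
have sqle (y : R) : y ^+ 2 <= M ^+ 2 * r ^+ 2 -> `|y| <= M * r.
  move=> h; rewrite -(@ler_pXn2r _ 2) ?nnegrE ?mulr_ge0//; last exact: ltW.
  by rewrite real_normK ?num_real// exprMn.
exists (D A0 B0 c / r ^+ 2); split.
- split => //; rewrite -(@ler_pXn2r _ 2) ?nnegrE ?mulr_ge0//; last exact: ltW.
  have hc : - c <= M by apply: le_trans cM; rewrite -normrN ler_norm.
  have -> : (2 * M) ^+ 2 = 4 * M ^+ 2 by ring.
  by rewrite rE; lra.
- split; first by rewrite divr_gt0.
  rewrite ler_pdivrMr// dA; apply: (@le_trans _ _ (A0 * r ^+ 2)).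
    by rewrite gerBl sqr_ge0.
  by rewrite ler_wpM2r// ltW.
- by rewrite divfK// lt0r_neq0.
- by rewrite dA; field.
- split => //; apply: sqle.
    apply: (@le_trans _ _ (A0 * r ^+ 2)); first by rewrite -subr_ge0 -dA ltW.
    apply: ler_wpM2r; [exact: ltW|exact: le_trans MM].
  apply: (@le_trans _ _ (B0 * r ^+ 2)); first by rewrite -subr_ge0 -dB ltW.
  apply: ler_wpM2r; [exact: ltW|exact: le_trans MM].
Qed.

(** With y = 1 / sqrt v, completing the square gives y - X y^2 / 2 <= 1 / (2 X), and y^n exp (- y)
    <= n!. This is where x being nonzero enters. *)
Let gauss_decay (n : nat) : exists2 C : R, 0 < C &
  forall v, 0 < v -> (Num.sqrt v)^-1 ^+ n * expR (- (X / (2 * v))) <= C.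
Proof.
exists (n`!%:R * expR ((2 * X)^-1)); first by rewrite mulr_gt0 ?expR_gt0// ltr0n fact_gt0.
move=> v v0; set y := (Num.sqrt v)^-1.
have sv0 : 0 < Num.sqrt v by rewrite sqrtr_gt0.
have y0 : 0 <= y by rewrite invr_ge0 ltW.
have yE : y ^+ 2 = v^-1 by rewrite exprVn sqr_sqrtr// ltW.
have XN0 : X != 0 by exact: lt0r_neq0.
apply: (@le_trans _ _ (y ^+ n * (expR (- y) * expR ((2 * X)^-1)))).
  rewrite ler_wpM2l ?exprn_ge0// -expRD ler_expR.
  have -> : X / (2 * v) = X * y ^+ 2 / 2 by rewrite yE; field; exact: lt0r_neq0.
  have -> : - y + (2 * X)^-1 = - (X * y ^+ 2 / 2) + (X * y - 1) ^+ 2 / (2 * X) by field.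
  by rewrite lerDl divr_ge0 ?sqr_ge0// mulr_ge0// ltW.
by rewrite mulrA ler_wpM2r ?expR_ge0// exprn_expRN_bound.
Qed.

(** As both shifts equal x l, the quadratic form collapses to (A0 + B0 - 2 c) (x l)^2 / D = (x l)^2
    / v: r cancels and the exponential depends on v alone. *)
Let prefactorE (A0 B0 c v r : R) : 0 < r -> 0 < v -> D A0 B0 c = v * r ^+ 2 ->
  r ^+ 2 = A0 + B0 - 2 * c ->
  pair_density A0 B0 c = ((2 * pi)^-1 ^+ d * (Num.sqrt v)^-1 ^+ d * r^-1 ^+ d *
    expR (- (X / (2 * v)))) *
  \prod_(l < d) wick ((B0 - c) * x l / (v * r ^+ 2)) ((A0 - c) * x l / (v * r ^+ 2))
     (B0 / (v * r ^+ 2)) (A0 / (v * r ^+ 2)) (c / (v * r ^+ 2)) (k l) (k l).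
Proof.
move=> r0 v0 DE rE; rewrite /pair_density DE.
have -> : Num.sqrt (v * r ^+ 2) = Num.sqrt v * r.
  by rewrite sqrtrM ?ltW// sqrtr_sqr gtr0_norm.
rewrite big_split /= prodr_const card_ord big_split /= -expR_sum.
have -> : \sum_(l < d) - ((B0 / (v * r ^+ 2) * (x l * x l) -
    2 * (c / (v * r ^+ 2)) * (x l * x l) + A0 / (v * r ^+ 2) * (x l * x l)) / 2) =
    - (X / (2 * v)).
  rewrite sumrN /X mulr_suml; congr (- _); apply: eq_bigr => l _.
  have -> : B0 / (v * r ^+ 2) * (x l * x l) - 2 * (c / (v * r ^+ 2)) * (x l * x l) +
    A0 / (v * r ^+ 2) * (x l * x l) = (A0 + B0 - 2 * c) * x l ^+ 2 / (v * r ^+ 2) by ring.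
  by rewrite -rE; field; rewrite !lt0r_neq0.
rewrite !invfM !exprMn -!mulrA; congr (_ * (_ * (_ * (_ * _)))).
rewrite mulrC; congr (_ * _); apply: eq_bigr => l _.
by congr (wick _ _ _ _ _ _ _); ring.
Qed.

(** A Wick factor has size s^(2 k l) with s = L / (v r), so the product is of order r^(-d-2m) times
    a power of 1 / v which the exponential absorbs. If A0 - c and B0 - c are at most t r,
    [wick_perturb] replaces the Wick product by a nonnegative one at a cost t C, whence the second
    bound. In the third, [a0] keeps v and c away from 0, so the leading term (c / D)^m is itself at
    least of order r^(-2m). *)
Lemma pair_density_bounds : exists2 C : R, 0 < C & 
  [/\ (forall A0 B0 c, 0 < A0 -> A0 <= M -> 0 < B0 -> B0 <= M -> 0 < D A0 B0 c ->
       `|pair_density A0 B0 c| <= C * (Num.sqrt (A0 + B0 - 2 * c))^-1 ^+ (d + 2 * m)),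
    (forall A0 B0 c t, 0 < A0 -> A0 <= M -> 0 < B0 -> B0 <= M -> 0 < D A0 B0 c ->
       0 <= t -> t <= 1 -> `|A0 - c| <= t * Num.sqrt (A0 + B0 - 2 * c) ->
       `|B0 - c| <= t * Num.sqrt (A0 + B0 - 2 * c) ->
       - (t * C) * (Num.sqrt (A0 + B0 - 2 * c))^-1 ^+ (d + 2 * m) <=
         pair_density A0 B0 c) &
    (forall a0 : R, 0 < a0 -> exists2 c0 : R, 0 < c0 &
     forall A0 B0 c t, 0 < A0 -> A0 <= M -> 0 < B0 -> B0 <= M -> 0 < D A0 B0 c ->
       0 <= t -> t <= 1 -> `|A0 - c| <= t * Num.sqrt (A0 + B0 - 2 * c) ->
       `|B0 - c| <= t * Num.sqrt (A0 + B0 - 2 * c) ->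
       a0 <= c -> a0 <= A0 - t ^+ 2 ->
       (c0 - t * C) * (Num.sqrt (A0 + B0 - 2 * c))^-1 ^+ (d + 2 * m) <=
         pair_density A0 B0 c)].
Proof.
pose N (l : 'I_d) := @wick_majorant R (k l) (k l).
have /(_ _)/cid2-/all_sig2[Mp Mp0 HMp] : forall l : 'I_d, exists2 Ml : R, 0 <= Ml &
  forall al be A B C s t, 0 <= s -> 0 <= t -> t <= 1 -> `|al| <= t * s -> `|be| <= t * s ->
  `|A| <= s ^+ 2 -> `|B| <= s ^+ 2 -> `|C| <= s ^+ 2 -> - (t * s ^+ 2) <= C ->
  `|wick al be A B C (k l) (k l) - wick 0 0 A B (Num.max C 0) (k l) (k l)| <=
     t * Ml * s ^+ (k l + k l).
  by move=> l; exact: wick_perturb.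
have N0 l : 0 <= N l by exact: wick_majorant_ge0.
have [C1 C10 HC1] := @prod_perturb R _ N Mp (index_enum 'I_d) N0 Mp0.
(* As powers of 1 / sqrt v, the prefactor contributes d and the scale s^(2m) contributes 4 m. *)
have [C2 C20 HC2] := gauss_decay (d + 4 * m).
pose PN := \prod_(l < d) N l.
have PN0 : 0 <= PN by exact: prodr_ge0.
pose C0 := (2 * pi)^-1 ^+ d * L ^+ (2 * m) * C2.
have p0 := pi_gt0 R.
have tp0 : 0 <= (2 * pi)^-1 ^+ d :> R by rewrite exprn_ge0// invr_ge0 mulr_ge0// ltW.
have L0 : 0 < L by apply: lt_le_trans L2M; rewrite mulr_gt0.
have C00 : 0 <= C0 by rewrite /C0 !mulr_ge0// ?exprn_ge0 ?ltW.
pose C := C0 * (PN + C1) + 1.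
have hC1 : C0 * PN <= C by rewrite /C mulrDr -addrA lerDl addr_ge0// mulr_ge0.
have hC2 : C0 * C1 <= C by rewrite /C mulrDr [_ * PN + _]addrC -addrA lerDl addr_ge0// mulr_ge0.
exists C; first by rewrite /C ltr_pwDr// mulr_ge0// addr_ge0.
(* the quantity G s^(2m), where s is the scale of the Wick coefficients *)
have Gs (v r : R) : 0 < v -> 0 < r ->
    (2 * pi)^-1 ^+ d * (Num.sqrt v)^-1 ^+ d * r^-1 ^+ d * expR (- (X / (2 * v))) *
    (L / (v * r)) ^+ (2 * m) <= C0 * r^-1 ^+ (d + 2 * m).
  move=> v0 r0; have := HC2 v v0.
  have -> : (Num.sqrt v)^-1 ^+ (d + 4 * m) = (Num.sqrt v)^-1 ^+ d * v^-1 ^+ (2 * m).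
    rewrite exprD (_ : 4 * m = 2 * (2 * m))%N; last by rewrite mulnA.
    have e : (Num.sqrt v)^-1 ^+ 2 = v^-1 by rewrite exprVn sqr_sqrtr// ltW.
    by rewrite [X in _ * X = _]exprM e.
  move=> h.
  have -> : (L / (v * r)) ^+ (2 * m) = L ^+ (2 * m) * v^-1 ^+ (2 * m) * r^-1 ^+ (2 * m).
    by rewrite invfM !exprMn mulrA.
  rewrite exprD; set e := expR _ in h *; set a := (2 * pi)^-1 ^+ d.
  have -> : a * (Num.sqrt v)^-1 ^+ d * r^-1 ^+ d * e *
      (L ^+ (2 * m) * v^-1 ^+ (2 * m) * r^-1 ^+ (2 * m)) =
    (a * L ^+ (2 * m) * (r^-1 ^+ d * r^-1 ^+ (2 * m))) *
    ((Num.sqrt v)^-1 ^+ d * v^-1 ^+ (2 * m) * e) by ring.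
  have -> : C0 * (r^-1 ^+ d * r^-1 ^+ (2 * m)) =
   (a * L ^+ (2 * m) * (r^-1 ^+ d * r^-1 ^+ (2 * m))) * C2.
    by rewrite /C0 -/a; ring.
  apply: ler_wpM2l => //.
  by rewrite !mulr_ge0// ?exprn_ge0 ?invr_ge0 ?ltW.
have G_ge0 (v r : R) : 0 < r -> 0 <= (2 * pi)^-1 ^+ d * (Num.sqrt v)^-1 ^+ d *
    r^-1 ^+ d * expR (- (X / (2 * v))).
  move=> r0; rewrite mulr_ge0 ?expR_ge0//; apply: mulr_ge0.
    by apply: mulr_ge0 => //; rewrite exprn_ge0// invr_ge0 sqrtr_ge0.
  by rewrite exprn_ge0// invr_ge0 ltW.
have S2m (s : R) : \prod_(l < d) s ^+ (k l + k l) = s ^+ (2 * m).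
  rewrite -expr_sum; congr (_ ^+ _); rewrite /m /order_of big_distrr /=.
  by apply: eq_bigr => l _; rewrite mul2n addnn.
have cond (A0 B0 c : R) : 0 < A0 -> A0 <= M -> 0 < B0 -> B0 <= M -> 0 < D A0 B0 c ->
  let r := Num.sqrt (A0 + B0 - 2 * c) in
  exists v : R, [/\ 0 < r /\ 0 < v, v <= M, v = A0 - ((A0 - c) / r) ^+ 2,
    pair_density A0 B0 c = ((2 * pi)^-1 ^+ d * (Num.sqrt v)^-1 ^+ d * r^-1 ^+ d *
      expR (- (X / (2 * v)))) *
     \prod_(l < d) wick ((B0 - c) * x l / (v * r ^+ 2)) ((A0 - c) * x l / (v * r ^+ 2))
       (B0 / (v * r ^+ 2)) (A0 / (v * r ^+ 2)) (c / (v * r ^+ 2)) (k l) (k l) &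
    let s := L / (v * r) in
    [/\ 0 <= s, `|B0 / (v * r ^+ 2)| <= s ^+ 2, `|A0 / (v * r ^+ 2)| <= s ^+ 2,
      `|c / (v * r ^+ 2)| <= s ^+ 2 &
      [/\ forall l, `|(B0 - c) * x l / (v * r ^+ 2)| <= s /\
                  `|(A0 - c) * x l / (v * r ^+ 2)| <= s
       & forall t, 0 <= t -> `|A0 - c| <= t * r -> `|B0 - c| <= t * r ->
        - (t * s ^+ 2) <= c / (v * r ^+ 2) /\
        forall l, `|(B0 - c) * x l / (v * r ^+ 2)| <= t * s /\
                  `|(A0 - c) * x l / (v * r ^+ 2)| <= t * s]]].
  move=> A00 A0M B00 B0M D0 r.
  have [v [[r0 r2M] [v0 vM] DE vE [Ac Bc cM]]] := setup A00 A0M B00 B0M D0.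
  rewrite -/r in r0 r2M DE vE Ac Bc.
  have rE : r ^+ 2 = A0 + B0 - 2 * c.
    by rewrite /r sqr_sqrtr//; move: r0; rewrite /r sqrtr_gt0 => /ltW.
  exists v; split => //; first exact: prefactorE.
  have vr0 : 0 < v * r ^+ 2 by rewrite mulr_gt0// exprn_gt0.
  have sE : (L / (v * r)) ^+ 2 = (L ^+ 2 / v) / (v * r ^+ 2).
    by field; rewrite !lt0r_neq0.
  have LM : M <= L ^+ 2 / v.
    rewrite ler_pdivlMr//; move: L2M M1 v0 vM; nra.
  have Mb (y : R) : `|y| <= M -> `|y / (v * r ^+ 2)| <= (L / (v * r)) ^+ 2.
    move=> yM; rewrite sE normrM [`|_^-1|]gtr0_norm ?invr_gt0//.
    by rewrite ler_wpM2r ?invr_ge0 ?(ltW vr0)//; exact: le_trans LM.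
  have tb t l (y : R) : 0 <= t -> `|y| * `|x l| <= t * L * r ->
      `|y * x l / (v * r ^+ 2)| <= t * (L / (v * r)).
    move=> t0 h; rewrite !normrM [`|_^-1|]gtr0_norm ?invr_gt0//.
    rewrite ler_pdivrMr//; apply: (le_trans h).
    have -> : t * (L / (v * r)) * (v * r ^+ 2) = t * L * r by field; rewrite !lt0r_neq0.
    by [].
  have s0 : 0 <= L / (v * r) by exact: divr_ge0 (ltW L0) (mulr_ge0 (ltW v0) (ltW r0)).
  split; first exact: s0.
  - by apply: Mb; rewrite gtr0_norm.
  - by apply: Mb; rewrite gtr0_norm.
  - exact: Mb.
  - split.
      move=> l; have [xl _] := xL l; have := @tb 1 l; rewrite !mul1r => tb1.
      have xr : M * r * `|x l| <= L * r by rewrite mulrAC ler_wpM2r// ltW.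
      by split; apply: tb1 => //; apply: le_trans xr; rewrite ler_wpM2r.
    move=> t t0 Act Bct; split.
      have ct : - (t * r) <= c.
        move: Act; rewrite ler_norml => /andP[_]; move: A00; lra.
      rewrite sE mulrA -mulNr ler_wpM2r ?invr_ge0 ?(ltW vr0)//.
      apply: le_trans ct; rewrite lerN2 ler_wpM2l// ler_pdivlMr//.
      by move: L2M M1 v0 vM r0 r2M; nra.
    move=> l; have [_ xl] := xL l.
    have xr : t * r * `|x l| <= t * L * r.
      by rewrite mulrAC ler_wpM2r ?(ltW r0)// ler_wpM2l.
    by split; apply: tb => //; apply: le_trans xr; rewrite ler_wpM2r.
have low (A0 B0 c t : R) : 0 < A0 -> A0 <= M -> 0 < B0 -> B0 <= M -> 0 < D A0 B0 c ->
    0 <= t -> t <= 1 -> `|A0 - c| <= t * Num.sqrt (A0 + B0 - 2 * c) ->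
    `|B0 - c| <= t * Num.sqrt (A0 + B0 - 2 * c) ->
    let r := Num.sqrt (A0 + B0 - 2 * c) in
    exists v : R, [/\ 0 < r /\ 0 < v, v <= M, v = A0 - ((A0 - c) / r) ^+ 2 &
     ((2 * pi)^-1 ^+ d * (Num.sqrt v)^-1 ^+ d * r^-1 ^+ d * expR (- (X / (2 * v)))) *
     (Num.max (c / (v * r ^+ 2)) 0) ^+ m - t * C * r^-1 ^+ (d + 2 * m) <=
     pair_density A0 B0 c].
  move=> A00 A0M B00 B0M D0 t0 t1 Act Bct r.
  have [v [[r0 v0] vM vE -> [s0 hB hA hc [_ hx]]]] := cond _ _ _ A00 A0M B00 B0M D0.
  have [hc' hxt] := hx _ t0 Act Bct; rewrite -/r in r0 vE s0 hB hA hc hc' hxt *.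
  exists v; split => //.
  set s := L / (v * r) in s0 hB hA hc hc' hxt.
  set G := (2 * pi)^-1 ^+ d * _ * _ * _.
  have G0 : 0 <= G by exact: G_ge0.
  set c' := Num.max _ _.
  have c'0 : 0 <= c' by rewrite /c' le_max lexx orbT.
  have c's : `|c'| <= s ^+ 2.
    by rewrite /c'; case: (leP (c / (v * r ^+ 2)) 0) => // _; rewrite normr0 sqr_ge0.
  pose V (l : 'I_d) := wick 0 0 (B0 / (v * r ^+ 2)) (A0 / (v * r ^+ 2)) c' (k l) (k l).
  set W := (X in \prod_(l < d) X l).
  have ts : t * s <= s by rewrite ler_piMl.
  have H := HC1 (fun l => s ^+ (k l + k l)) W V t t0 (fun l => exprn_ge0 _ s0).
  have {}H : `|\prod_(l < d) W l - \prod_(l < d) V l| <= t * C1 * s ^+ (2 * m).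
    rewrite -S2m; apply: H => l.
    - have [h1 h2] := hxt l; apply: wick_bound => //; exact: le_trans ts.
    - by apply: wick_bound => //; rewrite normr0.
    - by have [h1 h2] := hxt l; apply: HMp.
  have vr0 : 0 <= v * r ^+ 2 by rewrite mulr_ge0 ?exprn_ge0 ?ltW.
  have HV : c' ^+ m <= \prod_(l < d) V l.
    rewrite /m /order_of expr_sum; apply: ler_prod => l _; rewrite exprn_ge0//=.
    have hB0 : 0 <= B0 / (v * r ^+ 2) by exact: divr_ge0 (ltW B00) vr0.
    have hA0 : 0 <= A0 / (v * r ^+ 2) by exact: divr_ge0 (ltW A00) vr0.
    apply: le_trans (wick0_ge hB0 hA0 c'0 (k l)).
    by rewrite ler_peMl ?exprn_ge0// ler1n fact_gt0.
  have e1 : G * (t * C1 * s ^+ (2 * m)) <= t * C * r^-1 ^+ (d + 2 * m).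
    have -> : G * (t * C1 * s ^+ (2 * m)) = t * C1 * (G * s ^+ (2 * m)) by ring.
    apply: (@le_trans _ _ (t * C1 * (C0 * r^-1 ^+ (d + 2 * m)))).
      by rewrite ler_wpM2l ?mulr_ge0//; exact: Gs.
    have -> : t * C1 * (C0 * r^-1 ^+ (d + 2 * m)) =
      t * (C0 * C1) * r^-1 ^+ (d + 2 * m) by ring.
    by rewrite ler_wpM2r ?exprn_ge0 ?invr_ge0 ?(ltW r0)// ler_wpM2l.
  have e2 := ler_wpM2l G0 HV.
  have e3 : G * (\prod_(l < d) V l - \prod_(l < d) W l) <= G * (t * C1 * s ^+ (2 * m)).
    by rewrite ler_wpM2l//; apply: le_trans H; rewrite distrC ler_norm.
  by move: e1 e2 e3; rewrite mulrBr; lra.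
split.
- move=> A0 B0 c A00 A0M B00 B0M D0.
  have [v [[r0 v0] vM vE -> [s0 hB hA hc [hx _]]]] := cond _ _ _ A00 A0M B00 B0M D0.
  set r := Num.sqrt _ in r0 vE s0 hB hA hc hx *.
  set G := (2 * pi)^-1 ^+ d * _ * _ * _.
  have G0 : 0 <= G by exact: G_ge0.
  rewrite normrM [`|G|]ger0_norm// normr_prod.
  apply: (@le_trans _ _ (G * (PN * (L / (v * r)) ^+ (2 * m)))).
    rewrite ler_wpM2l// -S2m /PN -big_split /=; apply: ler_prod => l _.
    by rewrite normr_ge0 /=; have [h1 h2] := hx l; exact: wick_bound.
  have -> : G * (PN * (L / (v * r)) ^+ (2 * m)) = PN * (G * (L / (v * r)) ^+ (2 * m)) by ring.
  apply: (@le_trans _ _ (PN * (C0 * r^-1 ^+ (d + 2 * m)))).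
    by rewrite ler_wpM2l//; exact: Gs.
  by rewrite mulrA ler_wpM2r ?exprn_ge0 ?invr_ge0 ?(ltW r0)// mulrC.
- move=> A0 B0 c t A00 A0M B00 B0M D0 t0 t1 Act Bct.
  have [v [[r0 v0] vM vE]] := low _ _ _ _ A00 A0M B00 B0M D0 t0 t1 Act Bct.
  apply: le_trans; rewrite mulNr -[leLHS]add0r lerD2r.
  apply: mulr_ge0; first exact: G_ge0.
  by rewrite exprn_ge0// le_max lexx orbT.
- move=> a0 a00.
  exists ((2 * pi)^-1 ^+ d * (Num.sqrt M)^-1 ^+ d * expR (- (X / (2 * a0))) * (a0 / M) ^+ m).
    rewrite mulr_gt0 ?exprn_gt0 ?divr_gt0// mulr_gt0 ?expR_gt0//.
    by rewrite mulr_gt0 ?exprn_gt0 ?invr_gt0 ?sqrtr_gt0 ?mulr_gt0.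
  move=> A0 B0 c t A00 A0M B00 B0M D0 t0 t1 Act Bct a0c a0A.
  have [v [[r0 v0] vM vE]] := low _ _ _ _ A00 A0M B00 B0M D0 t0 t1 Act Bct.
  set r := Num.sqrt _ in r0 vE Act *; apply: le_trans; rewrite mulrBl lerD2r.
  (* The correction ((A0 - c) / r)^2 in v is at most t^2. *)
  have av : a0 <= v.
    rewrite vE; apply: (le_trans a0A); rewrite lerD2l lerN2.
    rewrite -[leLHS]real_normK ?num_real//.
    rewrite ler_pXn2r ?nnegrE// normrM [`|r^-1|]gtr0_norm ?invr_gt0//.
    by rewrite ler_pdivrMr.
  have c1 : (a0 / M) * r^-1 ^+ 2 <= Num.max (c / (v * r ^+ 2)) 0.
    rewrite le_max; apply/orP; left; rewrite invfM exprVn mulrA.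
    rewrite ler_wpM2r ?invr_ge0 ?exprn_ge0 ?(ltW r0)//.
    by rewrite ler_pM ?invr_ge0 ?(ltW M0) ?(ltW a00)// lef_pV2 ?posrE.
  have -> : (2 * pi)^-1 ^+ d * (Num.sqrt M)^-1 ^+ d * expR (- (X / (2 * a0))) *
     (a0 / M) ^+ m * r^-1 ^+ (d + 2 * m) =
     ((2 * pi)^-1 ^+ d * (Num.sqrt M)^-1 ^+ d * r^-1 ^+ d * expR (- (X / (2 * a0)))) *
       ((a0 / M) * r^-1 ^+ 2) ^+ m.
    have -> : (a0 / M * r^-1 ^+ 2) ^+ m = (a0 / M) ^+ m * r^-1 ^+ (2 * m).
      by rewrite exprMn [r^-1 ^+ (2 * m)]exprM.
    by rewrite exprD; ring.
  apply: ler_pM.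
  + rewrite mulr_ge0 ?expR_ge0//; apply: mulr_ge0; last by rewrite exprn_ge0// invr_ge0 ltW.
    by apply: mulr_ge0 => //; rewrite exprn_ge0// invr_ge0 sqrtr_ge0.
  + by rewrite exprn_ge0// mulr_ge0 ?exprn_ge0 ?divr_ge0 ?invr_ge0 ?ltW.
  + apply: ler_pM; rewrite ?expR_ge0//.
    * apply: mulr_ge0; last by rewrite exprn_ge0// invr_ge0 ltW.
      by apply: mulr_ge0 => //; rewrite exprn_ge0// invr_ge0 sqrtr_ge0.
    * rewrite ler_wpM2r ?exprn_ge0 ?invr_ge0 ?(ltW r0)// ler_wpM2l//.
      apply: lerXn2r; rewrite ?nnegrE ?invr_ge0 ?sqrtr_ge0//.
      by rewrite lef_pV2 ?posrE ?sqrtr_gt0//; exact: ler_wsqrtr.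
    * rewrite ler_expR lerN2 ler_wpM2l ?(ltW x0)// lef_pV2 ?posrE ?mulr_gt0//.
      by rewrite ler_wpM2l.
  + apply: lerXn2r => //; rewrite nnegrE.
      by rewrite mulr_ge0 ?exprn_ge0 ?divr_ge0 ?invr_ge0 ?ltW.
    by rewrite le_max lexx orbT.
Qed.

End pair_density_bounds.

(** * Independence and factorisation of expectations *)

Section density_measure.
Context {R : realType} {d} {S : measurableType d}.
Variables (mu : {finite_measure set S -> \bar R}) (h : S -> R).
Hypothesis bh : bounded_measurable h.
Hypothesis h0 : forall x, 0 <= h x.

(** The proofs about [h] are arguments so that the structure of a measure can be attached to this
    expression. *)
Definition density_measure of bounded_measurable h & (forall x, 0 <= h x) :
  set S -> \bar R := fun A => (\int[mu]_(x in A) (h x)%:E)%E.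

Local Notation rho := (density_measure bh h0).

Let rho0 : rho set0 = 0%E.
Proof. by rewrite /density_measure integral_set0. Qed.

Let rho_ge0 A : (0 <= rho A)%E.
Proof. by apply: integral_ge0 => x _; rewrite lee_fin. Qed.

Let rho_sigma_additive : semi_sigma_additive rho.
Proof.
move=> /= A mA tA mUA; rewrite /density_measure integral_bigcup//=; last first.
  by apply: (integrableS _ _ (subsetT _)) => //; exact: bmf_integrable.
apply: is_cvg_ereal_nneg_natsum_cond => n _ _.
by apply: integral_ge0 => x _; rewrite lee_fin.
Qed.

HB.instance Definition _ := isMeasure.Build _ _ _ rho rho0 rho_ge0 rho_sigma_additive.

End density_measure.

Section independence.
Context {R : realType} {dO : measure_display} {Omega : measurableType dO}.
Variable P : probability Omega R.
Notation bmf := bounded_measurable.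

Lemma Rintegral_indic_prob (A : set Omega) : measurable A ->
  \int[P]_w \1_A w = fine (P A).
Proof. by move=> mA; rewrite /Rintegral integral_indic// setIT. Qed.

(* if h is uncorrelated with the events of a pi-system, it is uncorrelated
   with every bounded function measurable for the generated sigma-algebra *)
Lemma Rintegral_indep (C : set (set Omega)) (h g : Omega -> R) (c : R) :
  setI_closed C -> C setT -> C `<=` measurable -> bmf h ->
  (forall E, C E -> \int[P]_w (h w * \1_E w) = c * fine (P E)) ->
  bmf (g : g_sigma_algebraType C -> R) ->
  \int[P]_w (h w * g w) = c * \int[P]_w g w.
Proof.
move=> CI CT Cm bh hE bg; have [mh [M hM]] := bh.
have sCm : <<s C >> `<=` measurable.
  by apply: smallest_sub => //; exact: sigma_algebra_measurable.
pose phi : Omega -> g_sigma_algebraType C := idfun.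
have mphi : measurable_fun setT phi.
  by move=> _ B mB; rewrite setTI; exact: sCm.
have bgO : bmf (g : Omega -> R).
  case: bg => mg [Mg gM]; split; last by exists Mg.
  by move=> _ B mB; rewrite setTI; apply: sCm; have := mg measurableT B mB; rewrite setTI.
(* Shifting by the bound makes [h] a density. The measures with densities [h'] and c + M agree on
   the pi-system, hence on the sigma-algebra it generates, and so integrate [g] alike. *)
pose h' w := h w + M.
have bh' : bmf h' by apply: bmfD => //; exact: bmf_cst.
have h'0 w : 0 <= h' w.
  by rewrite /h' -lerBlDr sub0r; have := hM w; rewrite ler_norml => /andP[].
have mE E : C E -> measurable E by exact: Cm.
have IE E : C E -> \int[P]_w (h' w * \1_E w) = (c + M) * fine (P E).
  move=> CE; rewrite /h'; under eq_Rintegral do rewrite mulrDl.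
  rewrite bmf_RintegralD ?hE// ?bmf_RintegralZl ?Rintegral_indic_prob ?mulrDl//.
  - exact: mE.
  - by apply: bmf_indic; exact: mE.
  - by apply: bmfM => //; apply: bmf_indic; exact: mE.
  - by apply: bmfM; [exact: bmf_cst|apply: bmf_indic; exact: mE].
have cM0 : 0 <= c + M.
  have := IE setT CT; rewrite probability_setT mulr1 => <-.
  by apply: Rintegral_ge0 => w _; rewrite mulr_ge0// indicE.
pose m2 := mscale (NngNum cM0) P.
have rhoE E : <<s C >> E -> density_measure P bh' h'0 E = m2 E.
  apply: (@g_sigma_algebra_measure_unique _ _ _ C Cm (fun=> setT)) => //.
  - by rewrite bigcup_const.
  - move=> A CA; rewrite /m2 /mscale /= /density_measure integral_mkcond.
    transitivity ((c + M)%:E * P A)%E => //.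
    rewrite -[X in (_ * X)%E]fineK ?fin_num_measure//; last exact: Cm.
    rewrite -EFinM -IE// bmf_RintegralE; last first.
      by apply: bmfM => //; apply: bmf_indic; exact: mE.
    apply: eq_integral => w _; rewrite patchE indicE.
    by case: (_ \in _); rewrite ?mulr1 ?mulr0.
  - move=> _; apply: (@le_lt_trans _ _ (\int[P]_w h' w)%:E); last exact: ltry.
    by rewrite (bmf_RintegralE P bh').
pose nu := pushforward m2 phi.
have nuE1 A : measurable A -> nu A = (\int[P]_w (\1_A (phi w) * h' w)%:E)%E.
  move=> mA; rewrite /nu /pushforward -rhoE// /density_measure integral_mkcond.
  apply: eq_integral => w _; rewrite patchE indicE /phi.
  by rewrite -[_ @^-1` A]/A; case: (_ \in _); rewrite ?mul1r ?mul0r.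
have nuE2 A : measurable A -> nu A = (\int[P]_w (\1_A (phi w) * (c + M))%:E)%E.
  move=> mA; have mA' : measurable (A : set Omega) by exact: sCm.
  rewrite /nu /pushforward /m2 /mscale /= -[phi @^-1` A]/A.
  under eq_integral do rewrite mulrC EFinM.
  rewrite integralZl//; last by apply: bmf_integrable; exact: bmf_indic.
  by rewrite integral_indic// setIT.
have bgm : measurable_fun setT (g : g_sigma_algebraType C -> R) by case: bg.
have T1 := @Rintegral_transfer R _ _ _ _ nu P phi h' mphi (proj1 bh') h'0 nuE1 g bgm.
have T2 := @Rintegral_transfer R _ _ _ _ nu P phi (fun=> c + M) mphi
  (measurable_cst _) (fun=> cM0) nuE2 g bgm.
have /eqP : \int[P]_w (h w * g w) + M * \int[P]_w g w =
   c * \int[P]_w g w + M * \int[P]_w g w.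
  rewrite -mulrDl [RHS]mulrC -[RHS]bmf_RintegralZr// -[RHS]T2 T1 /h'.
  rewrite -bmf_RintegralZl// -bmf_RintegralD//; last 2 first.
  - exact: bmfM.
  - exact: bmfZ.
  by apply: eq_Rintegral => w _; rewrite /phi/=; ring.
by rewrite (inj_eq (addIr _)) => /eqP.
Qed.

(** Indicators are exchanged for the functions [U l] one coordinate at a time; each exchange is
    [Rintegral_indep] with the product over the other coordinates in the role of [h]. *)
Lemma Rintegral_prod_indep (d : nat) (C : 'I_d -> set (set Omega))
    (U : 'I_d -> Omega -> R) :
  (forall l, setI_closed (C l)) -> (forall l, C l setT) ->
  (forall l, C l `<=` measurable) ->
  (forall E : 'I_d -> set Omega, (forall l, C l (E l)) ->
     P (\bigcap_l E l) = (\prod_(l < d) P (E l))%E) ->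
  (forall l, bmf (U l : g_sigma_algebraType (C l) -> R)) ->
  \int[P]_w \prod_(l < d) U l w = \prod_(l < d) \int[P]_w U l w.
Proof.
move=> CI CT Cm CP bU.
have bUO l : bmf (U l : Omega -> R).
  case: (bU l) => mU [M UM]; split; last by exists M.
  have sCm : <<s C l >> `<=` measurable.
    by apply: smallest_sub => //; exact: sigma_algebra_measurable.
  by move=> _ B mB; rewrite setTI; apply: sCm; have := mU measurableT B mB; rewrite setTI.
have gen : forall n : nat, (n <= d)%N -> forall E : 'I_d -> set Omega,
    (forall l, C l (E l)) ->
    \int[P]_w \prod_(l < d) (if (l < n)%N then U l w else \1_(E l) w) =
    \prod_(l < d) (if (l < n)%N then \int[P]_w U l w else fine (P (E l))).
  elim => [_ E CE|n IH nd E CE].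
    have mE l : measurable (E l) by exact: Cm (CE l).
    have -> : (fun w => \prod_(l < d) (if (l < 0)%N then U l w else \1_(E l) w)) =
        \1_(\bigcap_l E l).
      apply/funext => w /=; under eq_bigr do rewrite indicE.
      rewrite indicE; have [wE|wE] := boolP (w \in \bigcap_l E l).
        rewrite big1// => l _; rewrite mem_set//; apply: (set_mem wE l) => //.
      move/negP : wE => wE; apply/eqP; rewrite /= prodf_seq_eq0; apply/hasP.
      have [l wl] : exists l, ~ E l w.
        by apply/existsNP => wE'; apply: wE; apply: mem_set => l _.
      exists l; first exact: mem_index_enum.
      by rewrite /= (memNset wl).
    rewrite Rintegral_indic_prob.
      rewrite CP// (eq_bigr (fun l => (fine (P (E l)))%:E)); last first.
        by move=> l _; rewrite fineK// fin_num_measure.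
      by rewrite prodEFin.
    by apply: fin_bigcap_measurable => //; exact: finite_finset.
  have bF (m : nat) (E' : 'I_d -> set Omega) (l : 'I_d) : (forall l, C l (E' l)) ->
      bmf (fun w : Omega => if (l < m)%N then U l w else \1_(E' l) w).
    move=> CE'; case: (l < m)%N; first exact: bUO.
    by apply: bmf_indic; exact: Cm (CE' l).
  pose i := Ordinal nd.
  have split_l (F G : 'I_d -> R) : \prod_(l < d) (if (l < n.+1)%N then F l else G l) =
      (\prod_(l < d | l != i) (if (l < n)%N then F l else G l)) * F i.
    rewrite (bigD1 i)//= ltnSn mulrC; congr (_ * _); apply: eq_bigr => l li.
    rewrite ltnS leq_eqVlt; case: eqVneq => //= ln.
    by case/negP: li; apply/eqP/val_inj.
  rewrite split_l; under eq_Rintegral do rewrite split_l.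
  apply: (@Rintegral_indep (C i)) => //.
    under eq_fun do rewrite -big_filter.
    by apply: bmf_prod => l; exact: bF.
  move=> E' CE'.
  pose E'' l := if l == i then E' else E l.
  have CE'' l : C l (E'' l) by rewrite /E''; case: eqVneq => [->|].
  have := IH (ltnW nd) E'' CE''.
  have split2 (F : 'I_d -> R) (G : 'I_d -> set Omega -> R) :
      \prod_(l < d) (if (l < n)%N then F l else G l (E'' l)) =
      (\prod_(l < d | l != i) (if (l < n)%N then F l else G l (E l))) * G i E'.
    rewrite (bigD1 i)//= ltnn /E'' eqxx mulrC; congr (_ * _).
    by apply: eq_bigr => l /negbTE ->.
  rewrite (split2 _ (fun l A => fine (P A))) => <-; apply: eq_Rintegral => w _.
  by rewrite (split2 (fun l => U l w) (fun l A => \1_A w)).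
have := gen d (leqnn d) (fun=> setT) CT.
under eq_bigr do rewrite ltn_ord.
move=> <-; apply: eq_Rintegral => w _; apply: eq_bigr => l _.
by rewrite ltn_ord.
Qed.

End independence.

Section process.
Context {R : realType} {dO : measure_display} {Omega : measurableType dO}.
Variable P : probability Omega R.
Variable d : nat.
Notation bmf := bounded_measurable.
Implicit Types X Y : R -> 'I_d -> {RV P >-> R}.

Lemma sigma_process_setI_closed X A : setI_closed (sigma_process X A).
Proof.
move=> E F; rewrite /sigma_process; set G := (X in <<s X >>) => GE GF.
exact: (@measurableI _ (g_sigma_algebraType G) E F GE GF).
Qed.

Lemma sigma_process_setT X A : sigma_process X A setT.
Proof.
rewrite /sigma_process; set G := (X in <<s X >>).
exact: (@measurableT _ (g_sigma_algebraType G)).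
Qed.

Lemma sigma_process_measurable X A : sigma_process X A `<=` measurable.
Proof.
apply: smallest_sub; first exact: sigma_algebra_measurable.
move=> _ [t [l [B [_ _ mB ->]]]].
by rewrite -[X in measurable X]setTI; exact: (measurable_funPT (X t l)).
Qed.

Lemma sigma_processS X A B : A `<=` B -> sigma_process X A `<=` sigma_process X B.
Proof.
move=> AB; apply: sub_sigma_algebra2 => _ [t [l [D [t0 Al mD ->]]]].
by exists t, l, D; split => //; exact: AB.
Qed.

Lemma sigma_process_preimage X A t l B : 0 <= t -> A l -> measurable B ->
  sigma_process X A (X t l @^-1` B).
Proof. by move=> t0 Al mB; apply: sub_sigma_algebra; exists t, l, B. Qed.

Lemma sigma_process_bigcap X (E : 'I_d -> set Omega) :
  (forall l, sigma_process X [set l] (E l)) -> sigma_process X setT (\bigcap_l E l).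
Proof.
move=> HE; have {}HE l : sigma_process X setT (E l).
  by apply: sigma_processS (HE l).
move: HE; rewrite /sigma_process; set G := (X in <<s X >>) => HE.
apply: (@fin_bigcap_measurable _ (g_sigma_algebraType G)).
  exact: finite_finset.
by move=> l _; exact: HE.
Qed.

Lemma sigma_process_RV X A t l : 0 <= t -> A l ->
  measurable_fun setT (X t l : g_sigma_algebraType (sigma_process X A) -> R).
Proof.
move=> t0 Al _ B mB; rewrite setTI; apply: sub_sigma_algebra.
exact: sigma_process_preimage.
Qed.

(** [Rintegral_indep] is used twice: to pass from events of [Y] to [g], and from events of [X] to
    [f]. *)
Lemma independent_processes_indep X Y (f g : Omega -> R) :
  independent_processes X Y ->
  bmf (f : g_sigma_algebraType (sigma_process X setT) -> R) ->
  bmf (g : g_sigma_algebraType (sigma_process Y setT) -> R) ->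
  \int[P]_w (f w * g w) = (\int[P]_w f w) * \int[P]_w g w.
Proof.
move=> iXY bf bg.
have bO (Z : R -> 'I_d -> {RV P >-> R}) (h : Omega -> R) :
    bmf (h : g_sigma_algebraType (sigma_process Z setT) -> R) -> bmf (h : Omega -> R).
  move=> [mh [M hM]]; split; last by exists M.
  have sm : <<s sigma_process Z setT >> `<=` measurable.
    apply: smallest_sub; first exact: sigma_algebra_measurable.
    exact: sigma_process_measurable.
  by move=> _ B mB; rewrite setTI; apply: sm; have := mh measurableT B mB; rewrite setTI.
transitivity (\int[P]_w (g w * f w)).
  by apply: eq_Rintegral => w _; rewrite mulrC.
rewrite [RHS]mulrC.
have H := (@Rintegral_indep _ _ _ P (sigma_process X setT) g f (\int[P]_w g w)
  (@sigma_process_setI_closed X setT) (@sigma_process_setT X setT)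
  (@sigma_process_measurable X setT) (bO _ _ bg)).
apply: H; last exact: bf.
move=> E HE.
have mE : measurable E by exact: sigma_process_measurable HE.
transitivity (\int[P]_w (\1_E w * g w)).
  by apply: eq_Rintegral => w _; rewrite mulrC.
rewrite [RHS]mulrC.
apply: (@Rintegral_indep _ _ _ P (sigma_process Y setT) (\1_E) g (fine (P E))
  (@sigma_process_setI_closed Y setT) (@sigma_process_setT Y setT)
  (@sigma_process_measurable Y setT) (bmf_indic mE) _ bg).
move=> F HF; have mF : measurable F by exact: sigma_process_measurable HF.
rewrite -fineM ?fin_num_measure// -iXY// -Rintegral_indic_prob//; last exact: measurableI.
by apply: eq_Rintegral => w _; rewrite indicI.
Qed.

(** A pi-system generating the joint sigma-algebra of the l-th components of X and Y. Independence
    of the processes, combined with that of the components of each, makes these systems independent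
    for different l. *)
Definition component_events X Y (l : 'I_d) : set (set Omega) :=
  [set C | exists E F, [/\ sigma_process X [set l] E, sigma_process Y [set l] F &
     C = E `&` F]].

Lemma component_events_RVl X Y l t : 0 <= t ->
  measurable_fun setT (X t l : g_sigma_algebraType (component_events X Y l) -> R).
Proof.
move=> t0 _ B mB; rewrite setTI; apply: sub_sigma_algebra.
exists (X t l @^-1` B), setT; split; last by rewrite setIT.
- exact: sigma_process_preimage.
- exact: sigma_process_setT.
Qed.

Lemma component_events_RVr X Y l t : 0 <= t ->
  measurable_fun setT (Y t l : g_sigma_algebraType (component_events X Y l) -> R).
Proof.
move=> t0 _ B mB; rewrite setTI; apply: sub_sigma_algebra.
exists setT, (Y t l @^-1` B); split; last by rewrite setTI.
- exact: sigma_process_setT.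
- exact: sigma_process_preimage.
Qed.

Lemma Rintegral_prod_components X Y (U : 'I_d -> Omega -> R) :
  independent_processes X Y -> independent_components X -> independent_components Y ->
  (forall l, bmf (U l : g_sigma_algebraType (component_events X Y l) -> R)) ->
  \int[P]_w \prod_(l < d) U l w = \prod_(l < d) \int[P]_w U l w.
Proof.
move=> iXY iX iY bU; apply: (@Rintegral_prod_indep _ _ _ P _ (component_events X Y)) => //.
- move=> l _ _ [E [F [HE HF ->]]] [E' [F' [HE' HF' ->]]].
  exists (E `&` E'), (F `&` F'); split; last by rewrite setIACA.
  + exact: sigma_process_setI_closed.
  + exact: sigma_process_setI_closed.
- move=> l; exists setT, setT; split; last by rewrite setIT.
  + exact: sigma_process_setT.
  + exact: sigma_process_setT.
- move=> l _ [E [F [HE HF ->]]]; apply: measurableI.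
  + exact: sigma_process_measurable HE.
  + exact: sigma_process_measurable HF.
- move=> C HC.
  have /choice[E HE] := HC; have /choice[F HF] := HE.
  have hE l : sigma_process X [set l] (E l) by case: (HF l).
  have hF l : sigma_process Y [set l] (F l) by case: (HF l).
  have CE : C = fun l => E l `&` F l by apply/funext => l; case: (HF l).
  rewrite CE bigcapI iXY; [|exact: sigma_process_bigcap|exact: sigma_process_bigcap].
  rewrite iX// iY// -big_split /=; apply: eq_bigr => l _; rewrite iXY//.
    exact: sigma_processS (hE l).
  exact: sigma_processS (hF l).
Qed.

End process.

(** * Covariances and characteristic functions of the processes *)

Section process_covariance.
Context {R : realType} {dO : measure_display} {Omega : measurableType dO}.
Variable P : probability Omega R.
Variable d : nat.
Notation bmf := bounded_measurable.

Definition pcov (X : R -> 'I_d -> {RV P >-> R}) (l : 'I_d) (s t : R) : R :=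
  \int[P]_w (X s l w * X t l w).

Lemma expectationE (f : Omega -> R) : P.-integrable setT (EFin \o f) ->
  ('E_P[f] = (\int[P]_w f w)%:E)%E.
Proof.
by move=> If; rewrite unlock /Rintegral fineK//; exact: integrable_fin_num If.
Qed.

Section one_process.
Variable X : R -> 'I_d -> {RV P >-> R}.
Hypothesis gX : gaussian_process X.
Hypothesis cX : centered_process X.

Lemma gaussian_process_combo (l : 'I_d) (a b s t : R) : 0 <= s -> 0 <= t ->
  gaussian_rv P (fun w => a * X s l w + b * X t l w).
Proof.
move=> s0 t0.
pose f (u v : R) (i : 'I_2) := if i == 0 :> nat then u else v.
have := @gX 2 (f a b) (f s t) (fun=> l).
have -> : (fun w => \sum_(i < 2) f a b i * X (f s t i) l w) =
    (fun w => a * X s l w + b * X t l w).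
  by apply/funext => w; rewrite big_ord_recr big_ord1.
by apply => i; rewrite /f; case: ifP.
Qed.

Lemma process_measurable (l : 'I_d) (t : R) : measurable_fun setT (X t l).
Proof. exact: measurable_funPT. Qed.

Lemma process_integrableX2 (l : 'I_d) (t : R) : 0 <= t ->
  P.-integrable setT (EFin \o (fun w => X t l w * X t l w)).
Proof.
move=> t0; have g := gaussian_process_combo l 1 0 t0 t0.
have mY : measurable_fun setT (fun w => 1 * X t l w + 0 * X t l w).
  by apply: measurable_funD; apply: measurable_funM => //; exact: process_measurable.
have [m [s [I2 _ _ _]]] := gaussian_rv_moments mY g.
by apply: eq_integrable I2 => // w _ /=; rewrite mul1r mul0r addr0 expr2.
Qed.

Lemma process_integrableM (l : 'I_d) (s t : R) : 0 <= s -> 0 <= t ->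
  P.-integrable setT (EFin \o (fun w => X s l w * X t l w)).
Proof.
move=> s0 t0.
have I := integrableD measurableT (process_integrableX2 l s0) (process_integrableX2 l t0).
apply: (le_integrable measurableT _ _ I).
  by apply/measurable_EFinP; apply: measurable_funM; exact: process_measurable.
move=> w _ /=; rewrite lee_fin normrM.
set a := X s l w; set b := X t l w.
apply: le_trans (ler_norm _); rewrite -!expr2 -(@real_normK _ a) ?num_real// -(@real_normK _ b) ?num_real//.
have := sqr_ge0 (`|a| - `|b|); have := sqr_ge0 `|a|; have := sqr_ge0 `|b|.
have := mulr_ge0 (normr_ge0 a) (normr_ge0 b); nra.
Qed.

Lemma process_integrable1 (l : 'I_d) (t : R) : 0 <= t ->
  P.-integrable setT (EFin \o (X t l : Omega -> R)).
Proof.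
move=> t0; have I1 : P.-integrable setT (EFin \o (fun=> 1 : R)).
  by apply: bmf_integrable; exact: bmf_cst.
have I := integrableD measurableT I1 (process_integrableX2 l t0).
apply: (le_integrable measurableT _ _ I).
  by apply/measurable_EFinP; exact: process_measurable.
move=> w _ /=; rewrite lee_fin -expr2; apply: le_trans (ler_norm _).
by rewrite -(@real_normK _ (X t l w)) ?num_real//; have := sqr_ge0 (`|X t l w| - 1); nra.
Qed.

Lemma process_mean0 (l : 'I_d) (t : R) : 0 <= t -> \int[P]_w X t l w = 0.
Proof.
move=> t0; have := cX l t0; rewrite expectationE; last exact: process_integrable1.
by case.
Qed.

Lemma pcovC (l : 'I_d) (s t : R) : pcov X l s t = pcov X l t s.
Proof. by apply: eq_Rintegral => w _; rewrite mulrC. Qed.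

Lemma process_combo_mean (l : 'I_d) (a b s t : R) : 0 <= s -> 0 <= t ->
  \int[P]_w (a * X s l w + b * X t l w) = 0.
Proof.
move=> s0 t0; have Is := process_integrable1 l s0; have It := process_integrable1 l t0.
rewrite RintegralD//; last 2 first.
- exact: (integrableZl measurableT a Is).
- exact: (integrableZl measurableT b It).
by rewrite !RintegralZl// !process_mean0// !mulr0 addr0.
Qed.

Lemma process_combo_integrable2 (l : 'I_d) (a b c e s t : R) : 0 <= s -> 0 <= t ->
  P.-integrable setT (EFin \o
    (fun w => (a * X s l w + b * X t l w) * (c * X s l w + e * X t l w))).
Proof.
move=> s0 t0.
have I1 := integrableZl measurableT (a * c) (process_integrableM l s0 s0).
have I2 := integrableZl measurableT (a * e + b * c) (process_integrableM l s0 t0).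
have I3 := integrableZl measurableT (b * e) (process_integrableM l t0 t0).
have I := integrableD measurableT (integrableD measurableT I1 I2) I3.
by apply: eq_integrable I => // w _ /=; rewrite -!EFinM -!EFinD; congr EFin; ring.
Qed.

Lemma process_combo_cov (l : 'I_d) (a b c e s t : R) : 0 <= s -> 0 <= t ->
  \int[P]_w ((a * X s l w + b * X t l w) * (c * X s l w + e * X t l w)) =
  a * c * pcov X l s s + (a * e + b * c) * pcov X l s t + b * e * pcov X l t t.
Proof.
move=> s0 t0.
have I1 := integrableZl measurableT (a * c) (process_integrableM l s0 s0).
have I2 := integrableZl measurableT (a * e + b * c) (process_integrableM l s0 t0).
have I3 := integrableZl measurableT (b * e) (process_integrableM l t0 t0).
have J1 := process_integrableM l s0 s0.
have J2 := process_integrableM l s0 t0.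
have J3 := process_integrableM l t0 t0.
transitivity (\int[P]_w ((a * c * (X s l w * X s l w) +
   (a * e + b * c) * (X s l w * X t l w)) + b * e * (X t l w * X t l w))).
  by apply: eq_Rintegral => w _; ring.
rewrite RintegralD//; last exact: (integrableD measurableT I1 I2).
by rewrite RintegralD// !RintegralZl.
Qed.

Lemma process_combo_cos (l : 'I_d) (a b s t th : R) : 0 <= s -> 0 <= t ->
  \int[P]_w cos (th + (a * X s l w + b * X t l w)) = cos th * expR (- ((a ^+ 2 *
    pcov X l s s + 2 * a * b * pcov X l s t + b ^+ 2 * pcov X l t t) / 2)).
Proof.
move=> s0 t0.
have mY : measurable_fun setT (fun w => a * X s l w + b * X t l w).
  by apply: measurable_funD; apply: measurable_funM => //; exact: process_measurable.
rewrite (gaussian_rv_cos mY) ?process_combo_mean//; last exact: gaussian_process_combo.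
have E : \int[P]_w (a * X s l w + b * X t l w) ^+ 2 =
    a ^+ 2 * pcov X l s s + 2 * a * b * pcov X l s t + b ^+ 2 * pcov X l t t.
  under eq_Rintegral do rewrite expr2.
  by rewrite process_combo_cov//; ring.
by rewrite E.
Qed.

Lemma pcov_psd (l : 'I_d) (a b s t : R) : 0 <= s -> 0 <= t ->
  0 <= a ^+ 2 * pcov X l s s + 2 * a * b * pcov X l s t + b ^+ 2 * pcov X l t t.
Proof.
move=> s0 t0; have -> : a ^+ 2 * pcov X l s s + 2 * a * b * pcov X l s t +
   b ^+ 2 * pcov X l t t = a * a * pcov X l s s + (a * b + b * a) * pcov X l s t +
   b * b * pcov X l t t by ring.
rewrite -process_combo_cov//; apply: Rintegral_ge0 => w _.
by rewrite -expr2 sqr_ge0.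
Qed.

Lemma expectation_increment (l : 'I_d) (s t : R) : 0 <= s -> 0 <= t ->
  ('E_P[(fun w => (X t l w - X s l w) ^+ 2)%R] =
  (pcov X l t t - 2 * pcov X l s t + pcov X l s s)%:E)%E.
Proof.
move=> s0 t0.
have E : (fun w => (X t l w - X s l w) ^+ 2) =
    (fun w => (-1 * X s l w + 1 * X t l w) * (-1 * X s l w + 1 * X t l w)).
  by apply/funext => w; ring.
rewrite E expectationE; last exact: process_combo_integrable2.
by rewrite process_combo_cov//; congr EFin; ring.
Qed.

Lemma expectation_increment_cov (l : 'I_d) (s t : R) : 0 <= s -> 0 <= t ->
  ('E_P[(fun w => (X t l w - X s l w) * X s l w)%R] = (pcov X l s t - pcov X l s s)%:E)%E.
Proof.
move=> s0 t0.
have E : (fun w => (X t l w - X s l w) * X s l w) =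
    (fun w => (-1 * X s l w + 1 * X t l w) * (1 * X s l w + 0 * X t l w)).
  by apply/funext => w; ring.
rewrite E expectationE; last exact: process_combo_integrable2.
by rewrite process_combo_cov//; congr EFin; ring.
Qed.

Lemma expectation_square (l : 'I_d) (s : R) : 0 <= s ->
  ('E_P[(fun w => X s l w ^+ 2)%R] = (pcov X l s s)%:E)%E.
Proof.
move=> s0; have -> : (fun w => X s l w ^+ 2) = (fun w => X s l w * X s l w).
  by apply/funext => w; rewrite expr2.
by rewrite expectationE//; exact: process_integrableX2.
Qed.

(** The product of the values at s and t is a function of a two-dimensional marginal, whose law is
    the same for all components. *)
Lemma pcov_identical (l l' : 'I_d) (s t : R) : identically_distributed_components X ->
  0 <= s -> 0 <= t -> pcov X l s t = pcov X l' s t.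
Proof.
move=> iX s0 t0; pose f (i : 'I_2) := if i == 0 :> nat then s else t.
have f0 i : 0 <= f i by rewrite /f; case: ifP.
pose g (v : 2.-tuple R) := tnth v ord0 * tnth v (lift ord0 ord0).
have mg : measurable_fun setT g.
  by apply: measurable_funM; exact: measurable_tnth.
have mM k : measurable_fun setT (fun w => X s k w * X t k w).
  by apply: measurable_funM; exact: process_measurable.
have H (B : set R) : measurable B ->
    P ((fun w => X s l w * X t l w) @^-1` B) = P ((fun w => X s l' w * X t l' w) @^-1` B).
  move=> mB; have mgB : measurable (g @^-1` B).
    by rewrite -[X in measurable X]setTI; exact: mg.
  have E k : (fun w => X s k w * X t k w) @^-1` B =
      (fun w => [tuple X (f i) k w | i < 2]) @^-1` (g @^-1` B).
    by apply/seteqP; split => w; rewrite /preimage /g /= !tnth_mktuple.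
  by rewrite !E; exact: iX.
pose nu := pushforward P (fun w => X s l' w * X t l' w).
have nuE k : (k = l \/ k = l') -> forall A : set R, measurable A ->
    nu A = (\int[P]_w (\1_A (X s k w * X t k w) * 1)%:E)%E.
  move=> kl A mA.
  have -> : nu A = P ((fun w => X s k w * X t k w) @^-1` A).
    by case: kl => ->; rewrite // H.
  have mYA : measurable ((fun w => X s k w * X t k w) @^-1` A).
    by rewrite -[X in measurable X]setTI; exact: mM.
  rewrite -[_ @^-1` A in LHS]setIT -integral_indic//.
  by apply: eq_integral => w _; rewrite mulr1.
have id_m : measurable_fun setT (fun x : R => x) by exact: measurable_id.
have T1 k kl := @Rintegral_transfer R _ _ _ _ nu P (fun w => X s k w * X t k w)
  (fun=> 1) (mM k) (measurable_cst _) (fun=> ler01) (nuE k kl) (fun x => x) id_m.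
have := T1 (mM l') l (or_introl erefl); rewrite (T1 (mM l') l' (or_intror erefl)) => E.
rewrite /pcov.
transitivity (\int[P]_w (X s l w * X t l w * 1)).
  by apply: eq_Rintegral => w _; rewrite mulr1.
by rewrite -E; apply: eq_Rintegral => w _; rewrite mulr1.
Qed.

End one_process.

(** The addition formula for the cosine separates X from Y. Sines are written as cosines with phase
    - pi / 2, so that [process_combo_cos] evaluates every factor; the sine of [B] has mean 0 and one
    term survives. *)
Lemma pair_charfun (X Y : R -> 'I_d -> {RV P >-> R}) (l : 'I_d)
    (t t' s s' : R) : gaussian_process X -> centered_process X ->
  gaussian_process Y -> centered_process Y -> independent_processes X Y ->
  0 <= t -> 0 <= t' -> 0 <= s -> 0 <= s' -> forall th xi eta : R,
  \int[P]_w cos (th + (xi * (X t l w - Y s l w) + eta * (X t' l w - Y s' l w))) =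
  cos th * expR (- ((xi ^+ 2 * (pcov X l t t + pcov Y l s s) +
    2 * xi * eta * (pcov X l t t' + pcov Y l s s') +
    eta ^+ 2 * (pcov X l t' t' + pcov Y l s' s')) / 2)).
Proof.
move=> gX cX gY cY iXY t0 t'0 s0 s'0 th xi eta.
pose A w := xi * X t l w + eta * X t' l w.
pose B w := xi * Y s l w + eta * Y s' l w.
have mA : measurable_fun setT (A : g_sigma_algebraType (sigma_process X setT) -> R).
  by apply: measurable_funD; apply: measurable_funM => //; exact: sigma_process_RV.
have mB : measurable_fun setT (B : g_sigma_algebraType (sigma_process Y setT) -> R).
  by apply: measurable_funD; apply: measurable_funM => //; exact: sigma_process_RV.
have bcos (Z : R -> 'I_d -> {RV P >-> R}) (C : Omega -> R) (u : R) :
    measurable_fun setT (C : g_sigma_algebraType (sigma_process Z setT) -> R) ->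
    bmf ((fun w => cos (u + C w)) : g_sigma_algebraType (sigma_process Z setT) -> R).
  move=> mC; split; last by exists 1 => w; rewrite ler_norml cos_geN1 cos_le1.
  apply: measurableT_comp; first exact: (continuous_measurable_fun (@continuous_cos R)).
  exact: measurable_funD.
have toO (Z : R -> 'I_d -> {RV P >-> R}) (h : Omega -> R) :
    bmf (h : g_sigma_algebraType (sigma_process Z setT) -> R) -> bmf (h : Omega -> R).
  move=> [mh [M hM]]; split; last by exists M.
  have sm : <<s sigma_process Z setT >> `<=` measurable.
    apply: smallest_sub; first exact: sigma_algebra_measurable.
    exact: sigma_process_measurable.
  by move=> _ D mD; rewrite setTI; apply: sm; have := mh measurableT D mD; rewrite setTI.
have sinE (u : R) : sin u = cos (- (pi / 2) + u).
  by rewrite cosD cosN sinN cos_pihalf sin_pihalf mul0r sub0r mulN1r opprK.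
have E w : cos (th + (xi * (X t l w - Y s l w) + eta * (X t' l w - Y s' l w))) =
    cos (th + A w) * cos (0 + B w) + cos (- (pi / 2) + th + A w) * cos (- (pi / 2) + B w).
  rewrite -addrA -!sinE add0r -cosB; congr cos; rewrite /A /B; ring.
under eq_Rintegral do rewrite E.
have b1 := bcos X A th mA; have b2 := bcos Y B 0 mB.
have b3 := bcos X A (- (pi / 2) + th) mA; have b4 := bcos Y B (- (pi / 2)) mB.
rewrite bmf_RintegralD; last 2 first.
- by apply: bmfM; [exact: toO b1|exact: toO b2].
- by apply: bmfM; [exact: toO b3|exact: toO b4].
rewrite !(independent_processes_indep iXY)// !process_combo_cos//.
rewrite cos0 [cos (- (pi / 2))]cosN cos_pihalf !mul0r mulr0 addr0.
have comb (u v z : R) : u + v = z -> cos th * expR u * (1 * expR v) = cos th * expR z.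
  by move=> <-; rewrite expRD; ring.
by apply: comb; field.
Qed.

End process_covariance.

(** * Integrals over time intervals and joint measurability *)

Section interval_measure.
Context {R : realType}.
Notation bmf := bounded_measurable.
Implicit Types (a b c : R) (f g : measurableTypeR R -> R).

Let mitv a b : measurable (`]a, b[%classic : set (measurableTypeR R)).
Proof. exact: measurable_itv. Qed.

Let itv_lty x y a b : (lebesgue_measure
  ([set` Interval (BSide x a) (BSide y b)] : set (measurableTypeR R)) < +oo)%E.
Proof. by rewrite lebesgue_measure_itv /=; case: ifP => _; rewrite ?ltry// -EFinB ltry. Qed.

(** Lebesgue measure on ]a, b[ as a finite measure on the whole line, to which the results on
    bounded measurable functions apply. The open ends leave out the times 0 and T, about which (P2)
    says nothing. *)
Definition itv_measure a b : {finite_measure set (measurableTypeR R) -> \bar R} :=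
  mfrestr (mitv a b) (itv_lty false true a b).

Lemma itv_measure_setT a b : a <= b -> fine (itv_measure a b setT) = b - a.
Proof.
move=> ab; rewrite /= /mfrestr /mrestr setTI lebesgue_measure_itv /= lte_fin.
by case: ltP => // ba; apply/esym/eqP; rewrite subr_eq0 eq_le ba ab.
Qed.

Let itv_measureC a b : itv_measure a b (~` `]a, b[%classic) = 0%E.
Proof.
change (lebesgue_measure ((~` `]a, b[%classic) `&` (`]a, b[%classic : set (measurableTypeR R))) = 0%E).
by rewrite setICl measure0.
Qed.

Lemma Rintegral_itv_measure a b f : bmf f ->
  \int[itv_measure a b]_x f x = \int[lebesgue_measure]_(x in `]a, b[) f x.
Proof.
move=> bf; congr fine.
rewrite (@negligible_integral _ (measurableTypeR R) _ (itv_measure a b) setT (~` `]a, b[%classic)); last 4 first.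
- by apply: measurableC; exact: mitv.
- exact: measurableT.
- exact: bmf_integrable.
- exact: itv_measureC.
rewrite setDE setTI setCK; apply: eq_measure_integral => A mA AI.
by rewrite /= /mfrestr /mrestr setIidl.
Qed.

Lemma bmf_integrable_itv a b f : bmf f ->
  lebesgue_measure.-integrable `]a, b[%classic (EFin \o f).
Proof.
move=> [mf [M hM]]; apply: measurable_bounded_integrable; first exact: mitv.
- exact: itv_lty.
- exact: measurable_funS mf.
- exists M; split; first exact: num_real.
  by move=> y My x _ /=; exact: le_trans (hM x) (ltW My).
Qed.

Lemma Rintegral_itv_cc a b f : bmf f ->
  \int[lebesgue_measure]_(x in `[a, b]) f x = \int[itv_measure a b]_x f x.
Proof.
move=> bf; rewrite Rintegral_itv_measure//.
have [ab|ba] := ltP a b; last first.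
  have e0 : \int[lebesgue_measure]_(x in `]a, b[) f x = 0.
    by rewrite set_itv_ge ?Rintegral_set0// bnd_simp -leNgt.
  rewrite e0; have [->|ne] := eqVneq a b; first by rewrite set_itv1 Rintegral_set1.
  by rewrite set_itv_ge ?Rintegral_set0// bnd_simp -ltNge lt_neqAle eq_sym ne.
have I := bmf_integrable_itv a b bf.
rewrite (Rintegral_itv_obnd_cbnd I); apply/esym; apply: Rintegral_itv_bndo_bndc.
case: bf => mf [M hM]; apply: measurable_bounded_integrable; first exact: measurable_itv.
- exact: itv_lty.
- exact: measurable_funS mf.
- exists M; split; first exact: num_real.
  by move=> y My x _ /=; exact: le_trans (hM x) (ltW My).
Qed.

Lemma le_Rintegral_itv_measure a b f g : bmf f -> bmf g ->
  (forall x, a < x -> x < b -> f x <= g x) ->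
  \int[itv_measure a b]_x f x <= \int[itv_measure a b]_x g x.
Proof.
move=> bf bg fg; rewrite !Rintegral_itv_measure//.
apply: le_Rintegral; [exact: mitv|exact: bmf_integrable_itv|exact: bmf_integrable_itv|].
by move=> x; rewrite /= in_itv /= => /andP[]; exact: fg.
Qed.

Lemma eq_Rintegral_itv_measure a b f g : bmf f -> bmf g ->
  (forall x, a < x -> x < b -> f x = g x) ->
  \int[itv_measure a b]_x f x = \int[itv_measure a b]_x g x.
Proof.
move=> bf bg fg; apply/eqP; rewrite eq_le.
by rewrite !le_Rintegral_itv_measure// => x ax xb; rewrite fg.
Qed.

End interval_measure.

Section path_measurability.
Context {R : realType} {dO : measure_display} {Omega : measurableType dO}.
Notation mR := (measurableTypeR R).

(** The process is the limit of its values at the grid points below |t|, and these are jointly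
    measurable, preimages being countable unions of products. At t = 0 the grid point is 0 itself;
    for |t| > 0 the path is continuous from both sides at |t|. *)
Lemma measurable_continuous_process (Z : R -> Omega -> R) :
  (forall t, 0 <= t -> measurable_fun setT (Z t)) ->
  (forall w, {within `[0, +oo[%classic, continuous (fun t : R => Z t w)}) ->
  measurable_fun setT (fun p : mR * Omega => Z `|p.1| p.2).
Proof.
move=> mZ cZ.
pose g (n : nat) (t : R) : R := (Num.trunc (`|t| * n.+1%:R))%:R / n.+1%:R.
have g0 n t : 0 <= g n t by rewrite divr_ge0.
have gcvg t : (fun n => g n t) @ \oo --> `|t|.
  apply/cvgrPdist_le => e e0.
  have := near_infty_natSinv_lt (PosNum e0); apply: filterS => n /= /ltW hn.
  have n0 : (0 : R) < n.+1%:R by rewrite ltr0n.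
  have := @truncn_itv R (`|t| * n.+1%:R) (mulr_ge0 (normr_ge0 _) (ltW n0)).
  move=> /andP[lo hi]; rewrite /g ger0_norm; last first.
    by rewrite subr_ge0 ler_pdivrMr.
  apply: le_trans hn; rewrite lerBlDr -[X in _ <= X + _]mul1r -mulrDl ler_pdivlMr//.
  by rewrite [1 + _]addrC natr1; exact: ltW.
apply: (@measurable_fun_cvg _ _ _ _ (fun n (p : mR * Omega) => Z (g n p.1) p.2)).
- move=> n _ B mB; rewrite setTI.
  pose D (k : nat) : set mR :=
    (fun t : R => `|t| * n.+1%:R) @^-1` `[k%:R, k.+1%:R[%classic.
  have mD k : measurable (D k).
    rewrite -[D k]setTI.
    have mf : measurable_fun setT (fun t : mR => `|t| * n.+1%:R : mR).
      by apply: measurable_funM => //; exact: measurableT_comp.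
    by apply: mf => //; exact: measurable_itv.
  rewrite (_ : _ @^-1` B = \bigcup_k (D k `*` (Z (k%:R / n.+1%:R) @^-1` B))).
    apply: bigcupT_measurable => k; apply: measurableX => //.
    by rewrite -[X in measurable X]setTI; apply: mZ => //; rewrite divr_ge0.
  apply/seteqP; split => [[t w] /= Bw|[t w] [k _] [/= Dk Bw]].
    exists (Num.trunc (`|t| * n.+1%:R)) => //; split => //=.
    by rewrite /D /= in_itv /=; apply: truncn_itv; rewrite mulr_ge0.
  rewrite /preimage /= /g (truncn_def (n := k))//.
- move=> [t w] _ /=.
  have [->|t0] := eqVneq t 0.
    rewrite normr0 (_ : (fun n => _) = fun=> Z 0 w); first exact: cvg_cst.
    by apply/funext => n; rewrite /g normr0 mul0r truncn0 mul0r.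
  have [c1 _] := (continuous_within_itvcyP _ _).1 (cZ w).
  have /c1 ct : `|t| \in `]0, +oo[ by rewrite in_itv /= andbT normr_gt0.
  exact: cvg_comp (gcvg t) ct.
Qed.

End path_measurability.

(** * The second moment as a quadruple integral *)

Section second_moment.
Context {R : realType} {dO : measure_display} {Omega : measurableType dO}.
Variable P : probability Omega R.
Variable d : nat.
Variables X Y : R -> 'I_d -> {RV P >-> R}.
Variables (k : 'I_d -> nat) (eps T : R) (x : 'rV[R]_d).
Notation bmf := bounded_measurable.
Notation mR := (measurableTypeR R).
Hypothesis eps0 : 0 < eps.

(* the absolute values only serve to make the integrand jointly measurable for all
   real times *)
Definition local_time_integrand (t s : R) (w : Omega) : R :=
  \prod_(l < d) heat1 eps (k l) (X `|t| l w - Y `|s| l w + x 0 l).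
Notation F := local_time_integrand.

Section pair.
Hypothesis gX : gaussian_process X.
Hypothesis cX : centered_process X.
Hypothesis inX : independent_components X.
Hypothesis idX : identically_distributed_components X.
Hypothesis gY : gaussian_process Y.
Hypothesis cY : centered_process Y.
Hypothesis inY : independent_components Y.
Hypothesis idY : identically_distributed_components Y.
Hypothesis iXY : independent_processes X Y.

(** The covariance matrices of X and Y are positive semidefinite, so their sum is; adding eps on the
    diagonal makes the determinant positive. *)
Lemma pair_cov_det_gt0 (l : 'I_d) (t t' s s' : R) :
  0 <= t -> 0 <= t' -> 0 <= s -> 0 <= s' ->
  0 < (pcov X l t t + pcov Y l s s + eps) * (pcov X l t' t' + pcov Y l s' s' + eps) -
      (pcov X l t t' + pcov Y l s s') ^+ 2.
Proof.
move=> t0 t'0 s0 s'0.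
set v := _ + pcov Y l s s; set w := _ + pcov Y l s' s'; set c := _ + pcov Y l s s'.
have H a b : 0 <= a ^+ 2 * v + 2 * a * b * c + b ^+ 2 * w.
  have h1 := pcov_psd gX l a b t0 t'0; have h2 := pcov_psd gY l a b s0 s'0.
  rewrite [X in 0 <= X](_ : _ = (a ^+ 2 * pcov X l t t + 2 * a * b * pcov X l t t' +
    b ^+ 2 * pcov X l t' t') + (a ^+ 2 * pcov Y l s s + 2 * a * b * pcov Y l s s' +
    b ^+ 2 * pcov Y l s' s')); last by rewrite /v /w /c; ring.
  exact: addr_ge0.
have v0 : 0 <= v by have := H 1 0; rewrite !(expr1n, expr0n)/=; lra.
have w0 : 0 <= w by have := H 0 1; rewrite !(expr1n, expr0n)/=; lra.
have D0 : 0 <= v * w - c ^+ 2.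
  have [w00|w00] := eqVneq w 0.
    have [c0|c0] := eqVneq c 0; last first.
      (* For w = 0 and c nonzero this direction would give the quadratic form the value v - (v + 1)
         = -1. *)
      have := H 1 (- ((v + 1) / 2) / c); rewrite w00 mulr0 addr0 expr1n mul1r mulr1.
      by rewrite -mulrA mulfVK//; lra.
    by rewrite w00 c0 expr0n mulr0 subr0.
  have wp : 0 < w by rewrite lt_neqAle eq_sym w00.
  have h := H w (- c).
  by rewrite -(pmulr_rge0 _ wp); apply: le_trans h _; rewrite le_eqVlt; apply/orP; left; apply/eqP; ring.
have e2 : 0 < eps * eps by rewrite mulr_gt0.
have := mulr_ge0 v0 (ltW eps0); have := mulr_ge0 w0 (ltW eps0); nra.
Qed.

(** Independence of the pairs of components factors the expectation into Gaussian integrals over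
    pairs, and identical distribution lets all of them use the covariances of [l0]. *)
Lemma Rintegral_integrand_pair (l0 : 'I_d) (t s t' s' : R) :
  0 <= t -> 0 <= s -> 0 <= t' -> 0 <= s' ->
  \int[P]_w (F t s w * F t' s' w) =
  pair_density (fun l => x 0 l) k (pcov X l0 t t + pcov Y l0 s s + eps)
    (pcov X l0 t' t' + pcov Y l0 s' s' + eps) (pcov X l0 t t' + pcov Y l0 s s').
Proof.
move=> t0 s0 t'0 s'0.
pose U l w := heat1 eps (k l) (X t l w - Y s l w + x 0 l) *
              heat1 eps (k l) (X t' l w - Y s' l w + x 0 l).
have -> : \int[P]_w (F t s w * F t' s' w) = \int[P]_w \prod_(l < d) U l w.
  by apply: eq_Rintegral => w _; rewrite -big_split /= !ger0_norm.
rewrite (Rintegral_prod_components iXY inX inY); last first.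
  move=> l; apply: bmfM; apply: bmf_comp (bmf_heat1 eps0 _).
  - apply: measurable_funD => //; apply: measurable_funB.
    + exact: component_events_RVl.
    + exact: component_events_RVr.
  - apply: measurable_funD => //; apply: measurable_funB.
    + exact: component_events_RVl.
    + exact: component_events_RVr.
apply: eq_bigr => l _.
have mZ (a b : R) : measurable_fun setT (fun w => X a l w - Y b l w).
  by apply: measurable_funB; exact: process_measurable.
rewrite (pcov_identical l0 l idX)// (pcov_identical l0 l idY)//.
rewrite (pcov_identical l0 l idX t'0)// (pcov_identical l0 l idY s'0)//.
rewrite (pcov_identical l0 l idX t0 t'0)// (pcov_identical l0 l idY s0 s'0)//.
have D0 := pair_cov_det_gt0 l t0 t'0 s0 s'0.
have B0 : 0 < pcov X l t' t' + pcov Y l s' s' + eps.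
  have h1 := pcov_psd gX l 0 1 t0 t'0; have h2 := pcov_psd gY l 0 1 s0 s'0.
  by move: h1 h2; rewrite !(expr1n, expr0n)/=; have := eps0; lra.
exact: (Rintegral_heat1_pair (mZ t s) (mZ t' s')
  (pair_charfun l gX cX gY cY iXY t0 t'0 s0 s'0) eps0 B0 D0).
Qed.

End pair.
End second_moment.

Lemma bmf_Rintegral_mul_swap {R : realType} {d1 d2} {S1 : measurableType d1}
  {S2 : measurableType d2} (m1 : {finite_measure set S1 -> \bar R})
  (m2 : {finite_measure set S2 -> \bar R}) (g : S2 -> R) (f : S1 * S2 -> R) :
  bounded_measurable g -> bounded_measurable f ->
  \int[m2]_w (g w * \int[m1]_t f (t, w)) = \int[m1]_t \int[m2]_w (g w * f (t, w)).
Proof.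
move=> bg bf.
have bgf : bounded_measurable (fun p : S1 * S2 => g p.2 * f p).
  by apply: bmfM => //; apply: bmf_comp bg; exact: measurable_snd.
rewrite (bmf_Fubini m1 m2 bgf) /=; apply: eq_Rintegral => w _ /=.
rewrite bmf_RintegralZl//; apply: (bmf_comp _ bf); exact: pair2_measurable.
Qed.

Section second_moment_integral.
Context {R : realType} {dO : measure_display} {Omega : measurableType dO}.
Variable P : probability Omega R.
Variable d : nat.
Variables X Y : R -> 'I_d -> {RV P >-> R}.
Variables (k : 'I_d -> nat) (eps T : R) (x : 'rV[R]_d).
Notation bmf := bounded_measurable.
Notation mR := (measurableTypeR R).
Notation F := (local_time_integrand X Y k eps x).
Notation mu := (itv_measure 0 T).
Hypothesis eps0 : 0 < eps.
Hypothesis cpX : continuous_paths X.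
Hypothesis cpY : continuous_paths Y.

Lemma bmf_local_time_integrand :
  bmf (fun p : (mR * mR) * Omega => F p.1.1 p.1.2 p.2).
Proof.
have mproc (Z : R -> 'I_d -> {RV P >-> R}) l : continuous_paths Z ->
    measurable_fun setT (fun p : mR * Omega => Z `|p.1| l p.2).
  move=> cpZ; apply: (measurable_continuous_process (Z := fun t w => Z t l w)) => [t _|w].
    exact: process_measurable.
  exact: cpZ.
apply: bmf_prod => l; apply: bmf_comp (bmf_heat1 eps0 _).
apply: measurable_funD; last exact: measurable_cst.
apply: measurable_funB.
- apply: (@measurableT_comp _ _ _ _ _ _ _ _ (fun p : (mR * mR) * Omega => (p.1.1, p.2)) (mproc X l cpX)).
  by apply: measurable_fun_pair; do ?[exact: measurable_snd | exact: measurable_fst | apply: measurableT_comp => //].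
- apply: (@measurableT_comp _ _ _ _ _ _ _ _ (fun p : (mR * mR) * Omega => (p.1.2, p.2)) (mproc Y l cpY)).
  by apply: measurable_fun_pair; do ?[exact: measurable_snd | exact: measurable_fst | apply: measurableT_comp => //].
Qed.

Lemma bmf_integrand_pair : bmf (fun p : ((mR * mR) * mR) * mR =>
  \int[P]_w (F p.1.1.1 p.1.1.2 w * F p.1.2 p.2 w)).
Proof.
apply: (bmf_Rintegral P (f := fun q : (((mR * mR) * mR) * mR) * Omega =>
  F q.1.1.1.1 q.1.1.1.2 q.2 * F q.1.1.2 q.1.2 q.2)).
apply: bmfM.
- apply: (@bmf_comp _ _ _ _ _ _ (fun q : (((mR * mR) * mR) * mR) * Omega =>
    (q.1.1.1, q.2)) _ bmf_local_time_integrand).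
  by apply: measurable_fun_pair; do ?[exact: measurable_snd | exact: measurable_fst | apply: measurableT_comp => //].
- apply: (@bmf_comp _ _ _ _ _ _ (fun q : (((mR * mR) * mR) * mR) * Omega =>
    ((q.1.1.2, q.1.2), q.2)) _ bmf_local_time_integrand).
  apply: measurable_fun_pair; last exact: measurable_snd.
  by apply: measurable_fun_pair; do ?[exact: measurable_snd | exact: measurable_fst | apply: measurableT_comp => //].
Qed.

Lemma local_timeE w : local_time X Y k eps T x w = \int[mu]_t \int[mu]_s F t s w.
Proof.
have bF t : bmf (fun s : mR => F t s w).
  apply: (@bmf_comp _ _ _ _ _ _ (fun s : mR => ((t : mR, s), w)) _ bmf_local_time_integrand).
  by apply: measurable_fun_pair => //; apply: measurable_fun_pair.
have bG : bmf (fun t : mR => \int[mu]_s F t s w).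
  apply: (bmf_Rintegral mu (f := fun q : mR * mR => F q.1 q.2 w)).
  apply: (@bmf_comp _ _ _ _ _ _ (fun q : mR * mR => (q, w)) _ bmf_local_time_integrand).
  by apply: measurable_fun_pair.
rewrite -(Rintegral_itv_cc _ _ bG); apply: eq_Rintegral => t.
rewrite inE /= in_itv /= => /andP[t0 _].
rewrite -(Rintegral_itv_cc _ _ (bF t)); apply: eq_Rintegral => s.
rewrite inE /= in_itv /= => /andP[s0 _].
rewrite multi_partial_heat_kernel//; apply: eq_bigr => l _.
by rewrite !mxE !ger0_norm.
Qed.

(** The expectation of the square is moved inside one time integral at a time, what is not yet
    unfolded acting as a bounded weight. *)
Lemma expectation_local_time2 :
  ('E_P[(fun w => `|local_time X Y k eps T x w| ^+ 2)%R] =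
   (\int[mu]_t \int[mu]_s \int[mu]_t' \int[mu]_s'
      \int[P]_w (F t s w * F t' s' w))%:E)%E.
Proof.
pose G1 (q : mR * Omega) := \int[mu]_s F q.1 s q.2.
pose G w := \int[mu]_t G1 (t, w).
have bG1 : bmf G1.
  apply: (bmf_Rintegral mu (f := fun q : (mR * Omega) * mR => F q.1.1 q.2 q.1.2)).
  apply: (@bmf_comp _ _ _ _ _ _ (fun q : (mR * Omega) * mR => ((q.1.1, q.2), q.1.2)) _ bmf_local_time_integrand).
  apply: measurable_fun_pair; last exact: measurableT_comp.
  by apply: measurable_fun_pair => //; exact: measurableT_comp.
have bG : bmf G.
  apply: (bmf_Rintegral mu (f := fun q : Omega * mR => G1 (q.2, q.1))).
  by apply: bmf_comp bG1; apply: measurable_fun_pair.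
have bF2 t : bmf (fun p : mR * Omega => F t p.1 p.2).
  apply: (@bmf_comp _ _ _ _ _ _ (fun p : mR * Omega => ((t : mR, p.1), p.2)) _ bmf_local_time_integrand).
  by apply: measurable_fun_pair => //; apply: measurable_fun_pair.
have bF1 t s : bmf (fun w => F t s w).
  apply: (@bmf_comp _ _ _ _ _ _ (fun w => ((t : mR, s : mR), w)) _ bmf_local_time_integrand).
  by apply: measurable_fun_pair.
have bG1w t : bmf (fun w => G1 (t, w)) by apply: bmf_comp bG1; exact: pair1_measurable.
have -> : (fun w => `|local_time X Y k eps T x w| ^+ 2) = (fun w => G w * G w).
  by apply/funext => w; rewrite local_timeE real_normK ?num_real// expr2.
rewrite expectationE; last by apply: bmf_integrable; exact: bmfM.
congr EFin; rewrite (bmf_Rintegral_mul_swap mu P bG bG1).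
apply: eq_Rintegral => t _ /=.
rewrite (bmf_Rintegral_mul_swap mu P bG (bF2 t)); apply: eq_Rintegral => s _ /=.
transitivity (\int[P]_w (F t s w * G w)).
  by apply: eq_Rintegral => w _ /=; rewrite mulrC.
rewrite (bmf_Rintegral_mul_swap mu P (bF1 t s) bG1); apply: eq_Rintegral => t' _ /=.
by rewrite (bmf_Rintegral_mul_swap mu P (bF1 t s) (bF2 t')).
Qed.

End second_moment_integral.

(** * Localisation near the diagonal *)

Section window.
Context {R : realType}.
Notation bmf := bounded_measurable.
Notation mR := (measurableTypeR R).
Notation leb := (@lebesgue_measure R).

Lemma lebesgue_measure_shift (t : R) (A : set mR) : measurable A ->
  leb A = leb ((fun x => x + t) @^-1` A).
Proof.
move=> mA.
have ms : measurable_fun setT ((fun x => x + t) : mR -> mR) by exact: measurable_funD.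
pose sh : {mfun mR >-> mR} := @mfun_Sub _ _ mR mR _ (mem_set ms).
rewrite (@lebesgue_measure_unique R (pushforward leb sh) _ A mA)//.
move=> _ [[a b] _ <-] /=; rewrite /pushforward.
have -> : sh @^-1` `]a, b] = `]a - t, b - t]%classic.
  by apply/seteqP; split => z /=; rewrite !in_itv /= ltrBlDr lerBrDr.
rewrite !lebesgue_measure_itv /= !lte_fin ltrD2r; case: ifP => // _.
by rewrite -!EFinD; congr EFin; ring.
Qed.

Lemma Rintegral_shift (t : R) (f : mR -> R) : measurable_fun setT f ->
  \int[leb]_x f x = \int[leb]_x f (x + t).
Proof.
move=> mf.
have ms : measurable_fun setT (fun x : mR => x + t : mR) by exact: measurable_funD.
rewrite (@Rintegral_transfer R _ _ _ _ leb leb (fun x : mR => x + t : mR) (fun=> 1)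
  ms (measurable_cst _) (fun=> ler01) _ f mf).
  by apply: eq_Rintegral => x _; rewrite mulr1.
move=> A mA; transitivity (leb ((fun x : R => x + t) @^-1` A)).
  exact: lebesgue_measure_shift.
have mA' : measurable ((fun x : mR => x + t : mR) @^-1` A).
  by rewrite -[X in measurable X]setTI; exact: ms.
rewrite -[X in leb X]setIT -integral_indic//.
by apply: eq_integral => w _; rewrite mulr1.
Qed.

Lemma Rintegral_itv_measure_indic (a b : R) (f : mR -> R) : bmf f ->
  \int[itv_measure a b]_x f x = \int[leb]_x (\1_(`]a, b[%classic) x * f x).
Proof.
move=> bf; rewrite Rintegral_itv_measure// Rintegral_mkcond.
by apply: eq_Rintegral => x _; rewrite patch_indic mulrC.
Qed.

Let bmf_itv_indic (a b : R) : bmf (\1_(`]a, b[%classic : set mR) : mR -> R).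
Proof. by apply: bmf_indic; exact: measurable_itv. Qed.

Let bmf_shift (t : R) (f : mR -> R) : bmf f -> bmf (fun x : mR => f (x + t)).
Proof. by apply: (@bmf_comp _ _ _ _ _ f (fun x : mR => x + t : mR)); exact: measurable_funD. Qed.

(** Substitution s = u + t: the window becomes the domain of integration, and the former domain
    survives as an indicator, the only boundary effect. *)
Lemma Rintegral_window (T de t : R) (f : mR -> R) : bmf f ->
  \int[itv_measure 0 T]_s (\1_(`]- de, de[%classic) (s - t) * f (s - t)) =
  \int[itv_measure (- de) de]_u (\1_(`]0, T[%classic) (u + t) * f u).
Proof.
move=> bf.
have b1 : bmf (fun s : mR => \1_(`]- de, de[%classic) (s - t) * f (s - t)).
  by apply: (bmf_shift (- t) (f := fun s => \1_(`]- de, de[%classic : set mR) s * f s)); apply: bmfM.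
have b2 : bmf (fun u : mR => \1_(`]0, T[%classic) (u + t) * f u).
  by apply: bmfM => //; exact: (bmf_shift t (bmf_itv_indic 0 T)).
rewrite !Rintegral_itv_measure_indic//.
rewrite (Rintegral_shift t); last by case: (bmfM (bmf_itv_indic 0 T) b1).
by apply: eq_Rintegral => u _; rewrite addrK; ring.
Qed.

Variables (T de : R) (rho : mR * mR -> R).
Hypothesis brho : bmf rho.
Hypothesis rho0 : forall p, 0 <= rho p.

Definition near_kernel (p : ((mR * mR) * mR) * mR) : R :=
  \1_(`]- de, de[%classic) (p.1.2 - p.1.1.1) *
  (\1_(`]- de, de[%classic) (p.2 - p.1.1.2) * rho (p.1.2 - p.1.1.1, p.2 - p.1.1.2)).

Lemma bmf_near_kernel : bmf near_kernel.
Proof.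
have m1 : measurable_fun setT (fun p : ((mR * mR) * mR) * mR => p.1.2 - p.1.1.1 : mR).
  by apply: measurable_funB;
    do ?[exact: measurable_snd | exact: measurable_fst | apply: measurableT_comp => //].
have m2 : measurable_fun setT (fun p : ((mR * mR) * mR) * mR => p.2 - p.1.1.2 : mR).
  by apply: measurable_funB;
    do ?[exact: measurable_snd | exact: measurable_fst | apply: measurableT_comp => //].
apply: bmfM; first exact: bmf_comp m1 (bmf_itv_indic _ _).
apply: bmfM; first exact: bmf_comp m2 (bmf_itv_indic _ _).
by apply: bmf_comp brho; exact: measurable_fun_pair.
Qed.

Lemma near_kernel_ge0 p : 0 <= near_kernel p.
Proof. by rewrite !mulr_ge0// indicE. Qed.

(** This is J(eps) when [rho] is [rate_kernel]. *)
Definition rate_integral : R :=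
  \int[itv_measure (- de) de]_u \int[itv_measure (- de) de]_w rho (u, w).

Let bs (s : R) : bmf (fun u : mR => \int[itv_measure (- de) de]_w (\1_(`]0, T[%classic) (w + s) * rho (u, w : mR))).
Proof.
apply: (bmf_Rintegral (itv_measure (- de) de) (f := fun q : mR * mR => \1_(`]0, T[%classic) (q.2 + s) * rho q)).
apply: bmfM => //; apply: (bmf_comp _ (bmf_shift s (bmf_itv_indic 0 T))); exact: measurable_snd.
Qed.

Let br u : bmf (fun w => rho (u, w)).
Proof. by apply: bmf_comp brho; exact: pair1_measurable. Qed.

Let bsr u s : bmf (fun w : mR => \1_(`]0, T[%classic) (w + s) * rho (u, w)).
Proof. by apply: bmfM => //; exact: (bmf_shift s (bmf_itv_indic 0 T)). Qed.

Let bst s t : bmf (fun u : mR => \1_(`]0, T[%classic) (u + t) *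
  \int[itv_measure (- de) de]_w (\1_(`]0, T[%classic) (w + s) * rho (u, w : mR))).
Proof. by apply: bmfM => //; exact: (bmf_shift t (bmf_itv_indic 0 T)). Qed.

Let brw : bmf (fun u : mR => \int[itv_measure (- de) de]_w rho (u, w)).
Proof. exact: bmf_Rintegral. Qed.

Let indic01 (A : set R) z : 0 <= (\1_A z : R) <= 1.
Proof. by rewrite indicE; case: (_ \in _); rewrite /= ?lexx ler01. Qed.

Let windowE (t s : R) :
  \int[itv_measure 0 T]_t' \int[itv_measure 0 T]_s' near_kernel (((t, s), t'), s') =
  \int[itv_measure (- de) de]_u (\1_(`]0, T[%classic) (u + t) *
    \int[itv_measure (- de) de]_w (\1_(`]0, T[%classic) (w + s) * rho (u, w : mR))).
Proof.
rewrite -(Rintegral_window T de t (bs s)); apply: eq_Rintegral => t' _ /=.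
rewrite -(Rintegral_window T de s (br _)) -bmf_RintegralZl.
- by apply: eq_Rintegral => s' _.
- by apply: (bmf_shift (- s) (f := fun w => \1_(`]- de, de[%classic : set mR) w * rho (_, w))); exact: bmfM.
Qed.

Lemma rate_integral_ge0 : 0 <= rate_integral.
Proof. by apply: Rintegral_ge0 => u _; apply: Rintegral_ge0 => w _. Qed.

(** The boundary indicators are at most 1. This direction serves where the near kernel has a
    nonpositive coefficient. *)
Lemma near_kernel_integral_le (t s : R) :
  \int[itv_measure 0 T]_t' \int[itv_measure 0 T]_s' near_kernel (((t, s), t'), s')
    <= rate_integral.
Proof.
rewrite windowE; apply: bmf_le_Rintegral => // u.
have /andP[i0 i1] := indic01 `]0, T[%classic (u + t).
have h : \int[itv_measure (- de) de]_w (\1_(`]0, T[%classic) (w + s) * rho (u, w)) <=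
    \int[itv_measure (- de) de]_w rho (u, w).
  apply: bmf_le_Rintegral => // w.
  by have /andP[j0 j1] := indic01 `]0, T[%classic (w + s); rewrite ler_piMl.
apply: le_trans h; rewrite ler_piMl//; apply: Rintegral_ge0 => w _.
by apply: mulr_ge0 => //; case/andP: (indic01 `]0, T[%classic (w + s)).
Qed.

(** At distance [de] from both ends the boundary indicators equal 1. The equality serves on the box,
    where the coefficient may be positive. *)
Lemma near_kernel_integralE (t s : R) : de <= t -> t <= T - de -> de <= s -> s <= T - de ->
  \int[itv_measure 0 T]_t' \int[itv_measure 0 T]_s' near_kernel (((t, s), t'), s')
    = rate_integral.
Proof.
move=> h1 h2 h3 h4; rewrite windowE.
have ind (z u : R) : de <= z -> z <= T - de -> - de < u -> u < de ->
    \1_(`]0, T[%classic) (u + z) = 1 :> R.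
  by move=> *; rewrite indicE mem_set//= in_itv /=; lra.
apply: eq_Rintegral_itv_measure => // u u1 u2.
rewrite ind// mul1r; apply: eq_Rintegral_itv_measure => // w w1 w2.
by rewrite ind// mul1r.
Qed.

End window.

(** * Growth of the singular integral *)

Section singular_integral.
Context {R : realType}.
Notation bmf := bounded_measurable.
Notation mR := (measurableTypeR R).

Lemma le_Rintegral_sub_itv (a b a' b' : R) (f : mR -> R) : bmf f -> (forall x, 0 <= f x) ->
  a <= a' -> b' <= b -> \int[itv_measure a' b']_x f x <= \int[itv_measure a b]_x f x.
Proof.
move=> bf f0 aa bb.
have bi : bmf (\1_(`]a', b'[%classic : set mR) : mR -> R).
  by apply: bmf_indic; exact: measurable_itv.
have -> : \int[itv_measure a' b']_x f x =
    \int[itv_measure a b]_x (\1_(`]a', b'[%classic : set mR) x * f x).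
  rewrite !Rintegral_itv_measure_indic//; last exact: bmfM.
  apply: eq_Rintegral => x _; rewrite !indicE.
  have [xi|xi] := boolP (x \in (`]a', b'[%classic : set mR)); last by rewrite mul0r mulr0.
  rewrite mul1r mem_set ?mul1r//; move: xi; rewrite inE /= !in_itv /= => /andP[x1 x2].
  by rewrite (le_lt_trans aa x1) (lt_le_trans x2 bb).
apply: bmf_le_Rintegral => //; first exact: bmfM.
by move=> x; rewrite ler_piMl// indicE; case: (_ \in _).
Qed.

(** Cutting at [a] makes 1 / x a bounded function on the whole line without changing it on ]a,
    b[. *)
Lemma continuous_inv_max (a : R) : 0 < a -> continuous (fun x : R => (Num.max x a)^-1).
Proof.
move=> a0 x; apply: cvgV; first by rewrite lt0r_neq0// lt_max a0 orbT.
by apply: (@continuous_max R R (fun x => x) (fun=> a)); [exact: cvg_id|exact: cvg_cst].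
Qed.

Lemma bmf_inv_max (a : R) : 0 < a -> bmf (fun x : mR => (Num.max x a)^-1).
Proof.
move=> a0; split; first by apply: continuous_measurable_fun; exact: continuous_inv_max.
have mx0 (x : R) : 0 < Num.max x a by rewrite lt_max a0 orbT.
exists a^-1 => x; rewrite ger0_norm ?invr_ge0 ?(ltW (mx0 x))//.
by rewrite lef_pV2 ?posrE// le_max lexx orbT.
Qed.

Lemma Rintegral_itv_inv (a b : R) : 0 < a -> a < b ->
  \int[itv_measure a b]_x (Num.max x a)^-1 = ln b - ln a.
Proof.
move=> a0 ab; have b0 : 0 < b by exact: lt_trans ab.
have bf := bmf_inv_max a0.
rewrite -Rintegral_itv_cc// /Rintegral.
rewrite (@continuous_FTC2 R _ (@ln R) a b ab).
- by rewrite -EFinB.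
- by apply: continuous_subspaceT; exact: continuous_inv_max.
- split.
  + move=> x; rewrite in_itv /= => /andP[ax _].
    by apply: ex_derive; apply: is_derive1_ln; exact: lt_trans ax.
  + by apply: cvg_at_right_filter; exact: continuous_ln.
  + by apply: cvg_at_left_filter; exact: continuous_ln.
- move=> x; rewrite in_itv /= => /andP[ax _].
  rewrite derive1E; have x0 : 0 < x by exact: lt_trans ax.
  by rewrite (@derive_val _ _ _ _ _ _ _ (is_derive1_ln x0)) max_l// ltW.
Qed.

Lemma powR_le (a b r : R) : 0 <= r -> 0 <= a -> a <= b -> a `^ r <= b `^ r.
Proof. by move=> r0 a0 ab; apply: ge0_ler_powR; rewrite ?nnegrE//; exact: le_trans ab. Qed.

Lemma powRK (a r : R) : 0 <= a -> r != 0 -> (a `^ r) `^ r^-1 = a.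
Proof. by move=> a0 r0; rewrite -powRrM divff// powRr1. Qed.

Lemma sqrtrV_expE (y : R) (n : nat) : 0 <= y ->
  (Num.sqrt y)^-1 ^+ n = y `^ (- (n%:R / 2)).
Proof.
move=> y0; rewrite powRN exprVn; congr (_^-1).
by rewrite [n%:R / 2]mulrC powRrM powR12_sqrt// powR_mulrn// sqrtr_ge0.
Qed.

Definition rate_kernel (H1 H2 eps : R) (n : nat) (p : mR * mR) : R :=
  (Num.sqrt (`|p.1 : R| `^ (2 * H1) + `|p.2 : R| `^ (2 * H2) + eps))^-1 ^+ n.

Lemma rate_kernel_ge0 H1 H2 eps n p : 0 <= rate_kernel H1 H2 eps n p.
Proof. by rewrite exprn_ge0// invr_ge0 sqrtr_ge0. Qed.

Lemma rate_kernel_anti (H1 H2 eps s : R) n (u w : R) : 0 < eps ->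
  `|u| `^ (2 * H1) + `|w| `^ (2 * H2) + eps <= s ->
  (Num.sqrt s)^-1 ^+ n <= rate_kernel H1 H2 eps n (u, w).
Proof.
move=> e0 h; have p0 : 0 < `|u| `^ (2 * H1) + `|w| `^ (2 * H2) + eps.
  by rewrite ltr_wpDl// addr_ge0 ?powR_ge0.
have s0 : 0 < s by exact: lt_le_trans h.
by rewrite /rate_kernel; apply: lerXn2r; rewrite ?nnegrE ?invr_ge0 ?sqrtr_ge0// lef_pV2 ?posrE ?sqrtr_gt0// ler_wsqrtr.
Qed.

Lemma rate_kernel_le (H1 H2 eps s : R) n (u w : R) : 0 < s ->
  s <= `|u| `^ (2 * H1) + `|w| `^ (2 * H2) + eps ->
  rate_kernel H1 H2 eps n (u, w) <= (Num.sqrt s)^-1 ^+ n.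
Proof.
move=> s0 h; have p0 := lt_le_trans s0 h.
by rewrite /rate_kernel; apply: lerXn2r; rewrite ?nnegrE ?invr_ge0 ?sqrtr_ge0// lef_pV2 ?posrE ?sqrtr_gt0// ler_wsqrtr.
Qed.

Lemma bmf_rate_kernel H1 H2 eps n : 0 < eps -> bmf (rate_kernel H1 H2 eps n).
Proof.
move=> e0; split; last first.
  exists ((Num.sqrt eps)^-1 ^+ n) => -[u w]; rewrite ger0_norm ?rate_kernel_ge0//.
  by apply: rate_kernel_le => //; rewrite lerDr addr_ge0 ?powR_ge0.
have mS : measurable_fun setT (fun p : mR * mR =>
    `|p.1 : R| `^ (2 * H1) + `|p.2 : R| `^ (2 * H2) + eps : mR).
  apply: measurable_funD; last exact: measurable_cst.
  have mp (r : R) : measurable_fun setT (fun x : mR => `|x : R| `^ r : mR).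
    apply: (@measurableT_comp _ _ _ mR mR mR (fun x : R => x `^ r) _ (fun x : R => `|x|)).
      exact: measurable_powR.
    exact: normr_measurable.
  apply: measurable_funD.
    exact: (measurableT_comp (mp (2 * H1)) measurable_fst).
  exact: (measurableT_comp (mp (2 * H2)) measurable_snd).
pose sq (y : R) : R := y `^ (- (n%:R / 2)).
have -> : rate_kernel H1 H2 eps n = sq \o
    (fun p : mR * mR => `|p.1 : R| `^ (2 * H1) + `|p.2 : R| `^ (2 * H2) + eps).
  apply/funext => p; rewrite /rate_kernel /= /sq sqrtrV_expE//.
  by rewrite !addr_ge0 ?powR_ge0// ltW.
by apply: measurableT_comp => //; exact: measurable_powR.
Qed.

Section rate.
Variables (H1 H2 : R) (d m : nat) (de : R).
Hypothesis H10 : 0 < H1.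
Hypothesis H20 : 0 < H2.
Hypothesis de0 : 0 < de.
Hypothesis hH : 1 <= H1 * H2 / (H1 + H2) * (2 * m%:R + d%:R).

(** The kernel is the power - q of |u|^(2 H1) + |w|^(2 H2) + eps, a sum of order eps on the box |u|
    <= eps^a1, |w| <= eps^a2. In these terms the critical case is q = a1 + a2. *)
Let n := (d + 2 * m)%N.
Let q : R := n%:R / 2.
Let a1 := (2 * H1)^-1.
Let a2 := (2 * H2)^-1.
Notation J := (fun eps => rate_integral de (rate_kernel H1 H2 eps n)).

Let a10 : 0 < a1. Proof. by rewrite invr_gt0 mulr_gt0. Qed.
Let a20 : 0 < a2. Proof. by rewrite invr_gt0 mulr_gt0. Qed.
Let t1N : 2 * H1 != 0. Proof. by rewrite mulf_neq0 ?lt0r_neq0. Qed.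
Let t2N : 2 * H2 != 0. Proof. by rewrite mulf_neq0 ?lt0r_neq0. Qed.
Let q0 : 0 <= q. Proof. by rewrite divr_ge0. Qed.

Let ratioE : H1 * H2 / (H1 + H2) * (2 * m%:R + d%:R) = q / (a1 + a2).
Proof.
have h : 0 < H1 + H2 by rewrite addr_gt0.
have -> : a1 + a2 = (H1 + H2) / (2 * (H1 * H2)).
  by rewrite /a1 /a2; field; rewrite !lt0r_neq0.
rewrite invf_div /q /n natrD natrM; field; by rewrite !lt0r_neq0.
Qed.

Let expoE : (H1 + H2) / (2 * H1 * H2) - d%:R / 2 - m%:R = - (q - a1 - a2).
Proof.
rewrite /q /a1 /a2 /n natrD natrM; field; by rewrite !lt0r_neq0.
Qed.

Let brate eps : 0 < eps -> bmf (rate_kernel H1 H2 eps n).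
Proof. exact: bmf_rate_kernel. Qed.

Let h_rate_super eps : 1 < H1 * H2 / (H1 + H2) * (2 * m%:R + d%:R) ->
  h_rate d m H1 H2 eps = (eps `^ (q - a1 - a2))^-1 /\ 0 < q - a1 - a2.
Proof.
move=> h; rewrite /h_rate h expoE powRN; split => //.
have a12 : 0 < a1 + a2 by rewrite addr_gt0.
by move: h; rewrite ratioE ltr_pdivlMr// mul1r; lra.
Qed.

Let h_rate_crit eps : ~~ (1 < H1 * H2 / (H1 + H2) * (2 * m%:R + d%:R)) ->
  h_rate d m H1 H2 eps = ln (1 + (eps `^ (1 / 2))^-1) /\ q = a1 + a2.
Proof.
move=> h; rewrite /h_rate (negbTE h) powRN; split => //.
have a12 : 0 < a1 + a2 by rewrite addr_gt0.
move: hH h; rewrite -leNgt ratioE; move: q => r.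
rewrite ler_pdivlMr ?ler_pdivrMr// !mul1r => h1 h2.
by apply/eqP; rewrite eq_le h1 h2.
Qed.

(** Above the critical case h is eps^(-p) with p > 0, whence the threshold M^(-1/p). In the critical
    case ln (1 + eps^(-1/2)) >= - (ln eps) / 2, whence exp (- 2 B). *)
Lemma h_rate_ge (B : R) : exists2 e0, 0 < e0 &
  forall eps, 0 < eps -> eps < e0 -> B <= h_rate d m H1 H2 eps.
Proof.
have [hs|hc] := boolP (1 < H1 * H2 / (H1 + H2) * (2 * m%:R + d%:R)).
- have [_ p0] := h_rate_super 1 hs; set p := q - a1 - a2 in p0.
  pose M := Num.max B 1; have M0 : 0 < M by rewrite lt_max ltr01 orbT.
  exists (M^-1 `^ p^-1) => [|eps e0 he]; first by rewrite powR_gt0 ?invr_gt0.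
  have [-> _] := h_rate_super eps hs; rewrite -/p.
  apply: (@le_trans _ _ M); first by rewrite le_max lexx.
  rewrite -[leLHS]invrK lef_pV2 ?posrE ?invr_gt0 ?powR_gt0//.
  have := powR_le (ltW p0) (ltW e0) (ltW he).
  by rewrite -powRrM mulVf ?lt0r_neq0// powRr1// invr_ge0 ltW.
- exists (expR (- (2 * B))) => [|eps e0 he]; first exact: expR_gt0.
  have [-> _] := h_rate_crit eps hc.
  have pp : 0 < (eps `^ (1 / 2))^-1 by rewrite invr_gt0 powR_gt0.
  apply: (@le_trans _ _ (ln (eps `^ (1 / 2))^-1)); last first.
    by rewrite ler_ln ?posrE ?addr_gt0// lerDr.
  rewrite lnV ?posrE ?powR_gt0// ln_powR.
  have : ln eps <= - (2 * B) by rewrite -[leRHS]expRK ler_ln ?posrE ?expR_gt0// ltW.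
  by lra.
Qed.

Let innerb eps (S : {finite_measure set mR -> \bar R}) : 0 < eps ->
  bmf (fun u : mR => \int[S]_w rate_kernel H1 H2 eps n (u, w)).
Proof. by move=> e0; apply: bmf_Rintegral; exact: brate. Qed.

Let inner_ge eps u W s : 0 < eps -> 0 <= W -> W <= de ->
  `|u| `^ (2 * H1) + W `^ (2 * H2) + eps <= s ->
  (Num.sqrt s)^-1 ^+ n * W <= \int[itv_measure (- de) de]_w rate_kernel H1 H2 eps n (u, w).
Proof.
move=> e0 W0 Wd us.
have b1 : bmf (fun w : mR => rate_kernel H1 H2 eps n (u : mR, w)).
  by apply: bmf_comp (brate e0); exact: pair1_measurable.
apply: le_trans (le_Rintegral_sub_itv (a' := 0) (b' := W) b1 _ _ Wd); last 2 first.
- by move=> w; exact: rate_kernel_ge0.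
- by rewrite oppr_le0 ltW.
have -> : (Num.sqrt s)^-1 ^+ n * W = \int[itv_measure 0 W]_w ((Num.sqrt s)^-1 ^+ n).
  by rewrite Rintegral_cstT itv_measure_setT// subr0.
apply: le_Rintegral_itv_measure => //; first exact: bmf_cst.
move=> w w0 wW; apply: rate_kernel_anti => //; apply: le_trans us.
by rewrite lerD2r lerD2l gtr0_norm// powR_le ?(ltW wW) ?(ltW w0)// mulr_ge0// ltW.
Qed.

Let inner_ge0 eps u : 0 <= \int[itv_measure (- de) de]_w rate_kernel H1 H2 eps n (u, w).
Proof. by apply: Rintegral_ge0 => w _; exact: rate_kernel_ge0. Qed.

(** Above the critical case it suffices to integrate over 0 < u < eps^a1, 0 < w < eps^a2: there the
    sum is at most 3 eps, and the box has area eps^(a1 + a2). In the critical case all scales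
    between eps^a1 and a constant contribute equally: for such u, keeping 0 < w < u^(a2 / a1), where
    the sum is at most 3 u^(2 H1), leaves 3^(-q) / u, and the integral of 1 / u is the logarithm. *)
Lemma rate_integral_ge : exists2 c : R, 0 < c & exists2 e0, 0 < e0 &
  forall eps, 0 < eps -> eps < e0 -> c * h_rate d m H1 H2 eps <= J eps.
Proof.
have [hs|hc] := boolP (1 < H1 * H2 / (H1 + H2) * (2 * m%:R + d%:R)).
- exists (3 `^ (- q)); first exact: powR_gt0.
  exists (Num.min (de `^ (2 * H1)) (de `^ (2 * H2))).
    by rewrite lt_min !powR_gt0.
  move=> eps e0; rewrite lt_min => /andP[h1 h2].
  have [-> p0] := h_rate_super eps hs.
  set U := eps `^ a1; set W := eps `^ a2.
  have UP : U `^ (2 * H1) = eps by rewrite /U -powRrM mulVf// powRr1// ltW.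
  have WP : W `^ (2 * H2) = eps by rewrite /W -powRrM mulVf// powRr1// ltW.
  have Ud : U <= de.
    by have := powR_le (ltW a10) (ltW e0) (ltW h1); rewrite (powRK (ltW de0)).
  have Wd : W <= de.
    by have := powR_le (ltW a20) (ltW e0) (ltW h2); rewrite (powRK (ltW de0)).
  apply: (@le_trans _ _ ((Num.sqrt (3 * eps))^-1 ^+ n * W * U)).
    rewrite sqrtrV_expE -/q; last by rewrite mulr_ge0// ltW.
    rewrite (powRM _ (ler0n R 3) (ltW e0)) -!mulrA ler_wpM2l ?powR_ge0// -powRN /W /U.
    by rewrite -!powRD ?lt0r_neq0 ?implybT// le_eqVlt; apply/orP; left; apply/eqP; congr powR; ring.
  apply: le_trans (le_Rintegral_sub_itv (a' := 0) (b' := U) (innerb _ e0) _ _ Ud); last 2 first.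
  + by move=> u; exact: inner_ge0.
  + by rewrite oppr_le0 ltW.
  have -> : (Num.sqrt (3 * eps))^-1 ^+ n * W * U =
      \int[itv_measure 0 U]_u ((Num.sqrt (3 * eps))^-1 ^+ n * W).
    by rewrite Rintegral_cstT itv_measure_setT ?powR_ge0// subr0.
  apply: le_Rintegral_itv_measure; [exact: bmf_cst|exact: innerb|] => u u0 uU.
  apply: inner_ge => //; first exact: powR_ge0.
  have : `|u| `^ (2 * H1) <= U `^ (2 * H1).
    by rewrite gtr0_norm// powR_le// ?mulr_ge0 ?ltW.
  by rewrite UP WP (_ : 3 * eps = eps + eps + eps) ?lerD2r//; ring.
- have [_ qE] := h_rate_crit 1 hc.
  (* The exponent which balances the two increments: (u^g)^(2 H2) = u^(2 H1). *)
  pose g := a2 / a1.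
  have g0 : 0 < g by rewrite divr_gt0.
  (* u < D ensures both u <= de and u^g <= de. *)
  pose D := Num.min de (de `^ g^-1).
  have D0 : 0 < D by rewrite lt_min de0 powR_gt0.
  have Dde : D <= de by rewrite ge_min lexx.
  (* If - ln eps >= l0, then - (a1 / 2) ln eps exceeds |ln D|, so that U < D and ln D - ln U is at
     least half of - a1 ln eps. The summand 2 absorbs the constant in ln (1 + eps^(-1/2)) <= 1 - (ln
     eps) / 2. *)
  pose l0 := 2 + 2 * `|ln D| / a1.
  have ll0 : 0 < l0 by rewrite ltr_pwDl// divr_ge0 ?mulr_ge0// ltW.
  exists (3 `^ (- q) * (a1 / 2)); first by rewrite mulr_gt0 ?powR_gt0 ?divr_gt0.
  exists (expR (- l0)); first exact: expR_gt0.
  move=> eps e0 he.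
  have lE : l0 <= - ln eps.
    by rewrite lerNr -[leRHS]expRK ler_ln ?posrE ?expR_gt0// ltW.
  have [-> _] := h_rate_crit eps hc.
  set U := eps `^ a1.
  have U0 : 0 < U by exact: powR_gt0.
  have UP : U `^ (2 * H1) = eps by rewrite /U -powRrM mulVf// powRr1// ltW.
  have lnU : ln U = a1 * ln eps by rewrite /U ln_powR.
  have a1l : 2 * a1 + 2 * `|ln D| <= - (a1 * ln eps).
    have := ler_wpM2l (ltW a10) lE; rewrite /l0 mulrDr mulrN.
    by rewrite [a1 * (_ / a1)]mulrC mulfVK ?lt0r_neq0//; lra.
  have lnD := ler_norm (- ln D); rewrite normrN in lnD.
  have UD : U < D.
    by rewrite -ltr_ln ?posrE// lnU; have := a10; have := normr_ge0 (ln D); move: a1l lnD; lra.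
  apply: (@le_trans _ _ (3 `^ (- q) * (ln D - ln U))).
    rewrite -mulrA ler_wpM2l ?powR_ge0//.
    have pp : 0 < (eps `^ (1 / 2))^-1 by rewrite invr_gt0 powR_gt0.
    have e1 : 1 <= (eps `^ (1 / 2))^-1.
      rewrite -ler_ln ?posrE// ln1 lnV ?posrE ?powR_gt0// ln_powR.
      by move: ll0 lE; lra.
    have h1 : ln (1 + (eps `^ (1 / 2))^-1) <= 1 - ln eps / 2.
      apply: (@le_trans _ _ (ln (2 * (eps `^ (1 / 2))^-1))).
        by rewrite ler_ln ?posrE ?addr_gt0 ?mulr_gt0//; move: e1; lra.
      rewrite lnM ?posrE// lnV ?posrE ?powR_gt0// ln_powR.
      by have := @le_ln1Dx R 1 (lt_trans (ltrN10 R) ltr01); rewrite -[1 + 1]/(2%:R); lra.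
    have h2 : 1 - ln eps / 2 <= - ln eps.
      have := divr_ge0 (mulr_ge0 (ler0n R 2) (normr_ge0 (ln D))) (ltW a10); move: lE; rewrite /l0; lra.
    have := ler_wpM2l (ltW (divr_gt0 a10 (ltr0n R 2))) (le_trans h1 h2).
    by move/le_trans; apply; rewrite lnU; have := a10; have := normr_ge0 (ln D); move: a1l lnD; lra.
  rewrite -Rintegral_itv_inv// -bmf_RintegralZl; last exact: bmf_inv_max.
  apply: le_trans (le_Rintegral_sub_itv (a' := U) (b' := D) (innerb _ e0) _ _ Dde); last 2 first.
  + by move=> u; exact: inner_ge0.
  + by apply: (@le_trans _ _ 0); [rewrite oppr_le0 ltW|exact: ltW].
  apply: le_Rintegral_itv_measure; [|exact: innerb|].
    by apply: bmfZ; exact: bmf_inv_max.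
  move=> u Uu uD; have u0 : 0 < u by exact: lt_trans Uu.
  rewrite (max_l (ltW Uu)).
  have uW : u `^ g <= de.
    have : u <= de `^ g^-1 by apply: le_trans (ltW uD) _; rewrite ge_min lexx orbT.
    move/(powR_le (ltW g0) (ltW u0)); rewrite -powRrM mulVf ?lt0r_neq0// powRr1//.
    exact: ltW.
  have gE : (u `^ g) `^ (2 * H2) = u `^ (2 * H1).
    rewrite -powRrM; congr powR; rewrite /g /a1 /a2.
    by field; rewrite !lt0r_neq0.
  apply: le_trans (@inner_ge eps u (u `^ g) (3 * u `^ (2 * H1)) e0 (powR_ge0 _ _) uW _); last first.
    rewrite gE gtr0_norm//.
    have : U `^ (2 * H1) <= u `^ (2 * H1) by rewrite powR_le ?ltW// mulr_gt0.
    rewrite UP => h; rewrite [leRHS](_ : _ = u `^ (2 * H1) + u `^ (2 * H1) + u `^ (2 * H1)); last by ring.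
    by rewrite lerD2l.
  rewrite sqrtrV_expE -/q; last by rewrite mulr_ge0 ?powR_ge0.
  rewrite powRM ?powR_ge0// -mulrA ler_wpM2l ?powR_ge0//.
  rewrite -powRrM -powRD ?lt0r_neq0 ?implybT// -(powR_inv1 (ltW u0)).
  rewrite le_eqVlt; apply/orP; left; apply/eqP; congr powR; rewrite qE /g /a1 /a2.
  by field; rewrite !lt0r_neq0.
Qed.

End rate.
End singular_integral.

(** * What the class of processes says about one covariance function *)

Section regular_covariance.
Context {R : realType}.
Implicit Types (T H : R) (rho : R -> R -> R).

Definition increment_variance rho (s t : R) : R := rho t t - 2 * rho s t + rho s s.

(** The analytic content of the class for a single component. (P1) is extended to the closed
    interval [0, T] and to s, t equal or in either order; (P2) is written with real square roots. *)
Record regular_covariance T H rho : Prop := {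
  rc_sym : forall s t, rho s t = rho t s;
  rc_psd : forall a b s t, 0 <= s -> 0 <= t ->
    0 <= a ^+ 2 * rho s s + 2 * a * b * rho s t + b ^+ 2 * rho t t;
  rc_P1 : exists k1 k2 : R, [/\ 0 < k1, k1 <= k2 & forall s t, 0 <= s -> s <= T ->
    0 <= t -> t <= T -> k1 * `|t - s| `^ (2 * H) <= increment_variance rho s t /\
      increment_variance rho s t <= k2 * `|t - s| `^ (2 * H)];
  rc_P2 : exists2 beta : R -> R, beta g @[g --> +oo] --> (0 : R) &
    forall g s t, 1 < g -> 0 < s -> s < t -> t < T -> (t - s) / s <= 1 / g ->
    `|rho s t - rho s s| <=
      beta g * Num.sqrt (increment_variance rho s t) * Num.sqrt (rho s s) }.

Section facts.
Variables (T H : R) (rho : R -> R -> R).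
Hypothesis T0 : 0 < T.
Hypothesis H0 : 0 < H.
Hypothesis rc : regular_covariance T H rho.
Notation iv := (increment_variance rho).

Lemma increment_varianceC s t : iv s t = iv t s.
Proof. by rewrite /increment_variance (rc_sym rc s t); ring. Qed.

Lemma increment_variance_ge0 s t : 0 <= s -> 0 <= t -> 0 <= iv s t.
Proof.
move=> s0 t0; apply: le_trans (rc_psd rc (-1) 1 s0 t0) _.
by rewrite /increment_variance le_eqVlt; apply/orP; left; apply/eqP; ring.
Qed.

Lemma rc_var_ge0 t : 0 <= t -> 0 <= rho t t.
Proof.
by move=> t0; have := rc_psd rc 1 0 t0 t0; rewrite expr1n expr0n /=; lra.
Qed.

(** The difference of the two sides is the variance of 2 X_s - X_t. *)
Lemma rc_var_le s t : 0 <= s -> 0 <= t -> rho t t <= 2 * rho s s + 2 * iv s t.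
Proof.
by move=> s0 t0; have := rc_psd rc 2 (-1) s0 t0; rewrite /increment_variance; lra.
Qed.

Lemma rc_bounded : exists2 M, 1 <= M & forall t, 0 <= t -> t <= T -> rho t t <= M.
Proof.
have [k1 [k2 [k10 k12 hk]]] := rc_P1 rc.
have k20 : 0 <= k2 by apply: le_trans k12; exact: ltW.
exists (1 + 2 * rho 0 0 + 2 * (k2 * T `^ (2 * H))).
  by have := rc_var_ge0 (lexx 0); have := mulr_ge0 k20 (powR_ge0 T (2 * H)); lra.
move=> t t0 tT; have := rc_var_le (lexx 0) t0.
have [_] := hk _ _ (lexx 0) (ltW T0) t0 tT; rewrite subr0 ger0_norm//.
have : k2 * t `^ (2 * H) <= k2 * T `^ (2 * H).
  by rewrite ler_wpM2l// powR_le// mulr_ge0// ltW.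
by lra.
Qed.

Lemma rc_increment_variance_small e : 0 < e -> exists2 de, 0 < de &
  forall s t, 0 <= s -> s <= T -> 0 <= t -> t <= T -> `|t - s| <= de -> iv s t <= e.
Proof.
move=> e0; have [k1 [k2 [k10 k12 hk]]] := rc_P1 rc.
have k20 : 0 < k2 by exact: lt_le_trans k12.
have H20 : 0 < 2 * H by rewrite mulr_gt0.
exists ((e / k2) `^ (2 * H)^-1); first by rewrite powR_gt0 ?divr_gt0.
move=> s t s0 sT t0 tT h; have [_ h2] := hk _ _ s0 sT t0 tT.
apply: le_trans h2 _; rewrite mulrC -ler_pdivlMr//.
apply: le_trans (powR_le (ltW H20) (normr_ge0 _) h) _.
by rewrite -powRrM mulVf ?lt0r_neq0// powRr1// divr_ge0// ltW.
Qed.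

(** (P1) bounds increments, not the variance itself. But the increment from T / 3 to 2 T / 3 has
    variance at least 4 [ka], so at one of these two times the variance is at least [ka]. By
    [rc_var_le] it stays above [ka / 4] as long as the increment variance is at most [ka / 4]; T / 6
    keeps the interval inside ]0, T[. *)
Lemma rc_nondegenerate : exists a b a0, [/\ 0 < a, a < b, b < T, 0 < a0 &
  forall t, a <= t -> t <= b -> a0 <= rho t t].
Proof.
have [k1 [k2 [k10 k12 hk]]] := rc_P1 rc.
have Tk : 0 < T / 3 by rewrite divr_gt0.
pose ka := k1 * (T / 3) `^ (2 * H) / 4.
have ka0 : 0 < ka by rewrite divr_gt0// mulr_gt0// powR_gt0.
have [s [s1 s2 hs]] : exists s, [/\ T / 3 <= s, s <= 2 * T / 3 & ka <= rho s s].
  have p1 : 0 <= T / 3 by exact: ltW.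
  have p2 : 0 <= 2 * T / 3 by lra.
  have p3 : T / 3 <= T by lra.
  have p4 : 2 * T / 3 <= T by lra.
  have [] := hk _ _ p1 p3 p2 p4.
  rewrite (_ : 2 * T / 3 - T / 3 = T / 3); last by field.
  rewrite gtr0_norm// => h _; have := rc_psd rc 1 1 p1 p2; rewrite !expr1n => h2.
  have h3 : 4 * ka <= 2 * rho (T / 3) (T / 3) + 2 * rho (2 * T / 3) (2 * T / 3).
    by move: h h2; rewrite /increment_variance /ka; lra.
  have [h4|h4] := leP ka (rho (T / 3) (T / 3)).
    by exists (T / 3); split => //; lra.
  by exists (2 * T / 3); split => //; lra.
have ka4 : 0 < ka / 4 by rewrite divr_gt0.
have [de de0 hde] := rc_increment_variance_small ka4.
pose et := Num.min de (T / 6).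
have et0 : 0 < et by rewrite lt_min de0 divr_gt0.
have etT : et <= T / 6 by rewrite ge_min lexx orbT.
have etd : et <= de by rewrite ge_min lexx.
exists (s - et), (s + et), (ka / 4); split => //; try lra.
move=> t t1 t2; have t0 : 0 <= t by lra.
have s0 : 0 <= s by lra.
have tT : t <= T by lra.
have sT : s <= T by lra.
have : iv t s <= ka / 4.
  by apply: hde => //; rewrite ler_norml; apply/andP; split; lra.
by have := rc_var_le t0 s0; lra.
Qed.

(** For s < t this is (P2): as s >= et, a small t - s gives (t - s) / s <= 1 / g with beta g as
    small as desired. For t < s the base point is the later time; exchanging base points costs one
    increment variance, which, once below (th / 2)^2, is at most th / 2 times its own square
    root. *)
Lemma rc_increment_small th et : 0 < th -> 0 < et -> exists2 de, 0 < de &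
  forall s t, et <= s -> s < T -> et <= t -> t < T -> `|t - s| <= de ->
    `|rho s t - rho s s| <= th * Num.sqrt (iv s t).
Proof.
move=> th0 et0; have [M M1 hM] := rc_bounded.
have M0 : 0 < M by exact: lt_le_trans M1.
have [beta b0 hb] := rc_P2 rc.
have sM0 : 0 < Num.sqrt M by rewrite sqrtr_gt0.
have th2 : 0 < th / 2 by rewrite divr_gt0.
have [g [g1 bg]] : exists g, 1 < g /\ `|beta g| <= th / 2 / Num.sqrt M.
  have e0 : 0 < th / 2 / Num.sqrt M by rewrite divr_gt0.
  move/cvgrPdist_le : b0 => /(_ _ e0) [N [_ hN]].
  exists (Num.max N 1 + 1); split.
    by rewrite ltr_pwDr// le_max lexx orbT.
  have := hN (Num.max N 1 + 1); rewrite sub0r normrN; apply.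
  by rewrite ltr_pwDr// le_max lexx.
have g0 : 0 < g by exact: lt_trans g1.
have sq0 : 0 < (th / 2) ^+ 2 by rewrite exprn_gt0.
have [d1 d10 hd1] := rc_increment_variance_small sq0.
exists (Num.min d1 (et / g)); first by rewrite lt_min d10 divr_gt0.
have step s t : et <= s -> s < t -> t < T -> t - s <= et / g ->
    `|rho s t - rho s s| <= th / 2 * Num.sqrt (iv s t).
  move=> es st tT hd; have s0 : 0 < s by exact: lt_le_trans es.
  have sT : s <= T by apply: ltW; exact: lt_trans tT.
  have gs : (t - s) / s <= 1 / g.
    rewrite ler_pdivrMr//; apply: le_trans hd _.
    by rewrite mulrC mul1r ler_wpM2l// invr_ge0 ltW.
  apply: le_trans (hb g s t g1 s0 st tT gs) _.
  apply: (@le_trans _ _ (`|beta g| * Num.sqrt (iv s t) * Num.sqrt M)).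
    apply: (@le_trans _ _ (`|beta g| * Num.sqrt (iv s t) * Num.sqrt (rho s s))).
      by rewrite ler_wpM2r ?sqrtr_ge0// ler_wpM2r ?sqrtr_ge0// ler_norm.
    by rewrite ler_wpM2l ?mulr_ge0 ?sqrtr_ge0// ler_wsqrtr// hM// ltW.
  rewrite mulrAC ler_wpM2r ?sqrtr_ge0//.
  by rewrite -ler_pdivlMr.
move=> s t es sT et' tT; rewrite le_min => /andP[h1 h2].
have [st|ts|->] := ltgtP s t.
- apply: le_trans (step s t es st tT _) _; first by rewrite ger0_norm in h2; lra.
  by rewrite ler_wpM2r ?sqrtr_ge0//; lra.
- have s0 : 0 <= s by lra.
  have t0 : 0 <= t by lra.
  have h3 : `|rho t s - rho t t| <= th / 2 * Num.sqrt (iv s t).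
    by rewrite increment_varianceC; apply: step => //; rewrite distrC ger0_norm in h2; lra.
  have i0 := increment_variance_ge0 s0 t0.
  have h4 : iv s t <= th / 2 * Num.sqrt (iv s t).
    have i1 : iv s t <= (th / 2) ^+ 2 by apply: hd1 => //; exact: ltW.
    rewrite -[leLHS]sqr_sqrtr// expr2 ler_wpM2r ?sqrtr_ge0//.
    by rewrite -[leRHS]gtr0_norm// -sqrtr_sqr ler_wsqrtr.
  have -> : rho s t - rho s s = - (iv s t + (rho t s - rho t t)).
    by rewrite /increment_variance (rc_sym rc t s); ring.
  rewrite normrN; apply: le_trans (ler_normD _ _) _; rewrite (ger0_norm i0).
  by lra.
- by rewrite subrr normr0 mulr_ge0 ?sqrtr_ge0// ltW.
Qed.

End facts.
End regular_covariance.

Lemma class_G12_regular_covariance {R : realType} {dO : measure_display}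
    {Omega : measurableType dO} (P : probability Omega R) (d : nat) (H T : R)
    (X : R -> 'I_d -> {RV P >-> R}) (l : 'I_d) : 0 < T -> 0 < H ->
  class_G12 H T X -> regular_covariance T H (pcov X l).
Proof.
move=> T0 H0 [[gX cX _ _ P1] P2]; split.
- by move=> s t; exact: pcovC.
- by move=> a b s t; exact: pcov_psd.
(* (P1) speaks of times strictly below its horizon; the horizon T + 1 includes T. *)
- have T1 : 0 < T + 1 by rewrite addr_gt0.
  have [k1 [k2 [k10 k12 hk]]] := P1 _ T1; exists k1, k2; split => // s t s0 sT t0 tT.
  have step u v : 0 <= u -> u < v -> v <= T ->
      k1 * `|v - u| `^ (2 * H) <= increment_variance (pcov X l) u v /\
      increment_variance (pcov X l) u v <= k2 * `|v - u| `^ (2 * H).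
    move=> u0 uv vT; have v0 : 0 <= v by apply: le_trans (ltW uv).
    have vT1 : v < T + 1 by rewrite ltr_pwDr.
    have := hk l u v u0 uv vT1; rewrite expectation_increment// !lee_fin.
    by rewrite gtr0_norm ?subr_gt0.
  have [st|ts|<-] := ltgtP s t; first exact: step.
  - have -> : increment_variance (pcov X l) s t = increment_variance (pcov X l) t s.
      by rewrite /increment_variance [pcov X l s t]pcovC; ring.
    by rewrite distrC; exact: step.
  - rewrite subrr normr0 powR0 ?mulf_neq0 ?lt0r_neq0// !mulr0 /increment_variance.
    by split; lra.
- have [beta [b0 _ bc hb]] := P2; exists beta => // g s t g1 s0 st tT hg.
  have t0 : 0 <= t by apply: ltW; exact: lt_trans st.
  have := hb l g s t g1 s0 st tT hg.
  rewrite (expectation_increment_cov gX l (ltW s0) t0).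
  rewrite (expectation_increment gX l (ltW s0) t0) (expectation_square gX l (ltW s0)) !poweR_EFin abse_EFin -!EFinM lee_fin.
  have h1 := pcov_psd gX l 1 0 (ltW s0) (ltW s0).
  have h2 := pcov_psd gX l (-1) 1 (ltW s0) t0.
  rewrite !powR12_sqrt; first by [].
  - by move: h1; rewrite expr1n expr0n /=; lra.
  - by move: h2; rewrite sqrrN !expr1n /increment_variance; lra.
Qed.

(** * Kernel bounds in terms of time increments *)

Section pair_kernel.
Context {R : realType} {d : nat}.
Variables (rX rY : R -> R -> R) (x : 'I_d -> R) (k : 'I_d -> nat).
Definition pair_kernel (eps t s t' s' : R) : R :=
  pair_density x k (rX t t + rY s s + eps) (rX t' t' + rY s' s' + eps)
    (rX t t' + rY s s').

End pair_kernel.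

Lemma inv_sqrt_expr_le {R : realType} (n : nat) (p q : R) : 0 < p -> p <= q ->
  (Num.sqrt q)^-1 ^+ n <= (Num.sqrt p)^-1 ^+ n.
Proof.
move=> p0 pq; have q0 := lt_le_trans p0 pq.
by apply: lerXn2r; rewrite ?nnegrE ?invr_ge0 ?sqrtr_ge0// lef_pV2 ?posrE ?sqrtr_gt0// ler_wsqrtr.
Qed.

(** The quantity in the middle is r^2, and (P1) compares it with the argument of [rate_kernel]; the
    entries 1 and 2 of the minimum and maximum take care of the term 2 eps. *)
Lemma pair_increment_bounds {R : realType} (T H1 H2 : R) (rX rY : R -> R -> R) :
  regular_covariance T H1 rX -> regular_covariance T H2 rY ->
  exists ka K : R, [/\ 0 < ka, 0 < K & forall eps t s t' s', 0 < eps ->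
    0 <= t /\ t <= T -> 0 <= s /\ s <= T -> 0 <= t' /\ t' <= T -> 0 <= s' /\ s' <= T ->
    ka * (`|t' - t| `^ (2 * H1) + `|s' - s| `^ (2 * H2) + eps) <=
      increment_variance rX t t' + increment_variance rY s s' + 2 * eps /\
    increment_variance rX t t' + increment_variance rY s s' + 2 * eps <=
      K * (`|t' - t| `^ (2 * H1) + `|s' - s| `^ (2 * H2) + eps)].
Proof.
move=> rcX rcY.
have [k1 [k2 [k10 k12 hk]]] := rc_P1 rcX.
have [j1 [j2 [j10 j12 hj]]] := rc_P1 rcY.
exists (Num.min (Num.min k1 j1) 1), (Num.max (Num.max k2 j2) 2).
set ka := Num.min _ 1; set K := Num.max _ 2.
have ka1 : ka <= k1 by rewrite !ge_min lexx.
have ka2 : ka <= j1 by rewrite !ge_min lexx orbT.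
have ka3 : ka <= 1 by rewrite !ge_min lexx orbT.
have K1 : k2 <= K by rewrite !le_max lexx.
have K2 : j2 <= K by rewrite !le_max lexx orbT.
have K3 : 2 <= K by rewrite !le_max lexx orbT.
split; [by rewrite !lt_min k10 j10 ltr01|by apply: lt_le_trans K3|].
move=> eps t s t' s' e0 [t0 tT] [s0 sT] [t'0 t'T] [s'0 s'T].
have [] := hk _ _ t0 tT t'0 t'T; have [] := hj _ _ s0 sT s'0 s'T.
have := powR_ge0 `|t' - t| (2 * H1); have := powR_ge0 `|s' - s| (2 * H2).
move: (_ `^ (2 * H1)) (_ `^ (2 * H2)) => u w w0 u0 h1 h2 h3 h4.
have := ler_wpM2r u0 ka1; have := ler_wpM2r w0 ka2; have := ler_wpM2r (ltW e0) ka3.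
have := ler_wpM2r u0 K1; have := ler_wpM2r w0 K2; have := ler_wpM2r (ltW e0) K3.
by split; lra.
Qed.

(** [pair_density_bounds] rewritten in the time variables. C, c0, a and b are fixed before the
    precision [tau], which only decides how close the times must be and how small eps; this order
    allows [tau] to be chosen later against c0. The lower bound [eta] on the times is what (P2)
    requires for uniformity, and the gain c0 asks for t in [a, b], where the variance of X_t is
    bounded below. *)
Lemma pair_kernel_bounds {R : realType} {d : nat} (T H1 H2 : R) (rX rY : R -> R -> R)
    (x : 'I_d -> R) (k : 'I_d -> nat) :
  0 < T -> 0 < H1 -> 0 < H2 ->
  regular_covariance T H1 rX -> regular_covariance T H2 rY ->
  0 < \sum_(l < d) x l ^+ 2 ->
  (forall eps t t' s s', 0 < eps -> 0 <= t -> 0 <= t' -> 0 <= s -> 0 <= s' ->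
    0 < (rX t t + rY s s + eps) * (rX t' t' + rY s' s' + eps) -
        (rX t t' + rY s s') ^+ 2) ->
  let rate eps t s t' s' :=
    rate_kernel H1 H2 eps (d + 2 * order_of k) (t' - t, s' - s) in
  let K := pair_kernel rX rY x k in
  exists C c0 a b : R,
  [/\ 0 < C, 0 < c0, 0 < a, a < b & b < T] /\
  ((forall eps t s t' s', 0 < eps -> eps <= 1 -> 0 <= t <= T -> 0 <= s <= T -> 0 <= t' <= T -> 0 <= s' <= T ->
     `|K eps t s t' s'| <= C * rate eps t s t' s') /\
   (forall tau eta, 0 < tau -> tau <= 1 -> 0 < eta -> exists2 de, 0 < de &
     exists2 e0, 0 < e0 & forall eps t s t' s', 0 < eps -> eps < e0 ->
       eta <= t < T -> eta <= s < T -> eta <= t' < T -> eta <= s' < T ->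
       `|t' - t| <= de -> `|s' - s| <= de ->
       - (tau * C) * rate eps t s t' s' <= K eps t s t' s' /\
       (a <= t <= b -> (c0 - tau * C) * rate eps t s t' s' <= K eps t s t' s'))).
Proof.
move=> T0 H10 H20 rcX rcY x0 det_gt0 rate K; pose n := (d + 2 * order_of k)%N.
pose r2 (eps t s t' s' : R) : R := (rX t t + rY s s + eps) + (rX t' t' + rY s' s' + eps) -
  2 * (rX t t' + rY s s').
have r2E eps t s t' s' : r2 eps t s t' s' =
    increment_variance rX t t' + increment_variance rY s s' + 2 * eps.
  by rewrite /r2 /increment_variance; ring.
have S0 eps u w : 0 < eps -> 0 < `|u| `^ (2 * H1) + `|w| `^ (2 * H2) + eps :> R.
  by move=> e0; rewrite ltr_wpDl// addr_ge0 ?powR_ge0.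
have inv_sqrtM (p q : R) : 0 < p ->
    (Num.sqrt (p * q))^-1 ^+ n = (Num.sqrt p)^-1 ^+ n * (Num.sqrt q)^-1 ^+ n.
  by move=> p0; rewrite sqrtrM ?ltW// invfM exprMn.
pose in0T (t : R) := 0 <= t /\ t <= T.
have [MX MX1 hMX] := rc_bounded T0 H10 rcX.
have [MY MY1 hMY] := rc_bounded T0 H20 rcY.
pose M := MX + MY + 1.
have M1 : 1 <= M by rewrite /M; lra.
have M0 : 0 < M by exact: lt_le_trans M1.
have [C C0 [b1 b2 b3]] := pair_density_bounds k x0 M1.
have [a [b [al [a0 ab bT al0 hal]]]] := rc_nondegenerate T0 H10 rcX.
have [c c0 b3'] := b3 (al / 2) (divr_gt0 al0 (ltr0n R 2)).
have [ka [K' [ka0 K0 hr]]] := pair_increment_bounds rcX rcY.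
pose hi := (Num.sqrt ka)^-1 ^+ n; pose lo := (Num.sqrt K')^-1 ^+ n.
have hi0 : 0 < hi by rewrite exprn_gt0// invr_gt0 sqrtr_gt0.
have lo0 : 0 < lo by rewrite exprn_gt0// invr_gt0 sqrtr_gt0.
have rhi eps t s t' s' : 0 < eps -> in0T t -> in0T s -> in0T t' -> in0T s' ->
    (Num.sqrt (r2 eps t s t' s'))^-1 ^+ n <= hi * rate eps t s t' s'.
  move=> e0 it is_ it' is'; have [h _] := hr _ _ _ _ _ e0 it is_ it' is'.
  rewrite r2E /rate /rate_kernel /= -inv_sqrtM//; apply: inv_sqrt_expr_le => //.
  by rewrite mulr_gt0// S0.
have rlo eps t s t' s' : 0 < eps -> in0T t -> in0T s -> in0T t' -> in0T s' ->
    lo * rate eps t s t' s' <= (Num.sqrt (r2 eps t s t' s'))^-1 ^+ n.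
  move=> e0 it is_ it' is'; have [h1 h2] := hr _ _ _ _ _ e0 it is_ it' is'.
  rewrite r2E /rate /rate_kernel /= -inv_sqrtM//; apply: inv_sqrt_expr_le => //.
  by apply: lt_le_trans h1; rewrite mulr_gt0// S0.
have A0 eps t s : 0 < eps -> in0T t -> in0T s -> 0 < rX t t + rY s s + eps.
  move=> e0 [t0 _] [s0 _]; have := rc_var_ge0 rcX t0; have := rc_var_ge0 rcY s0; lra.
have AM eps t s : eps <= 1 -> in0T t -> in0T s -> rX t t + rY s s + eps <= M.
  move=> e1 [t0 tT] [s0 sT]; have := hMX t t0 tT; have := hMY s s0 sT; rewrite /M; lra.
exists (C * hi), (c * lo), a, b; split; first by split => //; exact: mulr_gt0.
split=> [eps t s t' s' e0 e1 /andP it /andP is_ /andP it' /andP is'|tau eta tau0 tau1 eta0].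
  apply: le_trans (b1 _ _ _ (A0 _ _ _ e0 it is_) (AM _ _ _ e1 it is_)
    (A0 _ _ _ e0 it' is') (AM _ _ _ e1 it' is') _) _.
    by case: it it' is_ is' => ? _ [? _] [? _] [? _]; exact: det_gt0.
  by rewrite -mulrA ler_wpM2l ?(ltW C0)//; exact: rhi.
(* As r <= 2 M, the second entry gives sg r <= al / 2, hence D >= al / 2; it also gives sg^2 <= al /
   2, hence A - sg^2 >= al / 2. These are the conditions for [b3']. *)
pose sg := Num.min tau (al / (4 * M)).
have sg0 : 0 < sg by rewrite lt_min tau0 divr_gt0// mulr_gt0.
have sgt : sg <= tau by rewrite ge_min lexx.
have sgM : sg * (4 * M) <= al by rewrite -ler_pdivlMr ?mulr_gt0// ge_min lexx orbT.
have sg3 : 0 < sg / 3 by rewrite divr_gt0.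
have [dX dX0 hX] := rc_increment_small T0 H10 rcX sg3 eta0.
have [dY dY0 hY] := rc_increment_small T0 H20 rcY sg3 eta0.
exists (Num.min dX dY); first by rewrite lt_min dX0.
(* Then eps <= (sg / 3) sqrt eps <= (sg / 3) r: the increment of X, that of Y and eps each take a
   third of sg r. *)
exists (Num.min 1 ((sg / 3) ^+ 2)); first by rewrite lt_min ltr01 exprn_gt0.
move=> eps t s t' s' e0; rewrite lt_min => /andP[e1 e2].
move=> /andP[et tT] /andP[es sT] /andP[et' t'T] /andP[es' s'T].
rewrite !le_min => /andP[tX _] /andP[_ sY].
have pos u : eta <= u -> 0 <= u by move=> h; apply: le_trans h; exact: ltW.
have t0 := pos _ et; have s0 := pos _ es; have t'0 := pos _ et'; have s'0 := pos _ es'.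
have it : in0T t by split => //; exact: ltW.
have is_ : in0T s by split => //; exact: ltW.
have it' : in0T t' by split => //; exact: ltW.
have is' : in0T s' by split => //; exact: ltW.
have rt := rhi _ _ _ _ _ e0 it is_ it' is'.
have rl := rlo _ _ _ _ _ e0 it is_ it' is'.
have rate0 : 0 <= rate eps t s t' s' by exact: rate_kernel_ge0.
have iX := increment_variance_ge0 rcX t0 t'0.
have iY := increment_variance_ge0 rcY s0 s'0.
set A := rX t t + rY s s + eps.
set B := rX t' t' + rY s' s' + eps.
set D := rX t t' + rY s s'.
set r := Num.sqrt (A + B - 2 * D).
have rE : A + B - 2 * D = r2 eps t s t' s' by [].
have sr u : 0 <= u -> u <= r2 eps t s t' s' -> Num.sqrt u <= r.
  by move=> u0 h; rewrite /r rE ler_wsqrtr.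
have eX : sg / 3 * Num.sqrt (increment_variance rX t t') <= sg / 3 * r.
  by rewrite ler_wpM2l ?(ltW sg3)//; apply: sr => //; rewrite r2E; move: iX iY e0; clear; lra.
have eY : sg / 3 * Num.sqrt (increment_variance rY s s') <= sg / 3 * r.
  by rewrite ler_wpM2l ?(ltW sg3)//; apply: sr => //; rewrite r2E; move: iX iY e0; clear; lra.
have ee : eps <= sg / 3 * r.
  rewrite -[leLHS](sqr_sqrtr (ltW e0)) expr2; apply: ler_pM; rewrite ?sqrtr_ge0//.
    by rewrite -[leRHS]gtr0_norm// -sqrtr_sqr ler_wsqrtr// ltW.
  by apply: sr; rewrite ?(ltW e0)// r2E; move: iX iY e0; clear; lra.
have n1 : `|A - D| <= sg * r.
  have -> : A - D = - (rX t t' - rX t t) - (rY s s' - rY s s) + eps by rewrite /A /D; ring.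
  have := hX t t' et tT et' t'T tX; have := hY s s' es sT es' s'T sY.
  rewrite !ler_norml; move: eX eY ee e0; clear=> eX eY ee e0 /andP[? ?] /andP[? ?].
  by apply/andP; split; lra.
have n2 : `|B - D| <= sg * r.
  have -> : B - D = - (rX t' t - rX t' t') - (rY s' s - rY s' s') + eps.
    by rewrite /B /D (rc_sym rcX t t') (rc_sym rcY s s'); ring.
  have := hX t' t et' t'T et tT; have := hY s' s es' s'T es sT.
  rewrite [`|t - t'|]distrC [`|s - s'|]distrC => /(_ sY) h1 /(_ tX) h2.
  move: h1 h2; rewrite [increment_variance rX t' t](increment_varianceC rcX).
  rewrite [increment_variance rY s' s](increment_varianceC rcY).
  rewrite !ler_norml; move: eX eY ee e0; clear=> eX eY ee e0 /andP[? ?] /andP[? ?].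
  by apply/andP; split; lra.
have sg1 : sg <= 1 by exact: le_trans sgt tau1.
have D0 := det_gt0 _ _ _ _ _ e0 t0 t'0 s0 s'0.
have e1' := ltW e1.
have Crate : sg * C * (hi * rate eps t s t' s') <= tau * (C * hi) * rate eps t s t' s'.
  rewrite -!mulrA ler_wpM2r// ?mulr_ge0 ?(ltW C0) ?(ltW hi0)//.
have sC0 : 0 <= sg * C by rewrite mulr_ge0 ?(ltW sg0) ?(ltW C0).
have neg : - (tau * (C * hi)) * rate eps t s t' s' <=
    - (sg * C) * (Num.sqrt (A + B - 2 * D))^-1 ^+ n.
  rewrite !mulNr lerN2; apply: le_trans Crate.
  by rewrite ler_wpM2l// rE.
split.
  apply: le_trans neg _.
  by apply: b2 => //; [exact: A0|exact: AM|exact: A0|exact: AM|exact: ltW].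
move=> /andP[ta tb].
have rM : r <= 2 * M.
  rewrite -[leRHS]gtr0_norm ?mulr_gt0// -sqrtr_sqr ler_wsqrtr//.
  have h1 := AM _ _ _ e1' it is_; have h2 := AM _ _ _ e1' it' is'.
  have h3 : `|D| <= M.
    rewrite -(@ler_pXn2r _ 2) ?nnegrE ?(ltW M0)// real_normK ?num_real//.
    apply: le_trans (_ : A * B <= _); first by rewrite ltW// -subr_gt0.
    by rewrite expr2; apply: ler_pM => //; rewrite ltW//; exact: A0.
  have := ler_norm (- D); rewrite normrN.
  by have := ler_wpM2l (ltW M0) M1; rewrite expr2; move: h1 h2 h3; rewrite -/A -/B; clear; lra.
have sr2 : sg * r <= al / 2.
  by have := ler_wpM2l (ltW sg0) rM; move: sgM; clear; lra.
have Aal : al <= A.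
  by rewrite /A; have := hal t ta tb; have := rc_var_ge0 rcY s0; move: e0; clear; lra.
have Dal : al / 2 <= D.
  by move: n1; rewrite ler_norml => /andP[_]; move: sr2 Aal; clear; lra.
have sal : al / 2 <= A - sg ^+ 2.
  have h1 : sg ^+ 2 <= sg by rewrite expr2 ler_piMl ?(ltW sg0).
  have h2 : sg <= sg * M by rewrite ler_peMr ?(ltW sg0).
  by move: h1 h2 sgM Aal al0; clear; lra.
apply: (@le_trans _ _ ((c - sg * C) * (Num.sqrt (A + B - 2 * D))^-1 ^+ n)); last first.
  by apply: b3' => //; [exact: A0|exact: AM|exact: A0|exact: AM|exact: ltW].
rewrite !mulrBl; apply: lerD; last by move: neg; rewrite !mulNr.
by rewrite -mulrA ler_wpM2l ?(ltW c0)// rE.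
Qed.

(** * From kernel bounds to the quadruple integral *)

Section quadruple_integral.
Context {R : realType}.
Notation bmf := bounded_measurable.
Notation mR := (measurableTypeR R).

Let bmf_itv_indic (a b : R) : bmf (\1_(`]a, b[%classic : set mR) : mR -> R).
Proof. by apply: bmf_indic; exact: measurable_itv. Qed.

Lemma Rintegral_itv_indic (T a b : R) : 0 <= a -> a <= b -> b <= T ->
  \int[itv_measure 0 T]_x (\1_(`]a, b[%classic : set mR) x) = b - a.
Proof.
move=> a0 ab bT.
rewrite -(itv_measure_setT ab) -[RHS]mul1r -Rintegral_cstT.
rewrite !Rintegral_itv_measure_indic//; last exact: bmf_cst.
apply: eq_Rintegral => x _; rewrite !indicE mulr1.
have [xi|xi] := boolP (x \in (`]a, b[%classic : set mR)); last by rewrite mulr0.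
rewrite mulr1 mem_set//; move: xi; rewrite inE /= !in_itv /= => /andP[x1 x2].
by rewrite (le_lt_trans a0 x1) (lt_le_trans x2 bT).
Qed.

Let affine_indic (T a b e u v w : R) : 0 <= T -> 0 <= a -> a <= b -> b <= T -> 0 <= e -> e <= T ->
  bmf (fun x : mR => u * \1_(`]a, b[%classic : set mR) x + (v + w * \1_(`]0, e[%classic : set mR) x))
  /\ \int[itv_measure 0 T]_x (u * \1_(`]a, b[%classic : set mR) x +
       (v + w * \1_(`]0, e[%classic : set mR) x)) = u * (b - a) + (v * T + w * e).
Proof.
move=> T0 a0 ab bT e0 eT.
have b1 : bmf (fun x : mR => u * \1_(`]a, b[%classic : set mR) x) by exact: bmfZ.
have b2 : bmf (fun x : mR => w * \1_(`]0, e[%classic : set mR) x) by exact: bmfZ.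
have b3 : bmf (fun x : mR => v) by exact: bmf_cst.
split; first by do 2 apply: bmfD => //.
rewrite bmf_RintegralD//; last exact: bmfD.
rewrite bmf_RintegralD// !bmf_RintegralZl// !Rintegral_itv_indic// Rintegral_cstT.
by rewrite itv_measure_setT// !subr0.
Qed.

Variables (T de a b e c0 c1 C C2 : R) (K : ((mR * mR) * mR) * mR -> R) (rho : mR * mR -> R).
Hypothesis de0 : 0 < de.
Hypothesis dea : de <= a.
Hypothesis ab : a <= b.
Hypothesis bT : b <= T - de.
Hypothesis e0 : 0 <= e.
Hypothesis eT : e <= T.
Hypothesis c00 : 0 <= c0.
Hypothesis c10 : 0 <= c1.
Hypothesis C0 : 0 <= C.
Hypothesis bK : bmf K.
Hypothesis brho : bmf rho.
Hypothesis rho0 : forall p, 0 <= rho p.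

Let f x : R := \1_(`]a, b[%classic : set mR) x.
Let g x : R := \1_(`]0, e[%classic : set mR) x.
(** The coefficient of the near kernel: a gain c0 on the box ]a, b[^2, a small loss c1 everywhere,
    and the full loss C for each of t, s lying within e of time 0. *)
Let lam (t s : R) : R := c0 * (f t * f s) - c1 - C * (g t + g s).

Hypothesis K_ge : forall t s t' s', 0 < t < T -> 0 < s < T -> 0 < t' < T -> 0 < s' < T ->
  lam t s * near_kernel de rho (((t, s), t'), s') - C2 <= K (((t, s), t'), s').

(** On the box the inner integral of the near kernel equals J; elsewhere it is at most J, but there
    [lam] is nonpositive. So [lam t s * J] is a lower bound in both cases, and it remains to
    integrate combinations of indicators. *)
Lemma quadruple_integral_ge :
  (c0 * (b - a) ^+ 2 - c1 * T ^+ 2 - 2 * C * e * T) * rate_integral de rho - C2 * T ^+ 4 <=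
  \int[itv_measure 0 T]_t \int[itv_measure 0 T]_s
    \int[itv_measure 0 T]_t' \int[itv_measure 0 T]_s' K (((t, s), t'), s').
Proof.
set J := rate_integral de rho; set mu := itv_measure 0 T.
have J0 : 0 <= J by exact: rate_integral_ge0.
have T0 : 0 <= T by exact: le_trans e0 eT.
have bN := bmf_near_kernel de brho.
pose I (H : ((mR * mR) * mR) * mR -> R) (q : mR * mR) :=
  \int[mu]_t' \int[mu]_s' H ((q, t'), s').
have bI1 H : bmf H -> bmf (fun p : (mR * mR) * mR => \int[mu]_s' H (p, s')).
  by move=> bH; exact: (bmf_Rintegral mu bH).
have bI H : bmf H -> bmf (I H).
  by move=> bH; exact: (bmf_Rintegral mu (bI1 H bH)).
have sec (H : ((mR * mR) * mR) * mR -> R) (p : (mR * mR) * mR) : bmf H -> bmf (fun s' => H (p, s')).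
  by move=> bH; apply: bmf_comp bH; exact: pair1_measurable.
have sec1 (H : ((mR * mR) * mR) * mR -> R) (q : mR * mR) : bmf H ->
    bmf (fun t' => \int[mu]_s' H ((q, t'), s')).
  by move=> bH; apply: (bmf_comp (phi := fun t' => (q, t')) _ (bI1 H bH)); exact: pair1_measurable.
have muT : fine (mu setT) = T by rewrite itv_measure_setT// subr0.
have step t s : 0 < t < T -> 0 < s < T -> lam t s * J - C2 * T ^+ 2 <= I K (t, s).
  move=> ht hs.
  have bZ (t' : mR) : bmf (fun s' : mR => lam t s * near_kernel de rho (((t : mR, s : mR), t'), s')).
    by apply: bmfZ; exact: (sec _ _ bN).
  have -> : I K (t, s) = \int[mu]_t' \int[mu]_s' K (((t, s), t'), s') by [].
  apply: (@le_trans _ _ (\int[mu]_t' \int[mu]_s' (lam t s * near_kernel de rho (((t, s), t'), s') - C2))); last first.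
    have bG : bmf (fun p : ((mR * mR) * mR) * mR => lam t s * near_kernel de rho p - C2).
      by apply: bmfB; [exact: bmfZ|exact: bmf_cst].
    apply: le_Rintegral_itv_measure; [exact: (sec1 _ (t : mR, s : mR) bG)|exact: sec1|].
    move=> t' t'0 t'T; apply: le_Rintegral_itv_measure; [exact: (sec _ ((t : mR, s : mR), t') bG)|exact: sec|].
    by move=> s' s'0 s'T; apply: K_ge => //; apply/andP.
  have E t' : \int[mu]_s' (lam t s * near_kernel de rho (((t, s), t'), s') - C2) =
      lam t s * \int[mu]_s' near_kernel de rho (((t, s), t'), s') - C2 * T.
    rewrite bmf_RintegralB//; last exact: bmf_cst.
    by rewrite bmf_RintegralZl ?Rintegral_cstT ?muT//; exact: (sec _ ((t : mR, s : mR), t') bN).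
  under eq_Rintegral do rewrite E.
  have bZ1 := sec1 _ (t : mR, s : mR) bN.
  rewrite bmf_RintegralB; [|exact: bmfZ|exact: bmf_cst].
  rewrite bmf_RintegralZl// Rintegral_cstT muT expr2 mulrA lerD2r.
  have NJ := near_kernel_integral_le T de brho rho0 t s.
  have N0 : 0 <= \int[mu]_t' \int[mu]_s' near_kernel de rho (((t, s), t'), s').
    by apply: Rintegral_ge0 => t' _; apply: Rintegral_ge0 => s' _; exact: near_kernel_ge0.
  have i01 (A : set mR) z : 0 <= (\1_A z : R) by rewrite indicE.
  have [box|nbox] := boolP ((t \in `]a, b[) && (s \in `]a, b[)).
    move: box; rewrite !in_itv /= => /andP[/andP[ta tb] /andP[sa sb]].
    by rewrite (near_kernel_integralE brho) //; have := dea; have := bT; lra.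
  have ff : f t * f s = 0.
    have memE (z : R) : (z \in (`]a, b[%classic : set mR)) = (z \in `]a, b[).
      by rewrite mem_setE.
    by move: nbox; rewrite negb_and /f !indicE !memE => /orP[] /negbTE ->; rewrite ?mul0r ?mulr0.
  have lam0 : lam t s <= 0.
    rewrite /lam ff mulr0 sub0r.
    have := mulr_ge0 C0 (addr_ge0 (i01 (`]0, e[%classic : set mR) t) (i01 (`]0, e[%classic : set mR) s)).
    by rewrite -/(g t) -/(g s); have := c10; lra.
  by rewrite ler_wnM2l.
have b' : b <= T by have := de0; have := bT; lra.
have a0 : 0 <= a by have := de0; have := dea; lra.
have lin (t s : R) : lam t s * J - C2 * T ^+ 2 =
    (c0 * J * f t) * f s + ((- (c1 * J) - C2 * T ^+ 2 - C * J * g t) + (- (C * J)) * g s).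
  by rewrite /lam; ring.
have Iin t : \int[mu]_s (lam t s * J - C2 * T ^+ 2) =
    (c0 * J * (b - a)) * f t + (((- (c1 * J) - C2 * T ^+ 2) * T - C * J * e) + (- (C * J * T)) * g t).
  under eq_Rintegral do rewrite lin.
  have [_ ->] := affine_indic (c0 * J * f t) (- (c1 * J) - C2 * T ^+ 2 - C * J * g t) (- (C * J)) T0 a0 ab b' e0 eT.
  by ring.
have bin t : bmf (fun s : mR => lam t s * J - C2 * T ^+ 2).
  have -> : (fun s : mR => lam t s * J - C2 * T ^+ 2) = (fun s : mR =>
      (c0 * J * f t) * f s + ((- (c1 * J) - C2 * T ^+ 2 - C * J * g t) + (- (C * J)) * g s)).
    by apply/funext => s; exact: lin.
  by have [] := affine_indic (c0 * J * f t) (- (c1 * J) - C2 * T ^+ 2 - C * J * g t) (- (C * J)) T0 a0 ab b' e0 eT.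
have [bout Iout] := affine_indic (c0 * J * (b - a)) ((- (c1 * J) - C2 * T ^+ 2) * T - C * J * e)
  (- (C * J * T)) T0 a0 ab b' e0 eT.
apply: (@le_trans _ _ (\int[mu]_t \int[mu]_s (lam t s * J - C2 * T ^+ 2))).
  under eq_Rintegral do rewrite Iin.
  rewrite Iout le_eqVlt; apply/orP; left; apply/eqP; ring.
apply: le_Rintegral_itv_measure.
- have -> : (fun t : mR => \int[mu]_s (lam t s * J - C2 * T ^+ 2)) = (fun t : mR =>
    (c0 * J * (b - a)) * f t + (((- (c1 * J) - C2 * T ^+ 2) * T - C * J * e) + (- (C * J * T)) * g t)).
    by apply/funext => t; exact: Iin.
  exact: bout.
- exact: (bmf_Rintegral mu (bI K bK)).
move=> t t0 tT; apply: le_Rintegral_itv_measure; first exact: bin.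
  by apply: (bmf_comp (phi := fun s => (t : mR, s)) _ (bI K bK)); exact: pair1_measurable.
by move=> s s0 sT; apply: step; apply/andP.
Qed.

End quadruple_integral.

(** * Choice of the constants and conclusion *)

Lemma limf_einf_ge {R : realType} (f : R -> \bar R) (e0 c : R) : 0 < e0 ->
  (forall eps, 0 < eps -> eps < e0 -> (c%:E <= f eps)%E) ->
  (c%:E <= limf_einf f (0 : R)^'+)%E.
Proof.
move=> e00 hf; rewrite limf_einfE.
apply: (@le_trans _ _ (ereal_inf (f @` `]0, e0[%classic))).
  apply: le_ereal_inf_tmp => z [y /=]; rewrite in_itv /= => /andP[y0 ye] <-.
  exact: hf.
apply: ereal_sup_ubound; exists `]0, e0[%classic => //=.
near=> y; rewrite /= in_itv /=; apply/andP; split; near: y.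
  exact: nbhs_right_gt.
exact: nbhs_right_lt.
Unshelve. all: by end_near. Qed.

(** [K] is a bounded function on all real times that is prescribed at positive ones. Away from the
    diagonal it is bounded by C2 uniformly in eps. Near the diagonal it is at least - C rho in
    general, at least - tau C rho when t and s are at least e, and at least (c0 - tau C) rho when
    moreover a < t < b. *)
Lemma quadruple_pair_kernel_ge {R : realType} {d : nat} (T H1 H2 : R)
    (rX rY : R -> R -> R) (x : 'I_d -> R) (k : 'I_d -> nat) :
  0 < T -> 0 < H1 -> 0 < H2 ->
  regular_covariance T H1 rX -> regular_covariance T H2 rY ->
  0 < \sum_(l < d) x l ^+ 2 ->
  (forall eps t t' s s', 0 < eps -> 0 <= t -> 0 <= t' -> 0 <= s -> 0 <= s' ->
    0 < (rX t t + rY s s + eps) * (rX t' t' + rY s' s' + eps) -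
        (rX t t' + rY s s') ^+ 2) ->
  1 <= H1 * H2 / (H1 + H2) * (2 * (order_of k)%:R + d%:R) ->
  exists2 c : R, 0 < c & exists2 e0 : R, 0 < e0 &
  forall eps (K : ((measurableTypeR R * measurableTypeR R) * measurableTypeR R) *
                  measurableTypeR R -> R),
  0 < eps -> eps < e0 -> bounded_measurable K ->
  (forall t s t' s', 0 < t -> 0 < s -> 0 < t' -> 0 < s' ->
     K (((t, s), t'), s') = pair_kernel rX rY x k eps t s t' s') ->
  0 < h_rate d (order_of k) H1 H2 eps /\
  c * h_rate d (order_of k) H1 H2 eps <=
  \int[itv_measure 0 T]_t \int[itv_measure 0 T]_s
    \int[itv_measure 0 T]_t' \int[itv_measure 0 T]_s' K (((t, s), t'), s').
Proof.
move=> T0 H10 H20 rcX rcY x0 det_gt0 hH; pose n := (d + 2 * order_of k)%N.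
have [C [c0 [a [b [[C0 c00 a0 ab bT] [ub lb]]]]]] :=
  pair_kernel_bounds k T0 H10 H20 rcX rcY x0 det_gt0.
pose A := c0 * (b - a) ^+ 2 / 2.
have A0 : 0 < A by rewrite divr_gt0// mulr_gt0// exprn_gt0// subr_gt0.
have A20 : 0 < A / 2 by rewrite divr_gt0.
have CT2 : 0 < C * T ^+ 2 by rewrite mulr_gt0// exprn_gt0.
(* the box ]a,b[^2 contributes 2 A; tau and e make each of the two negative
   contributions at most A / 2 *)
pose tau := Num.min 1 (A / 2 / (C * T ^+ 2)).
have tau0 : 0 < tau by rewrite lt_min ltr01 divr_gt0.
have tau1 : tau <= 1 by rewrite ge_min lexx.
have tauA : tau * (C * T ^+ 2) <= A / 2 by rewrite -ler_pdivlMr// ge_min lexx orbT.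
have CT : 0 < 2 * C * T by rewrite !mulr_gt0.
pose e := Num.min a (A / 2 / (2 * C * T)).
have e0 : 0 < e by rewrite lt_min a0 divr_gt0.
have ea : e <= a by rewrite ge_min lexx.
have eA : e * (2 * C * T) <= A / 2 by rewrite -ler_pdivlMr// ge_min lexx orbT.
(* With t, s >= e and increments below de <= e / 2, the times t', s' stay above e / 2. *)
have eta0 : 0 < e / 2 by rewrite divr_gt0.
have [de1 de10 [e1 e10 lb']] := lb tau (e / 2) tau0 tau1 eta0.
have Tb : 0 < T - b by rewrite subr_gt0.
pose de := Num.min (Num.min de1 (e / 2)) (Num.min a (T - b)).
have de0 : 0 < de by rewrite !lt_min de10 eta0 a0 Tb.
have ded : de <= de1 by rewrite !ge_min lexx.
have dee : de <= e / 2 by rewrite !ge_min lexx orbT.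
have dea : de <= a by rewrite !ge_min lexx !orbT.
have deT : de <= T - b by rewrite !ge_min lexx !orbT.
(* If one of the increments is at least de, the argument of the kernel is at least s0, whatever
   eps. *)
pose s0 := Num.min (de `^ (2 * H1)) (de `^ (2 * H2)).
have s00 : 0 < s0 by rewrite lt_min !powR_gt0.
pose C2 := C * (Num.sqrt s0)^-1 ^+ n.
have C20 : 0 <= C2 by rewrite mulr_ge0 ?(ltW C0)// exprn_ge0// invr_ge0 sqrtr_ge0.
have [c' c'0 [e2 e20 hJ]] := rate_integral_ge H10 H20 de0 hH.
(* h >= B makes the constant loss C2 T^4 at most half of the gain A c' h; the entry 1 keeps h
   positive. *)
pose B := Num.max 1 (2 * (C2 * T ^+ 4) / (A * c')).
have Ac : 0 < A * c' by rewrite mulr_gt0.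
have [e3 e30 hB] := h_rate_ge H10 H20 hH B.
exists (A * c' / 2); first by rewrite divr_gt0.
exists (Num.min (Num.min e1 e2) (Num.min e3 1)).
  by rewrite !lt_min e10 e20 e30 ltr01.
move=> eps K eps0; rewrite !lt_min => /andP[/andP[he1 he2] /andP[he3 he4]] bK KE.
have hb := hB eps eps0 he3; have hj := hJ eps eps0 he2.
set h := h_rate _ _ _ _ _ in hb hj *.
set rho := rate_kernel H1 H2 eps n in hj.
have h1 : 1 <= h by apply: le_trans hb; rewrite le_max lexx.
have hc : 2 * (C2 * T ^+ 4) <= h * (A * c').
  by rewrite -ler_pdivrMr//; apply: le_trans hb; rewrite le_max lexx orbT.
split; first by exact: lt_le_trans h1.
have brho : bounded_measurable rho by exact: bmf_rate_kernel.
have rho0 p : 0 <= rho p by exact: rate_kernel_ge0.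
have bT' : b <= T - de by rewrite lerBrDr addrC -lerBrDr.
have eT : e <= T by apply: le_trans ea _; apply: ltW; exact: lt_trans bT.
have c10 : 0 <= tau * C by rewrite mulr_ge0 ?(ltW tau0) ?(ltW C0).
apply: (@le_trans _ _ ((c0 * (b - a) ^+ 2 - tau * C * T ^+ 2 - 2 * C * e * T) *
    rate_integral de rho - C2 * T ^+ 4)).
  have J0 : 0 <= rate_integral de rho by exact: rate_integral_ge0.
  have cA : A <= c0 * (b - a) ^+ 2 - tau * C * T ^+ 2 - 2 * C * e * T.
    have -> : c0 * (b - a) ^+ 2 = 2 * A by rewrite /A; field.
    by move: tauA eA; clear; lra.
  have := ler_wpM2r J0 cA; have := ler_wpM2l (ltW A0) hj; move: hc; clear; lra.
apply: (quadruple_integral_ge (C := C) (c0 := c0) (a := a) (b := b)) => //; try exact: ltW.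
move=> t s t' s' /andP[t0 tT] /andP[u0 uT] /andP[t'0 t'T] /andP[s'0 s'T].
rewrite KE//.
have incl (u : R) : 0 < u -> u < T -> 0 <= u <= T by move=> *; apply/andP; split; exact: ltW.
have := ub eps t s t' s' eps0 (ltW he4) (incl t t0 tT) (incl s u0 uT)
  (incl t' t'0 t'T) (incl s' s'0 s'T).
rewrite -/n -/rho; set Q := pair_kernel _ _ _ _ _ _ _ _ _ => Qle.
have := ler_norm (- Q); rewrite normrN => QN.
have far (u w : R) : de <= `|u| \/ de <= `|w| -> rho (u, w) <= (Num.sqrt s0)^-1 ^+ n.
  move=> uw; apply: rate_kernel_le => //.
  have hu := powR_ge0 `|u| (2 * H1); have hw := powR_ge0 `|w| (2 * H2).
  case: uw => h'.
    have : de `^ (2 * H1) <= `|u| `^ (2 * H1) by rewrite powR_le ?mulr_ge0 ?(ltW H10) ?(ltW de0).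
    have : s0 <= de `^ (2 * H1) by rewrite ge_min lexx.
    by move: hw eps0; clear; lra.
  have : de `^ (2 * H2) <= `|w| `^ (2 * H2) by rewrite powR_le ?mulr_ge0 ?(ltW H20) ?(ltW de0).
  have : s0 <= de `^ (2 * H2) by rewrite ge_min lexx orbT.
  by move: hu eps0; clear; lra.
have inE' (p q z : R) : \1_(`]p, q[%classic : set (measurableTypeR R)) z = (p < z < q)%R%:R :> R.
  by rewrite indicE mem_setE in_itv.
rewrite /near_kernel /= !inE' -!ltr_norml.
have farC : de <= `|t' - t| \/ de <= `|s' - s| -> - C2 <= Q.
  move/far => h'; have := ler_wpM2l (ltW C0) h'; rewrite -/C2; move: Qle QN; clear; lra.
have [tn|tn] := ltP `|t' - t| de; last first.
  by rewrite mul0r mulr0 sub0r; apply: farC; left.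
have [sn|sn] := ltP `|s' - s| de; last first.
  by rewrite mul0r !mulr0 sub0r; apply: farC; right.
rewrite !mul1r t0 u0 /=.
set r := rho _ in Qle *.
have r0 : 0 <= r by exact: rho0.
have [te|te] := ltP t e.
  have -> : (a < t < b) = false by apply/negbTE; rewrite negb_and -leNgt (le_trans (ltW te) ea).
  have : 0 <= (s < e)%R%:R :> R by []. 
  move: (_%:R) => g g0; rewrite mul0r mulr0 sub0r.
  have := mulr_ge0 c10 r0; have := mulr_ge0 (mulr_ge0 (ltW C0) g0) r0.
  by rewrite -[true%:R]/(1 : R); move: C20 Qle QN; clear; lra.
have [se|se] := ltP s e.
  have -> : (a < s < b) = false by apply/negbTE; rewrite negb_and -leNgt (le_trans (ltW se) ea).
  rewrite !mulr0 sub0r add0r -[true%:R]/(1 : R).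
  have := mulr_ge0 c10 r0; move: C20 Qle QN; clear; lra.
rewrite addr0 mulr0 subr0.
have tn' := ltW tn; have sn' := ltW sn.
have [||||||l1 l2] := lb' eps t s t' s' eps0 he1.
- by rewrite tT (le_trans _ te)// ler_pdivrMr// ler_peMr ?(ltW e0)// ler1n.
- by rewrite uT (le_trans _ se)// ler_pdivrMr// ler_peMr ?(ltW e0)// ler1n.
- by rewrite t'T andbT; move: tn; rewrite ltr_norml => /andP[]; move: te dee; clear; lra.
- by rewrite s'T andbT; move: sn; rewrite ltr_norml => /andP[]; move: se dee; clear; lra.
- exact: le_trans tn' ded.
- exact: le_trans sn' ded.
rewrite -/n -/rho -/r -/Q in l1 l2.
have [tab|] := boolP (a < t < b); last first.
  by rewrite mul0r mulr0 sub0r; move: l1 C20; clear; lra.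
have := l2 _; rewrite mul1r => /(_ _) l3.
have {}l3 : (c0 - tau * C) * r <= Q.
  by apply: l3; case/andP: tab => /ltW -> /ltW ->.
have g1 : (a < s < b)%R%:R <= 1 :> R by rewrite lern1 leq_b1.
have := ler_wpM2r r0 (ler_wpM2l (ltW c00) g1).
by move: l3 C20; clear; lra.
Qed.

Theorem theorem1p1 (R : realType) (dO : measure_display)
    (Omega : measurableType dO) (P : probability Omega R)
    (d : nat) (hd : (1 <= d)%N) (T : R) (hT : 0 < T)
    (H1 H2 : R) (hH1 : 0 < H1 /\ H1 < 1) (hH2 : 0 < H2 /\ H2 < 1)
    (k : 'I_d -> nat)
    (X Y : R -> 'I_d -> {RV P >-> R})
    (hX : class_G12 H1 T X) (hY : class_G12 H2 T Y)
    (hXc : continuous_paths X) (hYc : continuous_paths Y)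
    (hXY : independent_processes X Y)
    (x : 'rV[R]_d) (hx : x != 0)
    (hH : 1 <= H1 * H2 / (H1 + H2) * (2 * (order_of k)%:R + d%:R)) :
  exists c1 c2 : R, [/\ 0 < c1, 0 < c2 &
    ((c1 * expR (- (c2 * enorm x ^+ 2)))%:E
       <= limf_einf
            (fun eps : R =>
               'E_P[(fun w => `|local_time X Y k eps T x w| ^+ 2)%R]
               / (h_rate d (order_of k) H1 H2 eps)%:E)
            (0 : R)^'+)%E].
Proof.
case: hH1 => H10 _; case: hH2 => H20 _.
pose l0 : 'I_d := Ordinal hd.
have rcX := class_G12_regular_covariance l0 hT H10 hX.
have rcY := class_G12_regular_covariance l0 hT H20 hY.
case: (hX) => -[gX cX inX idX _] _; case: (hY) => -[gY cY inY idY _] _.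
have x0 : 0 < \sum_(l < d) x 0 l ^+ 2.
  rewrite lt_neqAle sumr_ge0 ?andbT; last by move=> l _; exact: sqr_ge0.
  apply: contraNneq hx => /esym /eqP; rewrite psumr_eq0; last by move=> l _; exact: sqr_ge0.
  move/allP => h; apply/eqP/rowP => l; rewrite mxE.
  by have := h l (mem_index_enum l); rewrite sqrf_eq0 => /eqP.
have det eps t t' s s' (eps0 : 0 < eps) := @pair_cov_det_gt0 _ _ _ P d X Y eps eps0 gX gY l0 t t' s s'.
have [c c0 [e0 e00 hc]] := quadruple_pair_kernel_ge hT H10 H20 rcX rcY x0 det hH.
exists c, 1; split => //; apply: (@le_trans _ _ c%:E).
  by rewrite lee_fin mul1r ler_piMr ?(ltW c0)// expR_le1 oppr_le0 sqr_ge0.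
apply: (limf_einf_ge e00) => eps eps0 epse.
rewrite (expectation_local_time2 k T x eps0 hXc hYc).
have [h0 h] := hc eps _ eps0 epse (bmf_integrand_pair k x eps0 hXc hYc)
  (fun t s t' s' t0 s0 t'0 s'0 => Rintegral_integrand_pair k x eps0 gX cX inX idX gY cY inY idY hXY l0
    (ltW t0) (ltW s0) (ltW t'0) (ltW s'0)).
by rewrite inver gt_eqF// -EFinM lee_fin ler_pdivlMr.
Qed.
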